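(* Let $W=(W_s)_{s\in[0,1]}$ be a standard linear Brownian motion, $I_1=\int_0^1W_x\,dx$, and let $M=(M_s)_{s\in[0,1]}$ be the zero area Brownian bridge, i.e. the process $W$ conditioned on $W_1=0$ and $I_1=0$. Then: (1) an anticipative representation of $M$ is $$M_s=W_s-s(3s-2)\,W_1-6s(1-s)\,I_1,\qquad 0\le s\le1,$$ i.e. the process on the right-hand side has the law of $M$; (2) a non-anticipative representation of $M$ is $$dM_s=dW'_s-\frac{4M_s}{1-s}\,ds-\frac{6J_s}{(1-s)^2}\,ds,\qquad M_0=0,\qquad 0\le s<1,$$ where $J_s=\int_0^sM_x\,dx$ and $W'$ is a standard Brownian motion; (3) the two-dimensional process $(M_s,J_s)_{s\in[0,1]}$ is a time-inhomogeneous Markov process.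
   Context: The zero area Brownian bridge is the conditioned process $W^{(A)}$ of $W$ with respect to $A=\{\delta_1,a_0\}\subset C([0,1])^*$, where $\delta_1(f)=f(1)$ and $a_0(f)=\int_0^1f(x)\,dx$. The conditioned process (defined only in law) is a continuous Gaussian process $M$ such that for all $b_1,\dots,b_n\in C([0,1])^*$ the law of $(b_1(M),\dots,b_n(M))$ is the conditional law of the Gaussian vector $(b_1(W),\dots,b_n(W))$ given $W_1=0$ and $\int_0^1W_x\,dx=0$ in the sense of Gaussian conditioning, i.e. the law of $\big(b_k(W)-\mathbb E[b_k(W)\mid W_1,I_1]\big)_{k=1}^n$. *)

(* Defs.v *)
From HB Require Import structures.
From mathcomp Require Import all_boot all_order all_algebra.
From mathcomp Require Import all_classical all_reals all_analysis.

Set Implicit Arguments.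
Unset Strict Implicit.
Unset Printing Implicit Defensive.

Import Order.TTheory GRing.Theory Num.Theory.
Import numFieldNormedType.Exports.

Local Open Scope classical_set_scope.
Local Open Scope ring_scope.

(* A real process is a family X : I -> Omega -> R; only its values at indices
   in a given set T : set I are constrained or used. *)

Definition sigma_of d (Omega : measurableType d) d' (E : measurableType d')
    (I : Type) (T : set I) (X : I -> Omega -> E) : set (set Omega) :=
  <<s \bigcup_(i in T) preimage_set_system setT (X i) measurable >>.

Definition cylinder_sigma (R : realType) (I : Type) (T : set I) :
    set (set (I -> R)) :=
  <<s \bigcup_(i in T)
        preimage_set_system setT (fun f : I -> R => f i) measurable >>.

(* For T finite this is equality of laws of random vectors; for continuous
   processes it is equality of laws on C(T), whose Borel sigma-algebra is
   generated by the evaluations. *)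
Definition same_law (R : realType) (I : Type) (T : set I)
    d (Omega : measurableType d) (P : probability Omega R) (X : I -> Omega -> R)
    d' (Omega' : measurableType d') (P' : probability Omega' R)
    (X' : I -> Omega' -> R) : Prop :=
  forall A, cylinder_sigma T A ->
    P [set w | A (X^~ w)] = P' [set w | A (X'^~ w)].

(* Z is a version of E[X | G], for G a sub-sigma-algebra. *)
Definition cond_exp (R : realType) d (Omega : measurableType d)
    (P : probability Omega R) (G : set (set Omega)) (X Z : Omega -> R) : Prop :=
  [/\ P.-integrable setT (EFin \o X),
      P.-integrable setT (EFin \o Z),
      (forall B : set R, measurable B -> G (Z @^-1` B)) &
      forall A, G A ->
        (\int[P]_(w in A) (X w)%:E = \int[P]_(w in A) (Z w)%:E)%E].

(* [normal_prob m s] has standard deviation s and is a Gaussian law only for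
   s != 0; point masses are admitted as degenerate Gaussian laws. *)
Definition gaussian_rv (R : realType) d (Omega : measurableType d)
    (P : probability Omega R) (X : Omega -> R) : Prop :=
  measurable_fun setT X /\
  exists m s : R, forall B : set R, measurable B ->
    P (X @^-1` B) = if s == 0 then \d_m B else normal_prob m s B.

Definition gaussian_process (R : realType) (T : set R)
    d (Omega : measurableType d) (P : probability Omega R)
    (X : R -> Omega -> R) : Prop :=
  forall (n : nat) (t a : 'I_n -> R), (forall k, T (t k)) ->
    gaussian_rv P (fun w => \sum_(k < n) a k * X (t k) w).

Definition continuous_process (R : realType) (T : set R)
    d (Omega : measurableType d) (X : R -> Omega -> R) : Prop :=
  (forall t, T t -> measurable_fun setT (X t)) /\
  (forall w, {within T, continuous (fun t => X t w)}).

Definition increment (R : realType) (Omega : Type) (X : R -> Omega -> R)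
    (s t : R) (w : Omega) : R := X t w - X s w.

(* Standard Brownian motion with time set T, an interval of nonnegative reals
   containing 0. *)
Definition brownian_motion (R : realType) (T : set R)
    d (Omega : measurableType d) (P : probability Omega R)
    (W : R -> Omega -> R) : Prop :=
  [/\ continuous_process T W,
      {ae P, forall w, W 0 w = 0},
      (forall s t, T s -> T t -> s < t -> forall B : set R, measurable B ->
         P (increment W s t @^-1` B) = normal_prob 0 (Num.sqrt (t - s)) B) &
      (forall s t, T s -> T t -> s < t ->
         forall (A : set Omega) (B : set R),
         sigma_of (T `&` `]-oo, s]) W A -> measurable B ->
         P (A `&` increment W s t @^-1` B) =
         (P A * P (increment W s t @^-1` B))%E)].

(* C([0,1]) is represented by functions R -> R whose restriction to [0,1] is
   continuous. The bound in [C01_dual] forces b f to depend only on the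
   restriction of f to [0,1]. *)
Definition C01 (R : realType) : set (R -> R) :=
  [set f : R -> R | {within `[0, 1], continuous f}].

Definition C01_norm (R : realType) (f : R -> R) : R :=
  sup [set `|f x| | x in `[0, 1]%classic].

Definition C01_dual (R : realType) (b : (R -> R) -> R) : Prop :=
  (forall (c : R) (f g : R -> R), C01 f -> C01 g ->
     b (fun x => c * f x + g x) = c * b f + b g) /\
  (exists K : R, forall f : R -> R, C01 f -> `|b f| <= K * C01_norm f).

(* [conditioned_process A P W P' M]: M, on (Omega', P'), has the law of W, on
   (Omega, P), conditioned on a(W) = 0 for all a in A. As versions of a
   conditional expectation are almost surely equal, the choice of Z is
   immaterial. *)
Definition conditioned_process (R : realType) (A : set ((R -> R) -> R))
    d (Omega : measurableType d) (P : probability Omega R) (W : R -> Omega -> R)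
    d' (Omega' : measurableType d') (P' : probability Omega' R)
    (M : R -> Omega' -> R) : Prop :=
  [/\ continuous_process `[0, 1] M,
      gaussian_process `[0, 1] P' M &
      forall (n : nat) (b : 'I_n -> (R -> R) -> R),
        (forall k, C01_dual (b k)) ->
        exists Z : 'I_n -> Omega -> R,
          (forall k, cond_exp P (sigma_of A (fun a w => a (W^~ w)))
                       (fun w => b k (W^~ w)) (Z k)) /\
          same_law setT P' (fun k w => b k (M^~ w))
                        P (fun k w => b k (W^~ w) - Z k w)].

Definition area (R : realType) d (Omega : measurableType d)
    (X : R -> Omega -> R) (s : R) (w : Omega) : R :=
  \int[lebesgue_measure]_(x in `[0, s]) X x w.

Definition zero_area_bridge (R : realType)
    d (Omega : measurableType d) (P : probability Omega R) (W : R -> Omega -> R)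
    d' (Omega' : measurableType d') (P' : probability Omega' R)
    (M : R -> Omega' -> R) : Prop :=
  conditioned_process
    [set (fun f => f 1); (fun f => \int[lebesgue_measure]_(x in `[0, 1]) f x)]
    P W P' M.

(* The noise is additive, so the equation
     dM = dW - 4 M / (1 - s) ds - 6 J / (1 - s)^2 ds,   M_0 = 0,
   is a pathwise integral equation on [0,1); no stochastic integral occurs. *)
Definition bridge_sde (R : realType)
    d (Omega : measurableType d) (P : probability Omega R)
    (W M : R -> Omega -> R) : Prop :=
  [/\ continuous_process `[0, 1[ M,
      {ae P, forall w, M 0 w = 0} &
      {ae P, forall w, forall s, 0 <= s < 1 ->
         M s w = W s w
           - \int[lebesgue_measure]_(u in `[0, s]) (4 * M u w / (1 - u))
           - \int[lebesgue_measure]_(u in `[0, s])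
               (6 * area M u w / (1 - u) ^+ 2)}].

(* Non-anticipativity: M_s is a functional of (W_u)_{u <= s}. *)
Definition adapted_to (R : realType) (T : set R)
    d (Omega : measurableType d) (W M : R -> Omega -> R) : Prop :=
  forall s, T s -> forall B : set R, measurable B ->
    sigma_of (T `&` `]-oo, s]) W (M s @^-1` B).

(* P[X_t in B | X_u, u <= s] = kappa s t (X_s, B) almost surely. *)
Definition markov_with (R : realType) (T : set R)
    d (Omega : measurableType d) (P : probability Omega R)
    d' (E : measurableType d') (X : R -> Omega -> E)
    (kappa : R -> R -> R.-pker E ~> E) : Prop :=
  (forall t, T t -> measurable_fun setT (X t)) /\
  (forall s t, T s -> T t -> s <= t -> forall B : set E, measurable B ->
     cond_exp P (sigma_of (T `&` `]-oo, s]) X)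
       \1_(X t @^-1` B) (fun w => fine (kappa s t (X s w) B))).

Definition markov_process (R : realType) (T : set R)
    d (Omega : measurableType d) (P : probability Omega R)
    d' (E : measurableType d') (X : R -> Omega -> E) : Prop :=
  exists kappa : R -> R -> R.-pker E ~> E, markov_with T P X kappa.

Definition time_homogeneous_markov_process (R : realType) (T : set R)
    d (Omega : measurableType d) (P : probability Omega R)
    d' (E : measurableType d') (X : R -> Omega -> E) : Prop :=
  exists q : R -> R.-pker E ~> E, markov_with T P X (fun s t => q (t - s)).

(* Main.v *)
Require Import Defs.
From HB Require Import structures.
From mathcomp Require Import all_boot all_order all_algebra.
From mathcomp Require Import all_classical all_reals all_analysis.
From mathcomp Require Import measurable_realfun ring lra.

Set Implicit Arguments.
Unset Strict Implicit.
Unset Printing Implicit Defensive.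

Import Order.TTheory GRing.Theory Num.Theory.
Import numFieldNormedType.Exports.

Local Open Scope classical_set_scope.
Local Open Scope ring_scope.

(** Everything is read off characteristic functions. Finite linear combinations
    of the values of W, and their limits (areas, Wiener integrals), are centred
    Gaussian with computable covariances, and a law, or a conditional
    expectation, is determined by the expectations of cosines of such
    combinations.

    (1) The covariances show that N is independent of (W_1, I_1), while b(W) - b(N)
    is a combination of W_1 and I_1 for every continuous functional b; such a b is
    a limit of combinations of evaluations. Hence E[b(W) | W_1, I_1] = b(W) - b(N).

    (2) On [0,1) the equation is a linear Volterra equation. It is inverted
    explicitly, path by path: M_s = W_s + \int_0^s k(s,u) W_u du, which is the
    Wiener integral of h_s(u) = 3 (1-s)^2 / (1-u)^2 - 2 (1-s) / (1-u), and
    \int_0^(min s t) h_s h_t is the covariance of the zero area bridge. Conversely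
    the noise W' is a causal functional of M, so its law is that obtained from
    the solution driven by a Brownian motion.

    (3) The part of (M_t, J_t) orthogonal to (M_s, J_s) is orthogonal to
    (M_u, J_u) for all u <= s. For the inhomogeneity, compare the transitions from
    1/2 to 1 and from 1/4 to 3/4: the first hits {0} x R almost surely, the second
    almost never, but the laws of (M, J) at 1/2 and at 1/4 have the same null
    sets. *)

(** Complex exponentials are avoided: [cos (x + phi)] with a free phase covers both sine and cosine,
    and the span of these functions is closed under products. Indicators of half lines are then
    reached by powers in the style of Bernoulli's inequality, applied to a bounded trigonometric
    polynomial, without inversion formula or tightness. A bounded weight is carried along, so that
    one uniqueness statement serves equality of laws (weight 1) and independence (a cosine or an
    indicator as weight). Gaussian families are defined by these moments alone; integrability and
    centring are recovered afterwards from the bounded variables n sin (X / n). The coefficients s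
    (3s - 2) and 6s (1 - s) are those of the regression of W_s on (W_1, I_1). The drift is singular
    at time 1. On each [0, b] with b < 1 all kernels are continuous, so existence and uniqueness
    reduce to explicit primitives in which the noise is never differentiated. *)

(** * Bounded random variables and their expectations *)

Definition Ex (R : realType) d (Omega : measurableType d)
    (P : probability Omega R) (f : Omega -> R) : R := \int[P]_w f w.

Definition bounded_mfun (R : realType) d (Omega : measurableType d)
    (f : Omega -> R) : Prop :=
  measurable_fun setT f /\ exists K : R, forall w, `|f w| <= K.

Section bounded_mfun.
Context {R : realType} {d} {Omega : measurableType d}.
Implicit Types f g : Omega -> R.

Lemma bounded_mfun_cst (c : R) : bounded_mfun (fun _ : Omega => c).
Proof. by split; [exact: measurable_cst|exists `|c|]. Qed.

Lemma bounded_mfunD f g : bounded_mfun f -> bounded_mfun g ->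
  bounded_mfun (fun w => f w + g w).
Proof.
move=> [mf [K fK]] [mg [L gL]]; split; first exact: measurable_funD.
by exists (K + L) => w; rewrite (le_trans (ler_normD _ _))// lerD.
Qed.

Lemma bounded_mfunM f g : bounded_mfun f -> bounded_mfun g ->
  bounded_mfun (fun w => f w * g w).
Proof.
move=> [mf [K fK]] [mg [L gL]]; split; first exact: measurable_funM.
by exists (K * L) => w; rewrite normrM ler_pM.
Qed.

Lemma bounded_mfunX f n : bounded_mfun f -> bounded_mfun (fun w => f w ^+ n).
Proof.
move=> bf; elim: n => [|n IH]; first exact: bounded_mfun_cst.
by under eq_fun do rewrite exprS; exact: bounded_mfunM.
Qed.

Lemma bounded_mfun_cos f : measurable_fun setT f ->
  bounded_mfun (fun w => cos (f w)).
Proof.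
move=> mf; split; last first.
  by exists 1 => w; rewrite ler_norml cos_geN1 cos_le1.
apply: measurableT_comp => //.
apply: continuous_measurable_fun; exact: continuous_cos.
Qed.

Lemma bounded_mfun_sin f : measurable_fun setT f ->
  bounded_mfun (fun w => sin (f w)).
Proof.
move=> mf; split; last first.
  by exists 1 => w; rewrite ler_norml sin_geN1 sin_le1.
apply: measurableT_comp => //.
apply: continuous_measurable_fun; exact: continuous_sin.
Qed.

Lemma bounded_mfun_indic (A : set Omega) : measurable A ->
  bounded_mfun (\1_A : Omega -> R).
Proof.
move=> mA; split; first exact: measurable_indic.
by exists 1 => w; rewrite indicE; case: (_ \in _); rewrite ?normr1 ?normr0.
Qed.

End bounded_mfun.

Lemma Rintegral_dominated_cvg (R : realType) d (Omega : measurableType d)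
    (mu : {measure set Omega -> \bar R}) (h : nat -> Omega -> R) (f g : Omega -> R) :
  (forall n, measurable_fun setT (h n)) -> measurable_fun setT f ->
  mu.-integrable setT (EFin \o g) -> (forall n w, `|h n w| <= g w) ->
  {ae mu, forall w, h n w @[n --> \oo] --> f w} ->
  \int[mu]_w h n w @[n --> \oo] --> \int[mu]_w f w.
Proof.
move=> mh mf ig hg hf; apply: fine_cvg.
have [] := @dominated_convergence _ _ _ mu setT measurableT
  (fun n w => (h n w)%:E) (EFin \o f) (EFin \o g).
- by move=> n; exact/measurable_EFinP.
- exact/measurable_EFinP.
- apply: filterS hf => w hfw _; apply: cvg_EFin => //.
  by apply: nearW.
- exact: ig.
- by apply: aeW => w n _; rewrite lee_fin.
move=> intf _ /=; rewrite /Rintegral fineK//.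
by apply: integrable_fin_num => //; rewrite -/(EFin \o f).
Qed.

Section Ex.
Context {R : realType} {d} {Omega : measurableType d}.
Variable P : probability Omega R.
Implicit Types f g : Omega -> R.

Lemma bounded_mfun_integrable f : bounded_mfun f ->
  P.-integrable setT (EFin \o f).
Proof.
move=> [mf [K fK]]; apply: measurable_bounded_integrable => //.
  by rewrite (le_lt_trans (probability_le1 _ _))// ltry.
by exists K; split; [exact: num_real|move=> M KM w _ /=; exact/ltW/(le_lt_trans (fK w))].
Qed.

Lemma Ex_cst (c : R) : Ex P (fun=> c) = c.
Proof.
rewrite /Ex Rintegral_cst//.
by rewrite -[RHS]mulr1; congr (_ * _); exact: (congr1 fine (probability_setT P)).
Qed.

Lemma ExD f g : bounded_mfun f -> bounded_mfun g ->
  Ex P (fun w => f w + g w) = Ex P f + Ex P g.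
Proof. by move=> bf bg; apply: RintegralD => //; exact: bounded_mfun_integrable. Qed.

Lemma ExB f g : bounded_mfun f -> bounded_mfun g ->
  Ex P (fun w => f w - g w) = Ex P f - Ex P g.
Proof. by move=> bf bg; apply: RintegralB => //; exact: bounded_mfun_integrable. Qed.

Lemma ExZ (c : R) f : bounded_mfun f -> Ex P (fun w => c * f w) = c * Ex P f.
Proof. by move=> bf; apply: RintegralZl => //; exact: bounded_mfun_integrable. Qed.

Lemma Ex_indic (A : set Omega) : measurable A -> Ex P \1_A = fine (P A).
Proof. by move=> mA; rewrite /Ex /Rintegral integral_indic// setIT. Qed.

Lemma Ex_mul_indic f (A : set Omega) :
  Ex P (fun w => f w * \1_A w) = \int[P]_(w in A) f w.
Proof.
rewrite /Ex [RHS]Rintegral_mkcond; apply: eq_Rintegral => w _.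
by rewrite patchE indicE; case: (w \in A); rewrite ?mulr1 ?mulr0.
Qed.

Lemma Ex_cvg (h : nat -> Omega -> R) f (K : R) :
  (forall n, measurable_fun setT (h n)) -> measurable_fun setT f ->
  (forall n w, `|h n w| <= K) ->
  {ae P, forall w, h n w @[n --> \oo] --> f w} ->
  Ex P (h n) @[n --> \oo] --> Ex P f.
Proof.
move=> mh mf hK hf; apply: (@Rintegral_dominated_cvg _ _ _ _ _ _ (cst K)) => //.
exact/bounded_mfun_integrable/bounded_mfun_cst.
Qed.

End Ex.

(** * Indicators as limits of polynomials and of sines *)

(** Bernoulli's inequality, and the companion that follows from (1 - x) (1 + (n + 1) x) <= 1 + n x;
    the latter bounds (1 - x)^n by 1 / (1 + n x). *)
Lemma bernoulli_bounds (R : realFieldType) (x : R) n : 0 <= x <= 1 ->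
  1 - x *+ n <= (1 - x) ^+ n /\ (1 - x) ^+ n * (1 + x *+ n) <= 1.
Proof.
move=> /andP[x0 x1]; elim: n => [|n [IH1 IH2]].
  by rewrite mulr0n subr0 addr0 expr0 mulr1.
have pn : 0 <= (1 - x) ^+ n by rewrite exprn_ge0// subr_ge0.
have pm : 0 <= x *+ n by rewrite mulrn_wge0.
rewrite exprSr mulrSr; split.
  have h := ler_wpM2r (_ : 0 <= 1 - x) IH1.
  rewrite (le_trans _ (h _)) ?subr_ge0//.
  by rewrite mulrBl mul1r mulrBr mulr1; nra.
rewrite (le_trans _ IH2)// -mulrA ler_wpM2l//.
by nra.
Qed.

(** A polynomial in u that approximates the indicator of u < 1/2 on [0, 1]. The exponent is tuned so
    that u^k times it equals k (2u)^k: this tends to 0 below 1/2 and is at least k from 1/2 on. The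
    factor k decides the value at u = 1/2 itself. *)
Definition bernoulli_step (R : realType) (k : nat) (u : R) : R :=
  (1 - u ^+ k) ^+ (k * 2 ^ k).

Lemma bernoulli_step_bounds (R : realType) k (u : R) : 0 <= u <= 1 ->
  0 <= bernoulli_step k u <= 1.
Proof.
move=> /andP[u0 u1]; have uk : 0 <= 1 - u ^+ k <= 1.
  by rewrite subr_ge0 exprn_ile1//= lerBlDr lerDl exprn_ge0.
by case/andP: uk => *; rewrite exprn_ge0 ?exprn_ile1.
Qed.

Lemma cvg_mulrn_geometric (R : realType) (x : R) : 0 <= x < 1 ->
  x ^+ n *+ n @[n --> \oo] --> 0.
Proof.
case/andP; rewrite le_eqVlt => /predU1P[<- _|x0 x1].
  by apply: cvg_near_cst; apply: nearW => -[|n]; rewrite ?mulr0n// expr0n mul0rn.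
(* With x = y^2 the term n x^n is (n y^n) y^n: the first factor is bounded by the companion
   inequality at 1 - y, the second tends to 0. *)
pose y := Num.sqrt x.
have y0 : 0 < y by rewrite sqrtr_gt0.
have xE : x = y * y by rewrite -expr2 sqr_sqrtr// ltW.
have y1 : y < 1 by nra.
have yn n : y ^+ n *+ n <= (1 - y)^-1.
  have [] := @bernoulli_bounds _ (1 - y) n; first by lra.
  rewrite (_ : 1 - (1 - y) = y); last by ring.
  have yn0 : 0 < y ^+ n by rewrite exprn_gt0.
  move=> _ h; rewrite -[leRHS]mul1r ler_pdivlMr ?subr_gt0//.
  by move: h; rewrite mulrDr mulr1 mulrnAr mulrnAl; lra.
apply: (@squeeze_cvgr _ _ _ _ (cst 0) (fun n => (1 - y)^-1 * y ^+ n)).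
- near=> n; rewrite /= mulrn_wge0 ?exprn_ge0 ?(ltW x0)//=.
  by rewrite xE exprMn -mulrnAl ler_wpM2r// exprn_ge0// ltW.
- exact: cvg_cst.
- rewrite -[X in _ --> X](mulr0 (1 - y)^-1); apply: cvgMr.
  have := @cvg_geometric R 1 y; rewrite ger0_norm ?ltW// => /(_ y1).
  by apply: cvg_trans; apply: near_eq_cvg; near=> n; rewrite /geometric/= mul1r.
Unshelve. all: by end_near. Qed.

Lemma cvg_bernoulli_step (R : realType) (u : R) : 0 <= u <= 1 ->
  bernoulli_step k u @[k --> \oo] --> ((u < 2^-1)%R%:R : R).
Proof.
move=> /andP[u0 u1]; have u01 : 0 <= u <= 1 by rewrite u0.
have uk k : 0 <= u ^+ k <= 1 by rewrite exprn_ge0 ?exprn_ile1.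
have [uh|uh] := ltP u 2^-1.
  apply: (@squeeze_cvgr _ _ _ _ (fun k => 1 - (u * 2) ^+ k *+ k) (cst 1)).
  - near=> k; rewrite (andP (bernoulli_step_bounds k u01)).2 andbT.
    have [h _] := bernoulli_bounds (k * 2 ^ k) (uk k).
    rewrite (le_trans _ h)// lerD2l lerN2.
    by rewrite mulnC mulrnA exprMn -natrX mulr_natr.
  - rewrite -[X in _ --> X](subr0 (1:R)); apply: cvgB; first exact: cvg_cst.
    by apply: cvg_mulrn_geometric; lra.
  - exact: cvg_cst.
apply: (@squeeze_cvgr _ _ _ _ (cst 0) (fun k => (1 + k%:R)^-1)).
- near=> k; rewrite /= (andP (bernoulli_step_bounds k u01)).1 /=.
  have [_ h] := bernoulli_bounds (k * 2 ^ k) (uk k).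
  rewrite -[leRHS]mul1r ler_pdivlMr ?ltr_wpDr//.
  rewrite (le_trans _ h)// ler_wpM2l ?(andP (bernoulli_step_bounds k u01)).1//.
  rewrite lerD2l mulnC mulrnA -[u ^+ k *+ _]mulr_natr natrX -exprMn.
  by apply: ler_wMn2r; apply: exprn_ege1; lra.
- exact: cvg_cst.
- by under eq_fun do rewrite nat1r; exact: cvg_harmonic.
Unshelve. all: by end_near. Qed.

(** As soon as |x| / (n + 1) < 1, the sine has the sign of its argument. A bounded trigonometric
    function thus detects the sign of an unbounded variable. *)
Lemma cvg_lt_sin (R : realType) (x : R) :
  (sin (x / n.+1%:R) < 0)%R%:R @[n --> \oo] --> ((x < 0)%R%:R : R).
Proof.
apply: cvg_near_cst; near=> n; congr (_ _)%:R.
have n0 : 0 < n.+1%:R :> R by rewrite ltr0n.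
have xn : `|x / n.+1%:R| < 1.
  rewrite normrM normfV (gtr0_norm n0) ltr_pdivrMr// mul1r.
  rewrite (@lt_trans _ _ n%:R) ?ltr_nat//.
  by near: n; exact: nbhs_infty_gtr.
have [x0|x0|->] := ltgtP x 0; last by rewrite mul0r sin0 ltxx.
- have : x / n.+1%:R < 0 by rewrite pmulr_llt0 ?invr_gt0.
  move: xn; move: (x / _) => y; rewrite ltr_norml => /andP[y1 _] y0.
  by rewrite -[y]opprK sinN oppr_lt0 sin2_gt0//; apply/andP; split; lra.
- have : 0 < x / n.+1%:R by rewrite pmulr_lgt0 ?invr_gt0.
  move: xn; move: (x / _) => y; rewrite ltr_norml => /andP[_ y1] y0.
  by apply/negbTE; rewrite -leNgt ltW// sin2_gt0//; apply/andP; split; lra.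
Unshelve. all: by end_near. Qed.

(** * Trigonometric moments and laws *)

Definition lin (R : realType) (I : Type) (s : seq (R * I)) (f : I -> R) : R :=
  \sum_(p <- s) p.1 * f p.2.

Definition supported (R : Type) (I : Type) (T : set I) (s : seq (R * I)) : bool :=
  all (fun p => p.2 \in T) s.

Definition scale_comb (R : realType) (I : Type) (c : R) (s : seq (R * I)) :=
  [seq (c * p.1, p.2) | p <- s].

Section lin.
Context {R : realType} {I : Type}.
Implicit Types (s r : seq (R * I)) (f : I -> R) (T : set I).

Lemma lin_nil f : lin [::] f = 0. Proof. by rewrite /lin big_nil. Qed.

Lemma lin_cons p s f : lin (p :: s) f = p.1 * f p.2 + lin s f.
Proof. by rewrite /lin big_cons. Qed.

Lemma lin_seq1 p f : lin [:: p] f = p.1 * f p.2.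
Proof. by rewrite /lin big_seq1. Qed.

Lemma lin_cat s r f : lin (s ++ r) f = lin s f + lin r f.
Proof. by rewrite /lin big_cat. Qed.

Lemma lin_scale c s f : lin (scale_comb c s) f = c * lin s f.
Proof.
by rewrite /lin big_map mulr_sumr; apply: eq_bigr => p _; rewrite /= mulrA.
Qed.

Lemma supported_cat T s r :
  supported T (s ++ r) = supported T s && supported T r.
Proof. exact: all_cat. Qed.

Lemma supported_scale T c s : supported T (scale_comb c s) = supported T s.
Proof. by rewrite /supported all_map. Qed.

Lemma supportedP T i s : supported T (i :: s) <-> T i.2 /\ supported T s.
Proof. by rewrite /supported /= ; split => [/andP[/set_mem]|[/mem_set ->]]. Qed.

Lemma eq_lin T s f f' : supported T s -> (forall i, T i -> f i = f' i) ->
  lin s f = lin s f'.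
Proof.
move=> + h; elim: s => [|p s IH]; first by rewrite !lin_nil.
by move/supportedP => [Tp Ts]; rewrite !lin_cons IH// h.
Qed.

Lemma measurable_lin d (Omega : measurableType d) T s (Y : I -> Omega -> R) :
  (forall i, T i -> measurable_fun setT (Y i)) -> supported T s ->
  measurable_fun setT (fun w => lin s (Y^~ w)).
Proof.
move=> mY; elim: s => [|p s IH].
  by move=> _; under eq_fun do rewrite lin_nil; exact: measurable_cst.
move/supportedP => [Tp Ts]; under eq_fun do rewrite lin_cons.
apply: measurable_funD; last exact: IH.
by apply: measurable_funM => //; exact: mY.
Qed.

End lin.

(** The phase makes sines a special case of cosines, so that this real span is an algebra
    ([trig_mul]), as the span of complex exponentials would be. *)
Inductive trig_poly (R : realType) (I : Type) (T : set I) :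
    ((I -> R) -> R) -> Prop :=
| trig_cos s (phi : R) : supported T s ->
    trig_poly T (fun f => cos (lin s f + phi))
| trig_add h g : trig_poly T h -> trig_poly T g ->
    trig_poly T (fun f => h f + g f)
| trig_scale c h : trig_poly T h -> trig_poly T (fun f => c * h f).

Section trig_poly.
Context {R : realType} {I : Type} {T : set I}.
Implicit Types h g : (I -> R) -> R.

Lemma trig_cst (c : R) : trig_poly T (fun _ => c).
Proof.
rewrite (_ : (fun _ => c) = (fun f => c * cos (lin [::] f + 0))); last first.
  by apply/funext => f; rewrite lin_nil addr0 cos0 mulr1.
by apply: trig_scale; exact: trig_cos.
Qed.

Lemma cosM_half (x y : R) :
  cos x * cos y = 2^-1 * (cos (x + y) + cos (x - y)).
Proof. by rewrite cosB cosD; field. Qed.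

Lemma trig_mul h g : trig_poly T h -> trig_poly T g ->
  trig_poly T (fun f => h f * g f).
Proof.
move=> th tg; elim: th => {h} [s phi sT|h1 h2 _ IH1 _ IH2|c h _ IH].
- elim: tg => {g} [r psi rT|g1 g2 _ IH1 _ IH2|c g _ IH].
  + under eq_fun do rewrite cosM_half.
    apply: trig_scale; apply: trig_add.
      rewrite (_ : (fun _ => _) = (fun f => cos (lin (s ++ r) f + (phi + psi)))).
        by apply: trig_cos; rewrite supported_cat sT.
      by apply/funext => f; rewrite lin_cat addrACA.
    rewrite (_ : (fun _ => _) =
        (fun f => cos (lin (s ++ scale_comb (- 1) r) f + (phi - psi)))).
      by apply: trig_cos; rewrite supported_cat supported_scale sT.
    by apply/funext => f; rewrite lin_cat lin_scale mulN1r opprD addrACA.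
  + by under eq_fun do rewrite mulrDr; exact: trig_add.
  + by under eq_fun do rewrite mulrCA; exact: trig_scale.
- by under eq_fun do rewrite mulrDl; exact: trig_add.
- by under eq_fun do rewrite -mulrA; exact: trig_scale.
Qed.

Lemma trig_exp h n : trig_poly T h -> trig_poly T (fun f => h f ^+ n).
Proof.
move=> th; elim: n => [|n IH]; first exact: trig_cst.
by under eq_fun do rewrite exprS; exact: trig_mul.
Qed.

Lemma trig_sin s (phi : R) : supported T s ->
  trig_poly T (fun f => sin (lin s f + phi)).
Proof.
move=> sT; rewrite (_ : (fun _ => _) = (fun f => cos (lin s f + (phi - pi / 2)))).
  exact: trig_cos.
by apply/funext => f; rewrite addrA -[in LHS](subrK (pi/2) (lin s f + phi)) sinDpihalf.
Qed.

Lemma trig_bernoulli_step k h : trig_poly T h ->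
  trig_poly T (fun f => bernoulli_step k (h f)).
Proof.
move=> th; apply: trig_exp; apply: trig_add; first exact: trig_cst.
under eq_fun do rewrite -mulN1r; apply: trig_scale; exact: trig_exp.
Qed.

Lemma bounded_trig d (Omega : measurableType d) h (Y : I -> Omega -> R) :
  (forall i, T i -> measurable_fun setT (Y i)) -> trig_poly T h ->
  bounded_mfun (fun w => h (Y^~ w)).
Proof.
move=> mY; elim => {h} [s phi sT|h1 h2 _ IH1 _ IH2|c h _ IH].
- by apply: bounded_mfun_cos; apply: measurable_funD => //; exact: measurable_lin mY sT.
- exact: bounded_mfunD.
- by apply: bounded_mfunM => //; exact: bounded_mfun_cst.
Qed.

End trig_poly.

Definition box_indic (R : realType) (I : Type) (J : seq (I * R)) (f : I -> R) : R :=
  \prod_(p <- J) (f p.1 < p.2)%R%:R.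

Lemma bounded_box_indic (R : realType) (I : Type) (T : set I) d
    (Omega : measurableType d) J (Y : I -> Omega -> R) :
  (forall i, T i -> measurable_fun setT (Y i)) ->
  all (fun p => p.1 \in T) J -> bounded_mfun (fun w => box_indic J (Y^~ w)).
Proof.
move=> mY; rewrite /box_indic; elim: J => [|p J IH] /=.
  by move=> _; under eq_fun do rewrite big_nil; exact: bounded_mfun_cst.
move=> /andP[/set_mem Tp TJ]; under eq_fun do rewrite big_cons.
apply: bounded_mfunM; last exact: IH.
rewrite (_ : (fun _ => _) = \1_[set w | Y p.1 w < p.2]); last first.
  by apply/funext => w; rewrite indicE; case: (boolP (_ < _)) => h;
    [rewrite mem_set|rewrite memNset//; exact/negP].
apply: bounded_mfun_indic; rewrite -[X in measurable X]setTI.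
have := mY _ Tp measurableT `]-oo, p.2[%classic (measurable_itv _).
by congr measurable; apply/seteqP; split => x/=; rewrite in_itv.
Qed.

Section trig_extension.
Context {R : realType} {I : Type} {T : set I}.
Context {d} {Omega : measurableType d} {P : probability Omega R}
  {Y : I -> Omega -> R} {U : Omega -> R}.
Context {d'} {Omega' : measurableType d'} {P' : probability Omega' R}
  {Y' : I -> Omega' -> R} {U' : Omega' -> R}.
Hypothesis mY : forall i, T i -> measurable_fun setT (Y i).
Hypothesis mY' : forall i, T i -> measurable_fun setT (Y' i).
Hypothesis bU : bounded_mfun U.
Hypothesis bU' : bounded_mfun U'.
Hypothesis trig_eq : forall s phi, supported T s ->
  Ex P (fun w => U w * cos (lin s (Y^~ w) + phi)) =
  Ex P' (fun w => U' w * cos (lin s (Y'^~ w) + phi)).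

Let Exeq (h : (I -> R) -> R) :=
  Ex P (fun w => U w * h (Y^~ w)) = Ex P' (fun w => U' w * h (Y'^~ w)).

Lemma Exeq_trig h : trig_poly T h -> Exeq h.
Proof.
elim => {h} [s phi sT|h1 h2 t1 IH1 t2 IH2|c h t IH].
- exact: trig_eq.
- rewrite /Exeq.
  under eq_fun do rewrite mulrDr.
  under [in RHS]eq_fun do rewrite mulrDr.
  by rewrite !ExD; first (by congr (_ + _)); apply: bounded_mfunM => //;
    (exact: bounded_trig t1 || exact: bounded_trig t2).
- rewrite /Exeq.
  under eq_fun do rewrite mulrCA.
  under [in RHS]eq_fun do rewrite mulrCA.
  by rewrite !ExZ; first (by congr (_ * _)); apply: bounded_mfunM => //;
    exact: bounded_trig t.
Qed.

Lemma Exeq_lim (h : nat -> (I -> R) -> R) g (K : R) :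
  (forall n, Exeq (h n)) ->
  (forall n, bounded_mfun (fun w => h n (Y^~ w))) ->
  (forall n, bounded_mfun (fun w => h n (Y'^~ w))) ->
  (forall n f, `|h n f| <= K) ->
  (forall f, h n f @[n --> \oo] --> g f) -> Exeq g.
Proof.
move=> hE bh bh' hK hg.
have [mU [L UL]] := bU; have [mU' [L' UL']] := bU'.
have c1 : Ex P (fun w => U w * h n (Y^~ w)) @[n --> \oo] -->
    Ex P (fun w => U w * g (Y^~ w)).
  apply: (@Ex_cvg _ _ _ _ _ _ (L * K)).
  - by move=> n; apply: measurable_funM => //; case: (bh n).
  - apply: measurable_funM => //; apply: (@measurable_fun_cvg _ _ _ _ (fun n w => h n (Y^~ w))) => [n|w _].
      by case: (bh n).
    exact: hg.
  - by move=> n w; rewrite normrM ler_pM.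
  - by apply: aeW => w; apply: cvgMr; exact: hg.
have c2 : Ex P' (fun w => U' w * h n (Y'^~ w)) @[n --> \oo] -->
    Ex P' (fun w => U' w * g (Y'^~ w)).
  apply: (@Ex_cvg _ _ _ _ _ _ (L' * K)).
  - by move=> n; apply: measurable_funM => //; case: (bh' n).
  - apply: measurable_funM => //; apply: (@measurable_fun_cvg _ _ _ _ (fun n w => h n (Y'^~ w))) => [n|w _].
      by case: (bh' n).
    exact: hg.
  - by move=> n w; rewrite normrM ler_pM.
  - by apply: aeW => w; apply: cvgMr; exact: hg.
move: c1; under eq_fun do rewrite hE.
by move=> c1; apply: (cvg_unique _ c1 c2).
Qed.

Lemma trig_poly_bounded (h : (I -> R) -> R) : trig_poly T h -> exists K, forall f, `|h f| <= K.
Proof.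
elim => {h} [s phi sT|h1 h2 _ [K1 h1K] _ [K2 h2K]|c h _ [K hK]].
- by exists 1 => f; rewrite ler_norml cos_geN1 cos_le1.
- by exists (K1 + K2) => f; rewrite (le_trans (ler_normD _ _))// lerD.
- by exists (`|c| * K) => f; rewrite normrM ler_wpM2l.
Qed.

Lemma box_indic_bound (J : seq (I * R)) f : `|box_indic J f| <= 1.
Proof.
rewrite /box_indic; elim: J => [|p J IH]; first by rewrite big_nil normr1.
rewrite big_cons normrM (le_trans _ IH)// ler_piMl//.
by case: (_ < _); rewrite ?normr1 ?normr0.
Qed.

(** Induction on the constraints. The factor [h] stays arbitrary so that the new constraint can be
    absorbed in it: [bernoulli_step k (u n f)] is again a trigonometric polynomial, the induction
    hypothesis applies, and k, then n, are sent to infinity by bounded convergence. *)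
Lemma Exeq_trig_box J h : all (fun p => p.1 \in T) J -> trig_poly T h ->
  Exeq (fun f => h f * box_indic J f).
Proof.
elim: J h => [|[i c] J IH] h /=.
  move=> _ th; rewrite /box_indic.
  rewrite (_ : (fun _ => _) = h); first exact: Exeq_trig.
  by apply/funext => f; rewrite big_nil mulr1.
move=> /andP[iT JT] th.
have [K hK] := trig_poly_bounded th.
(* The sine is rescaled to [0, 1], the domain of [bernoulli_step]; the threshold 1/2 then
   corresponds to a vanishing sine. *)
pose u n (f : I -> R) := (1 + sin ((f i - c) / n.+1%:R)) / 2.
have u01 n f : 0 <= u n f <= 1.
  have := sin_geN1 ((f i - c) / n.+1%:R); have := sin_le1 ((f i - c) / n.+1%:R).
  by rewrite /u; lra.
have tu n : trig_poly T (u n).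
  rewrite /u; under eq_fun do rewrite mulrC.
  apply: trig_scale; apply: trig_add; first exact: trig_cst.
  rewrite (_ : (fun _ => _) =
    (fun f => sin (lin [:: (n.+1%:R^-1, i)] f + (- c / n.+1%:R)))).
    by apply: trig_sin; rewrite /supported/= iT.
  by apply/funext => f; rewrite lin_seq1/= mulrBl mulrC mulNr.
have bb : bounded_mfun (fun w => box_indic J (Y^~ w)).
  exact: bounded_box_indic JT.
have bb' : bounded_mfun (fun w => box_indic J (Y'^~ w)).
  exact: bounded_box_indic JT.
have bs (e : R) : 0 <= e <= 1 -> `|e| <= 1.
  by move=> /andP[e0 e1]; rewrite ger0_norm.
have K0 : 0 <= K by exact: le_trans (hK (fun=> 0)).
have bound f (e : R) : 0 <= e <= 1 -> `|h f * e * box_indic J f| <= K.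
  move=> e01; rewrite 2!normrM -[leRHS]mulr1 ler_pM// ?box_indic_bound//.
  by rewrite -[leRHS]mulr1 ler_pM// bs.
have step n : Exeq (fun f => h f * (u n f < 2^-1)%R%:R * box_indic J f).
  apply: (@Exeq_lim (fun k f => h f * bernoulli_step k (u n f) * box_indic J f) _ K).
  - by move=> k; apply: IH => //; apply: trig_mul => //; exact: trig_bernoulli_step.
  - by move=> k; apply: bounded_mfunM => //; apply: (@bounded_trig _ _ _ _ _ (fun f => h f * bernoulli_step k (u n f)) _ mY);
      apply: trig_mul => //; exact: trig_bernoulli_step.
  - by move=> k; apply: bounded_mfunM => //; apply: (@bounded_trig _ _ _ _ _ (fun f => h f * bernoulli_step k (u n f)) _ mY');
      apply: trig_mul => //; exact: trig_bernoulli_step.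
  - by move=> k f; apply: bound; exact: bernoulli_step_bounds.
  - by move=> f; apply: cvgMl; apply: cvgMr; exact: (cvg_bernoulli_step (u01 n f)).
have uE n f : (u n f < 2^-1) = (sin ((f i - c) / n.+1%:R) < 0).
  by rewrite /u; apply/idP/idP => ?; lra.
apply: (@Exeq_lim (fun n f => h f * (u n f < 2^-1)%R%:R * box_indic J f) _ K).
- exact: step.
- move=> n; apply: bounded_mfunM => //; apply: bounded_mfunM.
    exact: bounded_trig th.
  have [mu _] := bounded_trig mY (tu n).
  rewrite (_ : (fun _ => _) = \1_[set w | u n (Y^~ w) < 2^-1]); last first.
    by apply/funext => w; rewrite indicE; case: (boolP (_ < _)) => l;
      [rewrite mem_set|rewrite memNset//; exact/negP].
  apply: bounded_mfun_indic; rewrite -[X in measurable X]setTI.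
  have := mu measurableT `]-oo, 2^-1[%classic (measurable_itv _).
  by congr measurable; apply/seteqP; split => x/=; rewrite in_itv.
- move=> n; apply: bounded_mfunM => //; apply: bounded_mfunM.
    exact: bounded_trig th.
  have [mu _] := bounded_trig mY' (tu n).
  rewrite (_ : (fun _ => _) = \1_[set w | u n (Y'^~ w) < 2^-1]); last first.
    by apply/funext => w; rewrite indicE; case: (boolP (_ < _)) => l;
      [rewrite mem_set|rewrite memNset//; exact/negP].
  apply: bounded_mfun_indic; rewrite -[X in measurable X]setTI.
  have := mu measurableT `]-oo, 2^-1[%classic (measurable_itv _).
  by congr measurable; apply/seteqP; split => x/=; rewrite in_itv.
- by move=> n f; apply: bound; case: (_ < _); rewrite ?lexx ?ler01.
- move=> f; rewrite /box_indic big_cons mulrA; apply: cvgMl; apply: cvgMr.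
  under eq_fun do rewrite uE.
  by rewrite -subr_lt0; exact: cvg_lt_sin.
Qed.

End trig_extension.

Definition box (R : realType) (I : Type) (J : seq (I * R)) : set (I -> R) :=
  [set f | all (fun p => f p.1 < p.2) J].

Lemma indic_box (R : realType) (I : Type) (J : seq (I * R)) f :
  \1_(box J) f = box_indic J f.
Proof.
rewrite indicE /box_indic /box; elim: J => [|p J IH].
  by rewrite big_nil mem_set.
rewrite big_cons -IH; case: (ltP (f p.1) p.2) => h; rewrite ?mul1r ?mul0r.
  by congr (_%:R); congr nat_of_bool; apply/idP/idP => /set_mem/=; rewrite ?h => l;
    apply/mem_set => /=; rewrite ?h.
by rewrite memNset//= ltNge h.
Qed.

Lemma setI_closed_boxes (R : realType) (I : Type) (T : set I) :
  setI_closed [set box J | J in [set J : seq (I * R) | all (fun p => p.1 \in T) J]].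
Proof.
move=> _ _ [J1 /= T1 <-] [J2 /= T2 <-]; exists (J1 ++ J2).
  by rewrite /= all_cat T1.
by apply/seteqP; split => f; rewrite /box/= all_cat => /andP.
Qed.

(* Borel sets of the line are generated by the open left rays. *)
Lemma cylinder_sub_boxes (R : realType) (I : Type) (T : set I) :
  @cylinder_sigma R I T `<=`
  <<s [set box J | J in [set J : seq (I * R) | all (fun p => p.1 \in T) J]] >>.
Proof.
apply: smallest_sub; first exact: smallest_sigma_algebra.
move=> _ [i Ti [B mB <-]]; rewrite setTI.
set G := <<s _ >>.
have sG : sigma_algebra setT G by exact: smallest_sigma_algebra.
have : (R.-ocitv.-measurable).-sigma.-measurable B by [].
rewrite RGenInftyO.measurableE => +.
have : sigma_algebra setT [set B : set R | G ((fun f : I -> R => f i) @^-1` B)].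
  have [G0 GC GU] := sG; split => /=.
  - by rewrite preimage_set0.
  - by move=> A GA; rewrite setTD preimage_setC -setTD; exact: GC.
  - by move=> F GF; rewrite preimage_bigcup; exact: GU.
move=> sB; apply: (smallest_sub sB) => {mB}B [c ->] /=.
apply: sub_sigma_algebra; exists [:: (i, c)] => /=; first by rewrite mem_set.
by apply/seteqP; split => f; rewrite /box/= in_itv/= andbT.
Qed.

Lemma measurable_cylinder (R : realType) (I : Type) (T : set I) d
    (Omega : measurableType d) (Y : I -> Omega -> R) A :
  (forall i, T i -> measurable_fun setT (Y i)) ->
  cylinder_sigma T A -> measurable [set w | A (Y^~ w)].
Proof.
move=> mY; pose G := [set A : set (I -> R) | measurable [set w | A (Y^~ w)]].
have sG : sigma_algebra setT G.
  split; rewrite /G/=.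
  - by rewrite (_ : [set _ | _] = set0)//.
  - move=> B mB; rewrite (_ : [set _ | _] = ~` [set w | B (Y^~ w)]).
      exact: measurableC.
    by apply/seteqP; split => w /= => [[]|].
  - move=> F mF.
    rewrite (_ : [set _ | _] = \bigcup_n [set w | F n (Y^~ w)])//.
    exact: bigcupT_measurable.
apply: (smallest_sub sG) => _ [i Ti [B mB <-]]; rewrite /G/=.
rewrite (_ : [set _ | _] = setT `&` Y i @^-1` B); first exact: mY.
by apply/seteqP; split => w.
Qed.

Lemma sum_indic_trivIset (R : realType) (S : Type) (F : nat -> set S) (x : S) k n :
  trivIset setT F -> F k x ->
  \sum_(i < n) \1_(F i) x = (k < n)%N%:R :> R.
Proof.
move=> tF Fk; elim: n => [|n IH]; first by rewrite big_ord0.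
rewrite big_ord_recr/= IH indicE ltnS [(k <= n)%N]leq_eqVlt.
have [kE|kn] := eqVneq k n.
  by move=> {IH}; subst k; rewrite ltnn add0r mem_set.
rewrite /= memNset ?addr0// => Fn.
by move/eqP: kn; apply; apply: (tF k n) => //; exists x.
Qed.

Lemma cvg_sum_indic (R : realType) (S : Type) (F : nat -> set S) (x : S) :
  trivIset setT F ->
  \sum_(i < n) \1_(F i) x @[n --> \oo] --> (\1_(\bigcup_n F n) x : R).
Proof.
move=> tF; have [[k _ Fk]|nF] := pselect ((\bigcup_n F n) x).
  apply: cvg_near_cst; near=> n.
  rewrite (sum_indic_trivIset _ _ tF Fk) indicE mem_set; last by exists k.
  by congr (_ _)%:R; near: n; exact: nbhs_infty_gt.
apply: cvg_near_cst; apply: nearW => n.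
rewrite indicE memNset// big1// => i _; rewrite indicE memNset// => Fi.
by apply: nF; exists i.
Unshelve. all: by end_near. Qed.

Section cylinder_extension.
Context {R : realType} {I : Type} {T : set I}.
Context {d} {Omega : measurableType d} {P : probability Omega R}
  {Y : I -> Omega -> R} {U : Omega -> R}.
Context {d'} {Omega' : measurableType d'} {P' : probability Omega' R}
  {Y' : I -> Omega' -> R} {U' : Omega' -> R}.

Hypothesis mY : forall i, T i -> measurable_fun setT (Y i).
Hypothesis mY' : forall i, T i -> measurable_fun setT (Y' i).
Hypothesis bU : bounded_mfun U.
Hypothesis bU' : bounded_mfun U'.
Hypothesis trig_eq : forall s phi, supported T s ->
  Ex P (fun w => U w * cos (lin s (Y^~ w) + phi)) =
  Ex P' (fun w => U' w * cos (lin s (Y'^~ w) + phi)).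

(** Dynkin's argument: the boxes are stable under intersection and generate the cylinder events, and
    the events with equal weighted expectations form a Dynkin system. Measurability is part of [G]
    because the expectations are only additive for measurable events. *)
Lemma Ex_cylinder_eq A : cylinder_sigma T A ->
  Ex P (fun w => U w * \1_[set w | A (Y^~ w)] w) =
  Ex P' (fun w => U' w * \1_[set w | A (Y'^~ w)] w).
Proof.
move=> TA; have := cylinder_sub_boxes TA.
rewrite -(setI_closed_g_dynkin_g_sigma_algebra (@setI_closed_boxes R I T)).
pose G := [set A : set (I -> R) | [/\ measurable [set w | A (Y^~ w)],
  measurable [set w | A (Y'^~ w)] &
  Ex P (fun w => U w * \1_[set w | A (Y^~ w)] w) =
  Ex P' (fun w => U' w * \1_[set w | A (Y'^~ w)] w)]].
(* The empty combination with phase 0 has cosine 1, so the total weights agree; stability under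
   complements rests on this. *)
have UE : Ex P U = Ex P' U'.
  have := @trig_eq [::] 0 isT.
  under eq_fun do rewrite lin_nil addr0 cos0 mulr1.
  by under [in RHS]eq_fun do rewrite lin_nil addr0 cos0 mulr1.
suff [sG bG] : dynkin G /\
    [set box J | J in [set J : seq (I * R) | all (fun p => p.1 \in T) J]] `<=` G.
  by move=> /(smallest_sub sG bG)[].
split; last first.
  move=> _ [J TJ <-]; have cJ : @cylinder_sigma R I T (box J).
    have [G0 GC GU] : sigma_algebra setT (@cylinder_sigma R I T).
      exact: smallest_sigma_algebra.
    elim: J TJ => [|[i c] J IH] /=.
      by move=> _; rewrite (_ : box _ = setT `\` set0); [exact: GC|rewrite setD0; apply/seteqP].
    move=> /andP[/set_mem Ti TJ].
    rewrite (_ : box _ = (fun f => f i) @^-1` `]-oo, c[ `&` box J); last first.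
      by apply/seteqP; split => f; rewrite /box/= in_itv/=; [move/andP|case=> -> ->].
    apply: (@measurableI _ (g_sigma_algebraType (\bigcup_(i in T)
      preimage_set_system setT (fun f : I -> R => f i) measurable))); last exact: IH.
    apply: sub_sigma_algebra; exists i => //; exists `]-oo, c[%classic => //.
    by rewrite setTI.
  split; [exact: (measurable_cylinder (A:=box J) mY)|exact: (measurable_cylinder (A:=box J) mY')|].
  have := Exeq_trig_box mY mY' bU bU' trig_eq TJ (trig_cst 1).
  under eq_fun do rewrite mul1r -indic_box.
  by under [in RHS]eq_fun do rewrite mul1r -indic_box.
split.
- split; [exact: measurableT|exact: measurableT|].
  by under eq_fun do rewrite indicE mem_set// mulr1;
  under [in RHS]eq_fun do rewrite indicE mem_set// mulr1.
- move=> B [mB mB' BE].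
  have cE (S : Type) (D : set S) (x : S) : \1_(~` D) x = 1 - \1_D x :> R.
    by rewrite !indicE in_setC; case: (x \in D); rewrite ?subrr ?subr0.
  split => /=.
  + rewrite (_ : [set _ | _] = ~` [set w | B (Y^~ w)]); first exact: measurableC.
    by apply/seteqP; split => w.
  + rewrite (_ : [set _ | _] = ~` [set w | B (Y'^~ w)]); first exact: measurableC.
    by apply/seteqP; split => w.
  + under eq_fun do rewrite (cE _ [set w | B (Y^~ w)]) mulrBr mulr1.
    under [in RHS]eq_fun do rewrite (cE _ [set w | B (Y'^~ w)]) mulrBr mulr1.
    by rewrite !ExB// ?BE ?UE//; apply: bounded_mfunM => //; exact: bounded_mfun_indic.
- move=> F tF GF.
  have mF n : measurable [set w | F n (Y^~ w)] by case: (GF n).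
  have mF' n : measurable [set w | F n (Y'^~ w)] by case: (GF n).
  have mU1 : measurable [set w | (\bigcup_n F n) (Y^~ w)].
    rewrite (_ : [set _ | _] = \bigcup_n [set w | F n (Y^~ w)])//.
    exact: bigcupT_measurable.
  have mU2 : measurable [set w | (\bigcup_n F n) (Y'^~ w)].
    rewrite (_ : [set _ | _] = \bigcup_n [set w | F n (Y'^~ w)])//.
    exact: bigcupT_measurable.
  split => //.
  pose S n f : R := \sum_(i < n) \1_(F i) f.
  have S1 n f : `|S n f| <= 1.
    rewrite /S; have [[k Fk]|nF] := pselect (exists k, F k f).
      by rewrite (sum_indic_trivIset _ _ tF Fk); case: (_ < _)%N; rewrite ?normr1 ?normr0.
    rewrite big1 ?normr0// => i _; rewrite indicE memNset// => Fi.
    by apply: nF; exists (i : nat).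
  have [mU [K UK]] := bU; have [mU' [K' UK']] := bU'.
  have iE (d0 : measure_display) (O : measurableType d0) (Z : I -> O -> R) (D : set (I -> R)) w :
      \1_[set w | D (Z^~ w)] w = \1_D (Z^~ w) :> R.
    by rewrite !indicE; congr (_%:R); congr nat_of_bool; apply/idP/idP => /set_mem ?; apply/mem_set.
  have mS n : bounded_mfun (fun w => S n (Y^~ w)).
    elim: n => [|n IH]; rewrite /S.
      by under eq_fun do rewrite big_ord0; exact: bounded_mfun_cst.
    under eq_fun do rewrite big_ord_recr/= -iE.
    by apply: bounded_mfunD => //; exact: bounded_mfun_indic.
  have mS' n : bounded_mfun (fun w => S n (Y'^~ w)).
    elim: n => [|n IH]; rewrite /S.
      by under eq_fun do rewrite big_ord0; exact: bounded_mfun_cst.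
    under eq_fun do rewrite big_ord_recr/= -iE.
    by apply: bounded_mfunD => //; exact: bounded_mfun_indic.
  have SE n : Ex P (fun w => U w * S n (Y^~ w)) = Ex P' (fun w => U' w * S n (Y'^~ w)).
    elim: n => [|n IH]; rewrite /S.
      under eq_fun do rewrite big_ord0 mulr0.
      by under [in RHS]eq_fun do rewrite big_ord0 mulr0; rewrite !Ex_cst.
    under eq_fun do rewrite big_ord_recr/= -iE mulrDr.
    under [in RHS]eq_fun do rewrite big_ord_recr/= -iE mulrDr.
    have [_ _ FE] := GF n.
    rewrite !ExD; first (by congr (_ + _)); apply: bounded_mfunM => //;
      by [exact: mS|exact: mS'|exact: bounded_mfun_indic].
  have c1 : Ex P (fun w => U w * S n (Y^~ w)) @[n --> \oo] -->
      Ex P (fun w => U w * \1_[set w | (\bigcup_n F n) (Y^~ w)] w).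
    apply: (@Ex_cvg _ _ _ _ _ _ (K * 1)).
    + by move=> n; apply: measurable_funM => //; case: (mS n).
    + by apply: measurable_funM => //; exact: measurable_indic.
    + by move=> n w; rewrite normrM ler_pM.
    + by apply: aeW => w; apply: cvgMr; rewrite iE; exact: cvg_sum_indic.
  have c2 : Ex P' (fun w => U' w * S n (Y'^~ w)) @[n --> \oo] -->
      Ex P' (fun w => U' w * \1_[set w | (\bigcup_n F n) (Y'^~ w)] w).
    apply: (@Ex_cvg _ _ _ _ _ _ (K' * 1)).
    + by move=> n; apply: measurable_funM => //; case: (mS' n).
    + by apply: measurable_funM => //; exact: measurable_indic.
    + by move=> n w; rewrite normrM ler_pM.
    + by apply: aeW => w; apply: cvgMr; rewrite iE; exact: cvg_sum_indic.
  by move: c1; under eq_fun do rewrite SE; move=> c1; apply: (cvg_unique _ c1 c2).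
Qed.

End cylinder_extension.

Definition same_cf (R : realType) (I : Type) (T : set I)
    d (Omega : measurableType d) (P : probability Omega R) (X : I -> Omega -> R)
    d' (Omega' : measurableType d') (P' : probability Omega' R)
    (X' : I -> Omega' -> R) : Prop :=
  forall s phi, supported T s ->
    Ex P (fun w => cos (lin s (X^~ w) + phi)) =
    Ex P' (fun w => cos (lin s (X'^~ w) + phi)).

Lemma fine_probability_inj (R : realType) d (Omega : measurableType d)
    (P : probability Omega R) d' (Omega' : measurableType d')
    (P' : probability Omega' R) A B :
  measurable A -> measurable B -> fine (P A) = fine (P' B) -> P A = P' B.
Proof.
move=> mA mB h; rewrite -[LHS]fineK ?fin_num_measure//.
by rewrite -[RHS]fineK ?fin_num_measure// h.
Qed.

Lemma same_law_of_cf (R : realType) (I : Type) (T : set I)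
    d (Omega : measurableType d) (P : probability Omega R) (X : I -> Omega -> R)
    d' (Omega' : measurableType d') (P' : probability Omega' R)
    (X' : I -> Omega' -> R) :
  (forall i, T i -> measurable_fun setT (X i)) ->
  (forall i, T i -> measurable_fun setT (X' i)) ->
  same_cf T P X P' X' -> same_law T P X P' X'.
Proof.
move=> mX mX' cf A TA; apply: fine_probability_inj.
- exact: measurable_cylinder TA.
- exact: measurable_cylinder TA.
have := @Ex_cylinder_eq R I T _ _ P X (cst 1) _ _ P' X' (cst 1) mX mX'.
move=> /(_ (bounded_mfun_cst 1) (bounded_mfun_cst 1)).
have -> : (forall s phi, supported T s ->
    Ex P (fun w => cst 1 w * cos (lin s (X^~ w) + phi)) =
    Ex P' (fun w => cst 1 w * cos (lin s (X'^~ w) + phi))) = True.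
  apply/propext; split => // _ s phi sT.
  under eq_fun do rewrite mul1r.
  by under [in RHS]eq_fun do rewrite mul1r; exact: cf.
move=> /(_ Logic.I _ TA).
under eq_fun do rewrite mul1r.
under [in RHS]eq_fun do rewrite mul1r.
by rewrite !Ex_indic//; exact: measurable_cylinder TA.
Qed.

(** Transfers events generated by a process to the path space, where [Ex_cylinder_eq] speaks. *)
Lemma sigma_of_cylinder (R : realType) (I : Type) (T : set I)
    d (Omega : measurableType d) (X : I -> Omega -> R) A :
  sigma_of T X A -> exists2 C, cylinder_sigma T C & A = [set w | C (X^~ w)].
Proof.
pose G := [set A : set Omega |
  exists2 C, @cylinder_sigma R I T C & A = [set w | C (X^~ w)]].
have [C0 CC CU] : sigma_algebra setT (@cylinder_sigma R I T).
  exact: smallest_sigma_algebra.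
have sG : sigma_algebra setT G.
  split.
  - by exists set0.
  - move=> B [C TC ->]; exists (setT `\` C); first exact: CC.
    by apply/seteqP; split => w.
  - move=> F FG; have /choice[C CP] : forall n, exists C,
        @cylinder_sigma R I T C /\ F n = [set w | C (X^~ w)].
      by move=> n; have [C ? ?] := FG n; exists C.
    exists (\bigcup_n C n); first by apply: CU => n; case: (CP n).
    apply/seteqP; split => w [n _].
      by rewrite (CP n).2 => ?; exists n.
    by move=> ?; exists n => //; rewrite (CP n).2.
apply: (smallest_sub sG) => _ [i Ti [B mB <-]].
exists (setT `&` (fun f : I -> R => f i) @^-1` B) => //.
by apply: sub_sigma_algebra; exists i => //; exists B.
Qed.

Lemma sigma_of_measurable (I : Type) (T : set I)
    d (Omega : measurableType d) d' (E : measurableType d') (X : I -> Omega -> E) A :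
  (forall i, T i -> measurable_fun setT (X i)) -> sigma_of T X A -> measurable A.
Proof.
move=> mX; apply: smallest_sub; first exact: sigma_algebra_measurable.
by move=> _ [i Ti [B mB <-]]; exact: mX.
Qed.

(** * Independence from trigonometric moments *)

Definition trig_indep (R : realType) d (Omega : measurableType d)
    (P : probability Omega R) (I : Type) (T : set I) (Y : I -> Omega -> R)
    (J : Type) (S : set J) (G : J -> Omega -> R) : Prop :=
  forall s r phi psi, supported T s -> supported S r ->
    Ex P (fun w => cos (lin r (G^~ w) + psi) * cos (lin s (Y^~ w) + phi)) =
    Ex P (fun w => cos (lin r (G^~ w) + psi)) *
    Ex P (fun w => cos (lin s (Y^~ w) + phi)).

Section trig_indep.
Context {R : realType} {d} {Omega : measurableType d} {P : probability Omega R}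
  {I : Type} {T : set I} {Y : I -> Omega -> R}
  {J : Type} {S : set J} {G : J -> Omega -> R}.
Hypothesis mY : forall i, T i -> measurable_fun setT (Y i).
Hypothesis mG : forall i, S i -> measurable_fun setT (G i).
Hypothesis indep : trig_indep P T Y S G.

Let bounded_cos_lin (K : Type) (V : set K) (Z : K -> Omega -> R) s phi :
  (forall i, V i -> measurable_fun setT (Z i)) ->
  supported V s -> bounded_mfun (fun w => cos (lin s (Z^~ w) + phi)).
Proof. by move=> mZ sV; exact: bounded_trig mZ (trig_cos _ sV). Qed.

(** On one and the same space, the weight [cos (lin r G + psi)] is compared with the constant weight
    equal to its mean; [Ex_cylinder_eq] then replaces the cosines of [Y] by indicators. *)
Lemma trig_indep_Ex r psi A : supported S r -> sigma_of T Y A ->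
  Ex P (fun w => cos (lin r (G^~ w) + psi) * \1_A w) =
  Ex P (fun w => cos (lin r (G^~ w) + psi)) * Ex P \1_A.
Proof.
move=> rS YA; have mA := sigma_of_measurable mY YA.
have [C TC AE] := sigma_of_cylinder YA.
have := @Ex_cylinder_eq R I T _ _ P Y (fun w => cos (lin r (G^~ w) + psi))
  _ _ P Y (cst (Ex P (fun w => cos (lin r (G^~ w) + psi)))) mY mY
  (bounded_cos_lin _ mG rS) (bounded_mfun_cst _).
have H s phi : supported T s ->
    Ex P (fun w => cos (lin r (G^~ w) + psi) * cos (lin s (Y^~ w) + phi)) =
    Ex P (fun w => cst (Ex P (fun w => cos (lin r (G^~ w) + psi))) w *
                   cos (lin s (Y^~ w) + phi)).
  by move=> sT; rewrite ExZ ?indep//; exact: bounded_cos_lin mY sT.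
move=> /(_ H _ TC); rewrite -AE => ->.
by rewrite ExZ//; exact: bounded_mfun_indic.
Qed.

(** The same comparison with the roles exchanged: the weight is now [\1_A], against the constant P
    A, and the cosines of [G] disappear. *)
Lemma trig_indep_sets A B : sigma_of T Y A -> sigma_of S G B ->
  P (A `&` B) = (P A * P B)%E.
Proof.
move=> YA GB; have mA := sigma_of_measurable mY YA.
have mB := sigma_of_measurable mG GB.
have [C TC BE] := sigma_of_cylinder GB.
have := @Ex_cylinder_eq R J S _ _ P G \1_A _ _ P G (cst (Ex P \1_A)) mG mG
  (bounded_mfun_indic mA) (bounded_mfun_cst _).
have H r psi : supported S r ->
    Ex P (fun w => \1_A w * cos (lin r (G^~ w) + psi)) =
    Ex P (fun w => cst (Ex P \1_A) w * cos (lin r (G^~ w) + psi)).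
  move=> rS; rewrite ExZ; last exact: bounded_cos_lin mG rS.
  by under eq_fun do rewrite mulrC; rewrite trig_indep_Ex// mulrC.
move=> /(_ H _ TC); rewrite -BE.
rewrite ExZ; last exact: bounded_mfun_indic.
rewrite (_ : (fun w => _ * _) = \1_(A `&` B)); last first.
  by apply/funext => w; rewrite indicI.
rewrite !Ex_indic//; last exact: measurableI.
move=> h; rewrite -[LHS]fineK ?fin_num_measure//; last exact: measurableI.
rewrite h EFinM; congr (_ * _)%E; exact/fineK/fin_num_measure.
Qed.

End trig_indep.

(** * Normal laws *)

Lemma Rintegral_FTC2 (R : realType) (f F : R -> R) (a b : R) : a <= b ->
  {within `[a, b], continuous f} -> {within `[a, b], continuous F} ->
  (forall x, a < x < b -> is_derive x 1 F (f x)) ->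
  \int[lebesgue_measure]_(x in `[a, b]) f x = F b - F a.
Proof.
rewrite le_eqVlt => /predU1P[<- _ _ _|ab cf cF dF].
  by rewrite subrr set_itv1 Rintegral_set1.
rewrite /Rintegral (@continuous_FTC2 _ f F)//.
- have /(continuous_within_itvP _ ab)[_ Fa Fb] := cF.
  by split => // x /[!in_itv]/= xab; have [] := dF _ xab.
- by move=> x /[!in_itv]/= xab; have [_ <-] := dF _ xab; rewrite derive1E.
Qed.

Lemma normal_pdf0E (R : realType) (s x : R) : s != 0 ->
  normal_pdf 0 s x = normal_peak s * expR (- x ^+ 2 / (s ^+ 2 *+ 2)).
Proof. by move=> s0; rewrite normal_pdfE// /normal_fun subr0. Qed.

Lemma integrable_EFinZ (R : realType) d (T : measurableType d)
    (mu : {measure set T -> \bar R}) (D : set T) (k : R) (f : T -> R) :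
  measurable D -> mu.-integrable D (EFin \o f) ->
  mu.-integrable D (EFin \o (fun x => k * f x)).
Proof.
move=> mD /(integrableZl mD k); congr integrable.
Qed.

Section normal_cf.
Context {R : realType} (s : R).
Hypothesis s0 : s != 0.
Let p := normal_pdf 0 s.
Local Notation mu := (@lebesgue_measure R).

Let s2 : 0 < s ^+ 2. Proof. by rewrite exprn_even_gt0. Qed.

Lemma is_derive_normal_pdf (x : R) : is_derive x 1 p (- (x / s ^+ 2) * p x).
Proof.
rewrite (_ : p = fun x => normal_peak s * expR (- x ^+ 2 / (s ^+ 2 *+ 2))); last first.
  by apply/funext => y; exact: normal_pdf0E s0.
have h : is_derive x 1 (fun y : R => - y ^+ 2 / (s ^+ 2 *+ 2)) (- (x / s ^+ 2)).
  apply: is_derive_eq; rewrite /GRing.scale/=; field.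
  by rewrite s0.
have h2 := @is_derive1_comp R expR _ x _ _ (is_derive_expR _) h.
apply: is_derive_eq; rewrite /GRing.scale/=; ring.
Qed.

(** This is the dominating function for differentiation under the integral. With t = |x| / |s|, a
    part exp (- 3 t^2 / 8) of the density is spent on the factor t, and the rest is the density of
    standard deviation 2s up to a constant. *)
Lemma normr_mul_normal_pdf x : `|x| * p x <=
  (`|s| * normal_peak s / normal_peak (2 * s)) * normal_pdf 0 (2 * s) x.
Proof.
have t0 : 2 * s != 0 by rewrite mulf_neq0// pnatr_eq0.
have pt := normal_peak_gt0 t0; have ps := normal_peak_gt0 s0.
have ns : 0 < `|s| by rewrite normr_gt0.
have nE : `|s| ^+ 2 = s ^+ 2 by rewrite real_normK ?num_real.
have xE : `|x| ^+ 2 = x ^+ 2 by rewrite real_normK ?num_real.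
rewrite /p !normal_pdf0E//.
rewrite mulrCA [leRHS](_ : _ = normal_peak s *
  (`|s| * expR (- x ^+ 2 / ((2 * s) ^+ 2 *+ 2)))); last first.
  by field; rewrite gt_eqF.
rewrite ler_pM2l//.
have -> : - x ^+ 2 / (s ^+ 2 *+ 2) =
    - (3 / 8 * (x ^+ 2 / s ^+ 2)) + - x ^+ 2 / ((2 * s) ^+ 2 *+ 2).
  by field; rewrite s0.
rewrite expRD mulrA ler_wpM2r ?expR_ge0// expRN ler_pdivrMr ?expR_gt0//.
set t := `|x| / `|s|.
have -> : x ^+ 2 / s ^+ 2 = t ^+ 2 by rewrite expr_div_n nE xE.
have -> : `|x| = `|s| * t by rewrite mulrC divfK ?gt_eqF.
rewrite ler_pM2l//; apply: le_trans (expR_ge1Dx _).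
(* The parabola 3 t^2 / 8 - t has its minimum at t = 4/3, with value - 2/3 > - 1. *)
have := sqr_ge0 (t - 4 / 3); nra.
Qed.

Let g x := (`|s| * normal_peak s / normal_peak (2 * s)) * normal_pdf 0 (2 * s) x.

Let integrable_g : mu.-integrable setT (EFin \o g).
Proof.
rewrite /g; apply: integrable_EFinZ => //.
exact: integrable_normal_pdf.
Qed.

Let mp : measurable_fun setT p. Proof. exact: measurable_normal_pdf. Qed.
Let ip : mu.-integrable setT (EFin \o p). Proof. exact: integrable_normal_pdf. Qed.
Let p_ge0 x : 0 <= p x. Proof. exact: normal_pdf_ge0. Qed.
Let cp : continuous p. Proof. exact: continuous_normal_pdf. Qed.

Let mcos (a phi : R) : measurable_fun setT (fun x => cos (a * x + phi)).
Proof.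
apply: measurableT_comp.
  by apply: continuous_measurable_fun; exact: continuous_cos.
by apply: measurable_funD => //; exact: measurable_funM.
Qed.

Let msin (a phi : R) : measurable_fun setT (fun x => sin (a * x + phi)).
Proof.
apply: measurableT_comp.
  by apply: continuous_measurable_fun; exact: continuous_sin.
by apply: measurable_funD => //; exact: measurable_funM.
Qed.

Let psi (phi a : R) := \int[mu]_x (cos (a * x + phi) * p x).

Let integrable_le (f h : R -> R) : measurable_fun setT f ->
  mu.-integrable setT (EFin \o h) -> (forall x, `|f x| <= h x) ->
  mu.-integrable setT (EFin \o f).
Proof.
move=> mf ih fh; apply: le_integrable ih => //; first exact/measurable_EFinP.
by move=> x _; rewrite lee_fin (le_trans (fh x))// ler_norm.
Qed.

Let int_cos a phi : mu.-integrable setT (EFin \o (fun x => cos (a * x + phi) * p x)).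
Proof.
apply: (integrable_le _ ip) => [|x]; first exact: measurable_funM.
by rewrite normrM (ger0_norm (p_ge0 x)) ler_piMl// ler_norml cos_geN1 cos_le1.
Qed.

Let int_xsin a phi : mu.-integrable setT (EFin \o (fun x => x * sin (a * x + phi) * p x)).
Proof.
apply: (integrable_le _ integrable_g) => [|x].
  by apply: measurable_funM => //; exact: measurable_funM.
rewrite 2!normrM (ger0_norm (p_ge0 x)) (le_trans _ (normr_mul_normal_pdf x))//.
by rewrite ler_wpM2r// ler_piMr// ler_norml sin_geN1 sin_le1.
Qed.

(* Integration by parts: the boundary term [sin (a x + phi) p x] vanishes at infinity. *)
Let by_parts a phi :
  \int[mu]_x (x * sin (a * x + phi) * p x) = s ^+ 2 * a * psi phi a.
Proof.
pose F x := sin (a * x + phi) * p x.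
pose f x := a * (cos (a * x + phi) * p x) - (s ^+ 2)^-1 * (x * sin (a * x + phi) * p x).
have dF (x : R) : is_derive x 1 F (f x).
  have dp := is_derive_normal_pdf x.
  have h : is_derive x 1 (fun y : R => a * y + phi) a.
    by apply: is_derive_eq; rewrite /GRing.scale/=; ring.
  have h2 := @is_derive1_comp R sin _ x _ _ (is_derive_sin _) h.
  rewrite /F; apply: is_derive_eq; rewrite /f /GRing.scale/=.
  by field.
have cF : continuous F.
  by move=> x; apply/differentiable_continuous/derivable1_diffP; case: (dF x).
have cf : continuous f.
  move=> x; apply: cvgB; apply: cvgM; try exact: cvg_cst.
    apply: cvgM; last exact: cp.
    apply: continuous_comp; last exact: continuous_cos.
    by apply: cvgD; [apply: cvgM; [exact: cvg_cst|exact: cvg_id]|exact: cvg_cst].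
  apply: cvgM; last exact: cp.
  apply: cvgM; first exact: cvg_id.
  apply: continuous_comp; last exact: continuous_sin.
  by apply: cvgD; [apply: cvgM; [exact: cvg_cst|exact: cvg_id]|exact: cvg_cst].
have If n : \int[mu]_(x in `[- n%:R, n%:R]) f x = F n%:R - F (- n%:R).
  apply: Rintegral_FTC2 => //.
  - by rewrite lerNl -subr_ge0 opprK addr_ge0.
  - exact: continuous_subspaceT.
  - exact: continuous_subspaceT.
pose G x := `|a| * p x + (s ^+ 2)^-1 * g x.
have iG : mu.-integrable setT (EFin \o G).
  rewrite (_ : EFin \o G = (fun x => (EFin \o (fun x => (`|a| * p x)%R)) x +
      (EFin \o (fun x => ((s ^+ 2)^-1 * g x)%R)) x)%E); last first.
    by apply/funext => x; rewrite /G/= EFinD.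
  apply: integrableD => //; first exact: integrable_EFinZ.
  exact: integrable_EFinZ.
have fG x : `|f x| <= G x.
  rewrite /f (le_trans (ler_normB _ _))// lerD//.
    rewrite normrM ler_wpM2l// normrM (ger0_norm (p_ge0 x)) ler_piMl//.
    by rewrite ler_norml cos_geN1 cos_le1.
  rewrite normrM (ger0_norm (ltW _)) ?invr_gt0// ler_wpM2l ?invr_ge0 ?(ltW s2)//.
  rewrite 2!normrM (ger0_norm (p_ge0 x)) (le_trans _ (normr_mul_normal_pdf x))//.
  by rewrite ler_wpM2r// ler_piMr// ler_norml sin_geN1 sin_le1.
have mf : measurable_fun setT f by apply: continuous_measurable_fun.
have c1 : \int[mu]_(x in `[- n%:R, n%:R]) f x @[n --> \oo] --> \int[mu]_x f x.
  under eq_fun do rewrite Rintegral_mkcond.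
  apply: (@Rintegral_dominated_cvg _ _ _ mu (fun n : nat => f \_ `[- n%:R, n%:R]) f G) => //.
  - by move=> n; apply/measurable_restrict => //; exact: measurable_funTS.
  - move=> n x; rewrite patchE; case: ifPn => _; rewrite ?fG// normr0.
    exact: le_trans (fG x).
  - apply: aeW => x; apply: cvg_near_cst; near=> n.
    rewrite patchE mem_set//= in_itv/= -ler_norml.
    by near: n; exact: nbhs_infty_ger.
(* [K] bounds |x F x|, so the boundary terms at n and - n decay like 1 / n. *)
pose K := `|s| * normal_peak s / normal_peak (2 * s) * normal_peak (2 * s).
have FK x : x != 0 -> `|F x| <= K / `|x|.
  move=> x0; have nx : 0 < `|x| by rewrite normr_gt0.
  rewrite ler_pdivlMr// mulrC /F normrM (ger0_norm (p_ge0 x)).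
  rewrite mulrCA; apply: (@le_trans _ _ (`|x| * p x)).
    rewrite ler_piMl ?mulr_ge0//.
    by rewrite ler_norml sin_geN1 sin_le1.
  apply: le_trans (normr_mul_normal_pdf x) _; rewrite ler_wpM2l//.
    by rewrite !mulr_ge0// ?invr_ge0 ?normal_peak_ge0.
  by rewrite normal_pdf_ub// mulf_neq0// pnatr_eq0.
have c2 : F n%:R - F (- n%:R) @[n --> \oo] --> (0 : R).
  rewrite -cvg_shiftS /=.
  apply/norm_cvg0P.
  apply: (@squeeze_cvgr _ _ _ _ (cst 0) (fun n => (K + K) * n.+1%:R^-1)).
  - near=> n; rewrite normr_ge0/= (le_trans (ler_normB _ _))// mulrDl.
    have n0 : n.+1%:R != 0 :> R by rewrite pnatr_eq0.
    rewrite lerD//; first by rewrite (le_trans (FK _ n0))// normr_nat.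
    by rewrite (le_trans (FK _ _)) ?oppr_eq0// normrN normr_nat.
  - exact: cvg_cst.
  - rewrite -[X in _ --> X](mulr0 (K + K)); apply: cvgMr; exact: cvg_harmonic.
have f0 : \int[mu]_x f x = 0.
  move: c1; under eq_fun do rewrite If.
  by move=> c1; apply: (cvg_unique _ c1 c2).
move: f0; rewrite /f RintegralB//; last 2 first.
- exact: integrable_EFinZ.
- exact: integrable_EFinZ.
rewrite !RintegralZl//.
move/eqP; rewrite subr_eq0 => /eqP h.
by rewrite /psi -mulrA h mulrA divff ?gt_eqF// mul1r.
Unshelve. all: by end_near. Qed.

(** Differentiation under the integral produces the factor x sin (a x + phi), and [by_parts] turns
    it back into [psi]: this is the linear differential equation that determines the characteristic
    function. *)
Let is_derive_psi phi (a : R) :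
  is_derive a 1 (psi phi) (- (s ^+ 2 * a * psi phi a)).
Proof.
have df (b x : R) : is_derive b 1 (fun b => cos (b * x + phi) * p x)
    (- (x * sin (b * x + phi) * p x)).
  have h : is_derive b 1 (fun y : R => y * x + phi) x.
    by apply: is_derive_eq; rewrite /GRing.scale/=; ring.
  have h2 := @is_derive1_comp R cos _ b _ _ (is_derive_cos _) h.
  by apply: is_derive_eq; rewrite /GRing.scale/=; ring.
have pE (b x : R) : partial1of2 (fun a x => cos (a * x + phi) * p x) b x =
    - (x * sin (b * x + phi) * p x).
  by rewrite partial1of2E; case: (df b x).
have Ia : `]a - 1, a + 1[%classic a by rewrite /= in_itv/=; apply/andP; split; lra.
have H1 b : `]a - 1, a + 1[%classic b ->
    mu.-integrable setT (EFin \o (fun x => cos (b * x + phi) * p x)).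
  by move=> _; exact: int_cos.
have H2 b x : `]a - 1, a + 1[%classic b -> [set: R] x ->
    derivable (fun b : R => cos (b * x + phi) * p x : R) b 1.
  by move=> _ _; case: (df b x).
have g0 x : 0 <= g x.
  by rewrite /g !mulr_ge0 ?invr_ge0 ?normal_peak_ge0// normal_pdf_ge0.
have H3 b x : `]a - 1, a + 1[%classic b -> [set: R] x ->
    `|partial1of2 (fun a x => cos (a * x + phi) * p x) b x| <= g x.
  move=> _ _; rewrite pE normrN 2!normrM (ger0_norm (p_ge0 x)).
  rewrite (le_trans _ (normr_mul_normal_pdf x))//.
  by rewrite ler_wpM2r// ler_piMr// ler_norml sin_geN1 sin_le1.
have D := derivable_under_integral (mu := mu) measurableT Ia H1 H2 g0 integrable_g H3.
have := differentiation_under_integral (mu := mu) measurableT Ia H1 H2 g0 integrable_g H3.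
rewrite derive1E => E; apply: DeriveDef; first exact: D.
rewrite [LHS]E -by_parts -mulN1r -RintegralZl//.
by apply: eq_Rintegral => x _; rewrite pE mulN1r.
Qed.

(** By the differential equation, [psi phi a] times exp (a^2 s^2 / 2) has derivative 0 in a; its
    value at a = 0 is cos phi because the density has mass 1. *)
Let psiE phi a : psi phi a = cos phi * expR (- (a ^+ 2 * s ^+ 2 / 2)).
Proof.
pose h (a : R) := psi phi a * expR (a ^+ 2 * s ^+ 2 / 2).
have dh (b : R) : is_derive b 1 h 0.
  have h1 : is_derive b 1 (fun a : R => a ^+ 2 * s ^+ 2 / 2) (b * s ^+ 2).
    by apply: is_derive_eq; rewrite /GRing.scale/=; field.
  have h2 := @is_derive1_comp R expR _ b _ _ (is_derive_expR _) h1.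
  have h3 := is_derive_psi phi b.
  by rewrite /h; apply: is_derive_eq; rewrite /GRing.scale/=; ring.
have := is_derive_0_is_cst a 0 dh.
rewrite /h expr0n/= !mul0r expR0 mulr1 /psi.
under [X in _ = X]eq_Rintegral do rewrite mul0r add0r.
rewrite RintegralZl//.
have -> : \int[mu]_x p x = 1.
  by rewrite /Rintegral integral_normal_pdf.
by rewrite mulr1 expRN => <-; rewrite mulfK// gt_eqF// expR_gt0.
Qed.

(** The Radon-Nikodym derivative of the normal law and [p] have the same integrals over all
    measurable sets, so they agree almost everywhere. *)
Lemma integral_normal_prob (f : R -> \bar R) :
  (normal_prob 0 s).-integrable setT f ->
  (\int[normal_prob 0 s]_x f x = \int[mu]_x (f x * (p x)%:E))%E.
Proof.
move=> /[dup] intf /integrableP[mf finf].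
rewrite -(Radon_Nikodym_change_of_variables (normal_prob_dominates 0 s))//=.
apply: ae_eq_integral => //.
- apply: emeasurable_funM => //; apply: (measurable_int mu).
  by apply: Radon_Nikodym_integrable; exact: normal_prob_dominates.
- by apply: emeasurable_funM => //=; exact/measurable_EFinP.
- apply: ae_eqe_mul2l => /=.
  rewrite Radon_NikodymE//=; first exact: normal_prob_dominates.
  move=> abmu; case: cid => /= h [h1 h2 h3].
  apply: integral_ae_eq => //=; first exact/measurable_EFinP.
  by move=> E _ mE; rewrite -h3.
Qed.

Lemma Ex_normal_cos a phi : Ex (normal_prob 0 s) (fun x => cos (a * x + phi)) =
  cos phi * expR (- (a ^+ 2 * s ^+ 2 / 2)).
Proof.
rewrite -psiE /Ex /Rintegral integral_normal_prob//.
apply: bounded_mfun_integrable; apply: bounded_mfun_cos.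
by apply: measurable_funD => //; exact: measurable_funM.
Qed.

End normal_cf.

Definition law (R : realType) d (Omega : measurableType d)
    (P : probability Omega R) d' (E : measurableType d') (X : Omega -> E)
    (mX : measurable_fun setT X) : probability E R :=
  distribution P (mfun_Sub (mem_set mX)).

Section law.
Context {R : realType} {d} {Omega : measurableType d} {P : probability Omega R}.

Lemma lawE d' (E : measurableType d') (X : Omega -> E)
  (mX : measurable_fun setT X) B : law P mX B = P (X @^-1` B).
Proof. by []. Qed.

Lemma bounded_mfun_comp d' (E : measurableType d') (X : Omega -> E) (f : E -> R) :
  measurable_fun setT X -> bounded_mfun f -> bounded_mfun (f \o X).
Proof.
by move=> mX [mf [K fK]]; split; [exact: measurableT_comp|exists K => w /=].
Qed.

Lemma Ex_law d' (E : measurableType d') (X : Omega -> E)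
    (mX : measurable_fun setT X) (f : E -> R) : bounded_mfun f ->
  Ex (law P mX) f = Ex P (f \o X).
Proof.
move=> bf; rewrite /Ex /Rintegral /law; congr fine.
rewrite integral_distribution//=; first by case: bf => /measurable_EFinP.
exact: (bounded_mfun_integrable P (bounded_mfun_comp mX bf)).
Qed.

Lemma eq_Ex d' (E : measurableType d') (Q Q' : probability E R) (f : E -> R) :
  (forall B, measurable B -> Q B = Q' B) -> Ex Q f = Ex Q' f.
Proof.
move=> QQ; rewrite /Ex /Rintegral; congr fine.
by apply: eq_measure_integral => B mB _; exact: QQ.
Qed.

End law.

Section indep_pair.
Context {R : realType} {d} {Omega : measurableType d} {P : probability Omega R}.
Context {d1} {E1 : measurableType d1} {X : Omega -> E1} (mX : measurable_fun setT X).
Context {d2} {E2 : measurableType d2} {Z : Omega -> E2} (mZ : measurable_fun setT Z).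
Hypothesis indep : forall A B, measurable A -> measurable B ->
  P (X @^-1` A `&` Z @^-1` B) = (P (X @^-1` A) * P (Z @^-1` B))%E.

Let XZ w := (X w, Z w).
Let mXZ : measurable_fun setT XZ. Proof. exact: measurable_fun_pair. Qed.

Lemma law_indep_pair (S : set (E1 * E2)) : measurable S ->
  P (XZ @^-1` S) = (law P mX \x law P mZ)%E S.
Proof.
move=> mS; apply/esym.
apply: (@product_measure_unique _ _ _ _ _ (law P mX) (law P mZ) (law P mXZ)) => //.
Qed.

Lemma Ex_indep (f : E1 -> R) (g : E2 -> R) : bounded_mfun f -> bounded_mfun g ->
  Ex P (fun w => f (X w) * g (Z w)) =
  Ex P (fun w => f (X w)) * Ex P (fun w => g (Z w)).
Proof.
move=> bf bg; pose h (p : E1 * E2) := f p.1 * g p.2.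
have bh : bounded_mfun h.
  by apply: bounded_mfunM; exact: bounded_mfun_comp.
transitivity (Ex (law P mXZ) h); first by rewrite Ex_law.
have hE : Ex (law P mXZ) h = fine (\int[law P mX \x law P mZ]_p (h p)%:E)%E.
  rewrite /Ex /Rintegral; congr fine.
  by apply: eq_measure_integral => S mS _; exact: law_indep_pair.
rewrite hE.
have ih : (law P mX \x law P mZ)%E.-integrable setT (EFin \o h).
  have [mh [K hK]] := bh.
  apply: measurable_bounded_integrable => //.
    have e : (law P mX \x law P mZ)%E setT = 1%E.
      rewrite -(law_indep_pair measurableT) preimage_setT.
      exact: probability_setT.
    exact: (eq_ind_r (fun z => (z < +oo)%E) (ltry 1) e).
  by exists K; split; [exact: num_real|move=> M KM w _ /=; exact/ltW/(le_lt_trans (hK w))].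
rewrite -(integral12_prod_meas1 ih) /fubini_F.
rewrite -[Ex P (fun w => f (X w))]/(Ex P (f \o X)) -(Ex_law mX bf).
rewrite -[Ex P (fun w => g (Z w))]/(Ex P (g \o Z)) -(Ex_law mZ bg).
have -> : (fun x => \int[law P mZ]_y (EFin \o h) (x, y))%E =
    (fun x => (f x * Ex (law P mZ) g)%:E).
  apply/funext => x; rewrite /h /=.
  rewrite -[LHS]fineK; last first.
    apply: integrable_fin_num => //.
    apply: (bounded_mfun_integrable (law P mZ) (f := fun y => f x * g y)).
    by apply: bounded_mfunM => //; exact: bounded_mfun_cst.
  by congr EFin; rewrite -ExZ.
rewrite -[LHS]/(Ex (law P mX) (fun x => f x * Ex (law P mZ) g)).
by under eq_fun do rewrite mulrC; rewrite ExZ// mulrC.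
Qed.

End indep_pair.

Lemma lin_unit (R : realType) (s : seq (R * unit)) (f : unit -> R) :
  lin s f = lin s (fun=> 1) * f tt.
Proof.
elim: s => [|[a []] s IH]; first by rewrite !lin_nil mul0r.
by rewrite !lin_cons IH/= mulr1 mulrDl.
Qed.

Lemma eq_law_of_cf (R : realType) d (Omega : measurableType d)
    (P : probability Omega R) (X : Omega -> R) d' (Omega' : measurableType d')
    (P' : probability Omega' R) (X' : Omega' -> R) (B : set R) :
  measurable_fun setT X -> measurable_fun setT X' ->
  (forall a phi, Ex P (fun w => cos (a * X w + phi)) =
                 Ex P' (fun w => cos (a * X' w + phi))) ->
  measurable B -> P (X @^-1` B) = P' (X' @^-1` B).
Proof.
move=> mX mX' cf mB.
have := @same_law_of_cf R unit setT _ _ P (fun=> X) _ _ P' (fun=> X').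
move=> /(_ (fun _ _ => mX) (fun _ _ => mX')) h.
apply: (h _ ((fun f => f tt) @^-1` B)).
  by move=> s phi _; under eq_fun do rewrite lin_unit;
    under [in RHS]eq_fun do rewrite lin_unit; exact: cf.
by apply: sub_sigma_algebra; exists tt => //; exists B => //; rewrite setTI.
Qed.

Section normal_law.
Context {R : realType} {d} {Omega : measurableType d} {P : probability Omega R}.
Variable X : Omega -> R.
Hypothesis mX : measurable_fun setT X.

Lemma cf_of_normal_law (s : R) : s != 0 ->
  (forall B, measurable B -> P (X @^-1` B) = normal_prob 0 s B) ->
  forall a phi, Ex P (fun w => cos (a * X w + phi)) =
    cos phi * expR (- (a ^+ 2 * s ^+ 2 / 2)).
Proof.
move=> s0 XE a phi.
have bc : bounded_mfun (fun x : R => cos (a * x + phi)).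
  apply: bounded_mfun_cos; apply: measurable_funD => //; exact: measurable_funM.
rewrite -(Ex_normal_cos s0) -[LHS](Ex_law mX bc).
have mid : measurable_fun setT (idfun : measurableTypeR R -> R).
  by move=> _ B mB; rewrite setTI.
rewrite -[RHS](@Ex_law _ _ _ (normal_prob 0 s) _ _ _ mid _ bc).
by apply: eq_Ex => B mB; rewrite lawE XE.
Qed.

(** The degenerate case is separate because [normal_prob] is not a point mass at standard deviation
    0; there the characteristic function is that of the Dirac mass at 0. *)
Lemma normal_law_of_cf (v : R) : 0 <= v ->
  (forall a phi, Ex P (fun w => cos (a * X w + phi)) =
    cos phi * expR (- (a ^+ 2 * v / 2))) ->
  forall B, measurable B ->
    P (X @^-1` B) = if Num.sqrt v == 0 then \d_(0 : R) B
                    else normal_prob 0 (Num.sqrt v) B.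
Proof.
move=> v0 cf B mB; have [sv0|sv0] := eqVneq (Num.sqrt v) 0.
  have vE : v = 0 by rewrite -(sqr_sqrtr v0) sv0 expr0n.
  apply: (@eq_law_of_cf _ _ _ P X _ R \d_(0 : R) idfun) => //.
    by move=> _ C mC; rewrite setTI.
  move=> a phi.
  rewrite cf vE mulr0 mul0r oppr0 expR0 mulr1.
  rewrite /Ex /Rintegral integral_dirac//=; last first.
    apply/measurable_EFinP.
    apply: (@bounded_mfun_cos _ _ _ (fun x : R => a * x + phi) _).1.
    by apply: measurable_funD => //; exact: measurable_funM.
  by rewrite indicE mem_set// mul1r mulr0 add0r.
apply: (@eq_law_of_cf _ _ _ P X _ (measurableTypeR R) (normal_prob 0 (Num.sqrt v)) idfun) => //.
  by move=> _ C mC; rewrite setTI.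
by move=> a phi; rewrite cf Ex_normal_cos// sqr_sqrtr.
Qed.

End normal_law.

(** * Gaussian families *)

Definition cov_lin (R : realType) (I : Type) (C : I -> I -> R)
    (s r : seq (R * I)) : R := lin s (fun i => lin r (C i)).

Definition subst_comb (R : realType) (I J : Type) (l : J -> seq (R * I))
    (s : seq (R * J)) : seq (R * I) :=
  flatten [seq scale_comb p.1 (l p.2) | p <- s].

Section lin_linear.
Context {R : realType} {J : Type}.
Implicit Types (s : seq (R * J)).

Lemma linD s (f g : J -> R) : lin s (fun j => f j + g j) = lin s f + lin s g.
Proof.
elim: s => [|p s IH]; first by rewrite !lin_nil addr0.
by rewrite !lin_cons IH mulrDr addrACA.
Qed.

Lemma linZ s c (f : J -> R) : lin s (fun j => c * f j) = c * lin s f.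
Proof.
elim: s => [|p s IH]; first by rewrite !lin_nil mulr0.
by rewrite !lin_cons IH mulrDr mulrCA.
Qed.

Lemma lin0 s : lin s (fun=> 0) = 0.
Proof. by elim: s => [|p s IH]; rewrite ?lin_nil// lin_cons IH mulr0 addr0. Qed.

End lin_linear.

Section comb_theory.
Context {R : realType} {I J : Type}.
Implicit Types (s : seq (R * J)) (l : J -> seq (R * I)).

Lemma subst_comb_cons l p s :
  subst_comb l (p :: s) = scale_comb p.1 (l p.2) ++ subst_comb l s.
Proof. by []. Qed.

Lemma lin_subst l s (f : I -> R) :
  lin (subst_comb l s) f = lin s (fun j => lin (l j) f).
Proof.
elim: s => [|p s IH]; first by rewrite !lin_nil.
by rewrite subst_comb_cons lin_cat lin_scale lin_cons IH.
Qed.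

Lemma supported_subst (T : set I) (S : set J) l s :
  (forall j, S j -> supported T (l j)) -> supported S s ->
  supported T (subst_comb l s).
Proof.
move=> Tl; elim: s => [//|p s IH] /supportedP[Sp Ss].
by rewrite subst_comb_cons supported_cat supported_scale Tl//= IH.
Qed.

Lemma lin_exchange s (r : seq (R * I)) (F : J -> I -> R) :
  lin s (fun j => lin r (F j)) = lin r (fun i => lin s (F^~ i)).
Proof.
elim: s => [|p s IH]; first by rewrite lin_nil; under eq_fun do rewrite lin_nil; rewrite lin0.
rewrite lin_cons IH -linZ -linD; congr lin.
by apply/funext => i; rewrite lin_cons.
Qed.

Lemma cvg_lin (T : set J) s (f : nat -> J -> R) (g : J -> R) :
  supported T s -> (forall j, T j -> f n j @[n --> \oo] --> g j) ->
  lin s (f n) @[n --> \oo] --> lin s g.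
Proof.
move=> + fg; elim: s => [|p s IH] /=.
  by move=> _; under eq_fun do rewrite lin_nil; rewrite lin_nil; exact: cvg_cst.
move/supportedP => [Tp Ts]; under eq_fun do rewrite lin_cons.
by rewrite lin_cons; apply: cvgD; [apply: cvgMr; exact: fg|exact: IH].
Qed.

End comb_theory.

Lemma cov_lin_subst (R : realType) (I J K : Type) (C : I -> I -> R)
    (l : J -> seq (R * I)) (m : K -> seq (R * I)) s r :
  cov_lin C (subst_comb l s) (subst_comb m r) =
  lin s (fun j => lin r (fun k => cov_lin C (l j) (m k))).
Proof.
rewrite /cov_lin lin_subst; congr lin; apply/funext => j.
rewrite [in RHS]lin_exchange; congr lin; apply/funext => i.
by rewrite lin_subst.
Qed.

Lemma cov_lin_cat (R : realType) (I : Type) (C : I -> I -> R) s r :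
  (forall i j, C i j = C j i) ->
  cov_lin C (s ++ r) (s ++ r) = cov_lin C s s + 2 * cov_lin C s r + cov_lin C r r.
Proof.
move=> sC; rewrite /cov_lin lin_cat.
under eq_fun do rewrite lin_cat.
rewrite !linD [lin r (fun i => lin s _)]lin_exchange.
have -> : (fun i : I => lin r (C^~ i)) = (fun i => lin r (C i)).
  by apply/funext => i; congr lin; apply/funext => j.
ring.
Qed.

(** A centred Gaussian family with covariance [C], stated through characteristic functions: in this
    form it passes to linear images and to almost sure limits without any computation of moments. *)
Definition gaussian_family (R : realType) (I : Type) (T : set I)
    d (Omega : measurableType d) (P : probability Omega R)
    (X : I -> Omega -> R) (C : I -> I -> R) : Prop :=
  (forall i, T i -> measurable_fun setT (X i)) /\
  forall s phi, supported T s ->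
    Ex P (fun w => cos (lin s (X^~ w) + phi)) =
    cos phi * expR (- (cov_lin C s s / 2)).

Lemma eq_cov_lin (R : realType) (I : Type) (T : set I) (C C' : I -> I -> R) s r :
  (forall i j, T i -> T j -> C i j = C' i j) -> supported T s -> supported T r ->
  cov_lin C s r = cov_lin C' s r.
Proof.
move=> CC Ts Tr; apply: (eq_lin Ts) => i Ti.
by apply: (eq_lin Tr) => j Tj; exact: CC.
Qed.

Section gaussian_family.
Context {R : realType} {d} {Omega : measurableType d} {P : probability Omega R}.

Lemma gaussian_family_cov (I : Type) (T : set I) (X : I -> Omega -> R) C C' :
  (forall i j, T i -> T j -> C i j = C' i j) ->
  gaussian_family T P X C -> gaussian_family T P X C'.
Proof.
move=> CC [mX XC]; split => // s phi Ts; rewrite XC//.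
by rewrite (eq_cov_lin CC).
Qed.

Lemma gaussian_family_lin (I J : Type) (T : set I) (S : set J)
    (X : I -> Omega -> R) C (l : J -> seq (R * I)) :
  gaussian_family T P X C -> (forall j, S j -> supported T (l j)) ->
  gaussian_family S P (fun j w => lin (l j) (X^~ w))
    (fun j k => cov_lin C (l j) (l k)).
Proof.
move=> [mX XC] Tl; split => [j Sj|s phi Ss].
  exact: measurable_lin mX (Tl _ Sj).
under eq_fun do rewrite -lin_subst.
rewrite XC; last exact: supported_subst Tl Ss.
by rewrite cov_lin_subst.
Qed.

(** Bounded convergence handles the cosines; the exponent is a finite sum of covariances, so their
    pointwise convergence is enough. *)
Lemma gaussian_family_lim (I : Type) (T : set I) (X : nat -> I -> Omega -> R)
    (Y : I -> Omega -> R) C D :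
  (forall n, gaussian_family T P (X n) (C n)) ->
  (forall i, T i -> measurable_fun setT (Y i)) ->
  (forall i, T i -> {ae P, forall w, X n i w @[n --> \oo] --> Y i w}) ->
  (forall i j, T i -> T j -> C n i j @[n --> \oo] --> D i j) ->
  gaussian_family T P Y D.
Proof.
move=> gX mY XY CD; split => // s phi Ts.
have mc (Z : I -> Omega -> R) : (forall i, T i -> measurable_fun setT (Z i)) ->
    measurable_fun setT (fun w => cos (lin s (Z^~ w) + phi)).
  by move=> mZ; case: (bounded_trig mZ (trig_cos phi Ts)).
have c1 : Ex P (fun w => cos (lin s (X n ^~ w) + phi)) @[n --> \oo] -->
    Ex P (fun w => cos (lin s (Y^~ w) + phi)).
  apply: (@Ex_cvg _ _ _ _ _ _ 1).
  - by move=> n; apply: mc; case: (gX n).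
  - exact: mc.
  - by move=> n w; rewrite ler_norml cos_geN1 cos_le1.
  - have : {ae P, forall w, lin s (X n ^~ w) @[n --> \oo] --> lin s (Y^~ w)}.
      elim: s Ts {mc} => [_|p s IH /supportedP[Tp Ts]].
        by apply: aeW => w; under eq_fun do rewrite lin_nil; rewrite lin_nil; exact: cvg_cst.
      have := IH Ts; apply: filterS2 (XY _ Tp) => w h1 h2.
      under eq_fun do rewrite lin_cons.
      by rewrite lin_cons; apply: cvgD => //; exact: cvgMr.
    apply: filterS => w h; apply: (@cvg_comp _ _ _ _ cos).
      by apply: cvgD; [exact: h|exact: cvg_cst].
    exact: continuous_cos.
have c2 : cos phi * expR (- (cov_lin (C n) s s / 2)) @[n --> \oo] -->
    cos phi * expR (- (cov_lin D s s / 2)).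
  apply: cvgMr; apply: (@cvg_comp _ _ _ _ expR); last exact: continuous_expR.
  apply: cvgN; apply: cvgMl; rewrite /cov_lin.
  apply: (cvg_lin Ts) => i Ti.
  by apply: (cvg_lin Ts) => j Tj; exact: CD.
have e : (fun n => Ex P (fun w => cos (lin s (X n ^~ w) + phi))) =
    (fun n => cos phi * expR (- (cov_lin (C n) s s / 2))).
  by apply/funext => n; have [_ ->] := gX n.
by rewrite e in c1; apply: (cvg_unique _ c1 c2).
Qed.

Lemma gaussian_family_ae (I : Type) (T : set I) (X Y : I -> Omega -> R) C :
  gaussian_family T P X C -> (forall i, T i -> measurable_fun setT (Y i)) ->
  (forall i, T i -> {ae P, forall w, X i w = Y i w}) ->
  gaussian_family T P Y C.
Proof.
move=> gX mY XY.
apply: (@gaussian_family_lim _ _ (fun=> X) Y (fun=> C)) => //.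
  by move=> i Ti; apply: filterS (XY _ Ti) => w ->; exact: cvg_cst.
by move=> i j _ _; exact: cvg_cst.
Qed.

Lemma gaussian_family_cf (I : Type) (T : set I) (X : I -> Omega -> R) C s :
  gaussian_family T P X C -> supported T s ->
  forall a phi, Ex P (fun w => cos (a * lin s (X^~ w) + phi)) =
    cos phi * expR (- (a ^+ 2 * cov_lin C s s / 2)).
Proof.
move=> [_ XC] Ts a phi.
under eq_fun do rewrite -lin_scale.
rewrite XC ?supported_scale// /cov_lin lin_scale.
under eq_fun do rewrite lin_scale.
by rewrite linZ mulrA -expr2.
Qed.

(* Otherwise the characteristic function would be unbounded. *)
Lemma cov_lin_ge0 (I : Type) (T : set I) (X : I -> Omega -> R) C s :
  gaussian_family T P X C -> supported T s -> 0 <= cov_lin C s s.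
Proof.
move=> gX Ts; have := gaussian_family_cf gX Ts 1 0.
rewrite cos0 mul1r expr1n mul1r => E.
have : expR (- (cov_lin C s s / 2)) <= 1.
  rewrite -E -[leRHS](Ex_cst P (1:R)) /Ex; apply: le_Rintegral => //.
  - apply: bounded_mfun_integrable; apply: bounded_mfun_cos.
    apply: measurable_funD => //; apply: measurable_funM => //.
    by case: gX => mX _; exact: measurable_lin mX Ts.
  - by apply: bounded_mfun_integrable; exact: bounded_mfun_cst.
by rewrite -[X in _ <= X -> _]expR0 ler_expR oppr_le0 pmulr_lge0 ?invr_gt0.
Qed.

Lemma gaussian_family_law (I : Type) (T : set I) (X : I -> Omega -> R) C s B :
  gaussian_family T P X C -> supported T s -> measurable B ->
  P [set w | B (lin s (X^~ w))] =
    if Num.sqrt (cov_lin C s s) == 0 then \d_(0 : R) B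
    else normal_prob 0 (Num.sqrt (cov_lin C s s)) B.
Proof.
move=> gX Ts mB.
have := @normal_law_of_cf _ _ _ P (fun w => lin s (X^~ w)).
apply => //; first by case: gX => mX _; exact: measurable_lin mX Ts.
- exact: cov_lin_ge0 gX Ts.
- exact: (gaussian_family_cf gX Ts).
Qed.

Lemma gaussian_family_same_cf (I : Type) (T : set I) (X : I -> Omega -> R) C
    d' (Omega' : measurableType d') (P' : probability Omega' R) (X' : I -> Omega' -> R) :
  gaussian_family T P X C -> gaussian_family T P' X' C ->
  same_cf T P X P' X'.
Proof. by move=> [_ XC] [_ XC'] s phi Ts; rewrite XC ?XC'. Qed.

Lemma gaussian_family_transfer (I : Type) (T : set I) (X : I -> Omega -> R) C
    d' (Omega' : measurableType d') (P' : probability Omega' R) (X' : I -> Omega' -> R) :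
  gaussian_family T P X C -> (forall i, T i -> measurable_fun setT (X' i)) ->
  same_cf T P X P' X' -> gaussian_family T P' X' C.
Proof. by move=> [_ XC] mX' XX; split=> // s phi Ts; rewrite -XX// XC. Qed.

(** A product of cosines is half the sum of the cosines of the sum and of the difference. Without
    cross-covariance both have the same variance, the sum of the two, so the exponential splits and
    the cosines of the phases recombine into a product. *)
Lemma gaussian_family_indep (I J K : Type) (T : set I) (S : set J) (V : set K)
    (X : I -> Omega -> R) C (l : J -> seq (R * I)) (m : K -> seq (R * I)) :
  gaussian_family T P X C -> (forall i j, C i j = C j i) ->
  (forall j, S j -> supported T (l j)) ->
  (forall k, V k -> supported T (m k)) ->
  (forall j k, S j -> V k -> cov_lin C (l j) (m k) = 0) ->
  trig_indep P S (fun j w => lin (l j) (X^~ w)) V (fun k w => lin (m k) (X^~ w)).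
Proof.
move=> [mX XC] sC Tl Tm C0 s r phi psi Ss Vr.
pose ls := subst_comb l s; pose mr := subst_comb m r.
have Tls : supported T ls by exact: supported_subst Tl Ss.
have Tmr : supported T mr by exact: supported_subst Tm Vr.
have c0 c : cov_lin C ls (scale_comb c mr) = 0.
  rewrite /cov_lin; under eq_fun do rewrite lin_scale.
  rewrite linZ -/(cov_lin C ls mr) cov_lin_subst (_ : lin s _ = 0) ?mulr0//.
  rewrite (eq_lin Ss (f' := fun=> 0)) ?lin0// => j Sj.
  by rewrite (eq_lin Vr (f' := fun=> 0)) ?lin0// => k Vk; exact: C0.
have E c : cov_lin C (ls ++ scale_comb c mr) (ls ++ scale_comb c mr) =
    cov_lin C ls ls + c ^+ 2 * cov_lin C mr mr.
  rewrite cov_lin_cat// c0 mulr0 addr0; congr (_ + _).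
  rewrite /cov_lin lin_scale; under eq_fun do rewrite lin_scale.
  by rewrite linZ mulrA -expr2.
have bX s' phi' : supported T s' -> bounded_mfun (fun w => cos (lin s' (X^~ w) + phi')).
  by move=> Ts'; exact: bounded_trig mX (trig_cos _ Ts').
have T2 c : supported T (ls ++ scale_comb c mr).
  by rewrite supported_cat supported_scale Tls.
have LE w : cos (lin r (fun k => lin (m k) (X^~ w)) + psi) *
    cos (lin s (fun j => lin (l j) (X^~ w)) + phi) =
    2^-1 * (cos (lin (ls ++ scale_comb 1 mr) (X^~ w) + (phi + psi)) +
            cos (lin (ls ++ scale_comb (- 1) mr) (X^~ w) + (phi - psi))).
  rewrite mulrC cosM_half !lin_cat !lin_scale !lin_subst.
  by congr (_ * (cos _ + cos _)); ring.
under eq_fun do rewrite LE.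
rewrite ExZ ?ExD; [|exact: bX|exact: bX|apply: bounded_mfunD; exact: bX].
rewrite !XC ?T2// !E sqrrN expr1n mul1r.
have -> : (fun w => cos (lin r (fun k => lin (m k) (X^~ w)) + psi)) =
    (fun w => cos (lin mr (X^~ w) + psi)).
  by apply/funext => w; rewrite lin_subst.
have -> : (fun w => cos (lin s (fun j => lin (l j) (X^~ w)) + phi)) =
    (fun w => cos (lin ls (X^~ w) + phi)).
  by apply/funext => w; rewrite lin_subst.
rewrite !XC//.
have -> : - ((cov_lin C ls ls + cov_lin C mr mr) / 2) =
  - (cov_lin C mr mr / 2) + - (cov_lin C ls ls / 2) by ring.
by rewrite expRD cosB cosD; field.
Qed.

End gaussian_family.

(** * Brownian motion as a Gaussian process *)

(** The sample space with the sigma-algebra generated by [X]. Adaptedness becomes measurability on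
    this type, so the closure properties of measurable functions apply to it. *)
Definition sigma_type d (Omega : measurableType d) d' (E : measurableType d')
    (I : Type) (T : set I) (X : I -> Omega -> E) : measurableType _ :=
  g_sigma_algebraType (\bigcup_(i in T) preimage_set_system setT (X i) measurable).

Lemma sigma_type_measurable d (Omega : measurableType d) d' (E : measurableType d')
    (I : Type) (T : set I) (X : I -> Omega -> E) i : T i ->
  measurable_fun setT (X i : sigma_type T X -> E).
Proof.
by move=> Ti _ B mB; apply: sub_sigma_algebra; exists i => //; exists B.
Qed.

Lemma sigma_of_preimage d (Omega : measurableType d) d' (E : measurableType d')
    (I : Type) (T : set I) (X : I -> Omega -> E) d2 (F : measurableType d2)
    (f : Omega -> F) B :
  measurable_fun setT (f : sigma_type T X -> F) -> measurable B ->
  sigma_of T X (f @^-1` B).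
Proof. by move=> mf mB; rewrite -[_ @^-1` _]setTI; exact: mf. Qed.

Lemma sigma_of_sub d (Omega : measurableType d) d' (E : measurableType d')
    (I : Type) (T : set I) (X : I -> Omega -> E)
    d2 (F : measurableType d2) (J : Type) (S : set J) (Y : J -> Omega -> F) :
  (forall j, S j -> measurable_fun setT (Y j : sigma_type T X -> F)) ->
  sigma_of S Y `<=` sigma_of T X.
Proof.
move=> mY; apply: smallest_sub; first exact: smallest_sigma_algebra.
by move=> _ [j Sj [B mB <-]]; exact: (mY j Sj).
Qed.

Lemma eq_lin_mem (R : realType) (I : eqType) (s : seq (R * I)) (f g : I -> R) :
  (forall p, p \in s -> f p.2 = g p.2) -> lin s f = lin s g.
Proof.
elim: s => [_|p s IH fg]; first by rewrite !lin_nil.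
rewrite !lin_cons fg ?inE ?eqxx// IH// => q qs.
by apply: fg; rewrite inE qs orbT.
Qed.

(** Removes the latest time [x] in favour of [y], at the cost of one increment. It is applied to the
    path and also to the function min (t, .), which gives the corresponding splitting of the
    covariance. *)
Lemma lin_min_split (R : realType) (s : seq (R * R)) (x y : R) (f : R -> R) :
  y < x -> (forall p, p \in s -> p.2 <= y \/ p.2 = x) ->
  lin s f = lin [seq (p.1, Num.min p.2 y) | p <- s] f +
    lin s (fun t => (t == x)%:R) * (f x - f y).
Proof.
move=> yx; elim: s => [_|p s IH sP]; first by rewrite !lin_nil mul0r addr0.
rewrite /= !lin_cons IH /=; last by move=> q qs; apply: sP; rewrite inE qs orbT.
case: (sP p); first by rewrite inE eqxx.
- move=> py; rewrite min_l// lt_eqF ?(le_lt_trans py)//.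
  by rewrite mulr0 add0r addrA.
- by move=> ->; rewrite eqxx min_r ?(ltW yx)//=; ring.
Qed.

Section brownian_gaussian.
Context {R : realType} {T : set R} {d} {Omega : measurableType d}
  {P : probability Omega R} {W : R -> Omega -> R}.
Hypothesis T0 : T 0.
Hypothesis T_ge0 : forall t, T t -> 0 <= t.

Let mincov (s t : R) := Num.min s t.

(** Induction on the number of times: the increment over the last interval is normal and independent
    of everything before, so one Gaussian factor is split off at each stage. *)
Lemma brownian_gaussian : brownian_motion T P W ->
  gaussian_family T P W (fun s t => Num.min s t).
Proof.
move=> [[mW _] W0 Wnormal Windep]; split => // s phi Ts.
suff main : forall tau : seq R, path <%R 0 tau -> (forall t, t \in tau -> T t) ->
    forall s phi, (forall p, p \in s -> p.2 \in 0 :: tau) ->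
    Ex P (fun w => cos (lin s (W^~ w) + phi)) =
    cos phi * expR (- (cov_lin mincov s s / 2)).
  pose tau := sort <=%O (undup [seq p.2 | p <- s & p.2 != 0]).
  have tauP t : t \in tau -> T t /\ t != 0.
    rewrite mem_sort mem_undup => /mapP[p]; rewrite mem_filter => /andP[p0 ps] ->.
    by split=> //; exact/set_mem/(allP Ts).
  apply: (main tau).
  - rewrite path_sortedE; last exact: lt_trans.
    rewrite sort_lt_sorted undup_uniq andbT; apply/allP => t /tauP[Tt t0].
    by rewrite lt_neqAle eq_sym t0 T_ge0.
  - by move=> t /tauP[].
  - move=> p ps; rewrite inE mem_sort mem_undup; have [//|p0] := eqVneq p.2 0.
    by apply/mapP; exists p => //; rewrite mem_filter p0.
have le_last : forall tau : seq R, path <%R 0 tau -> forall z, z \in 0 :: tau -> z <= last 0 tau.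
  move=> tau; elim/last_ind: tau => [_ z|tau x IH]; first by rewrite inE => /eqP ->.
  rewrite rcons_path last_rcons => /andP[/IH {}IH lx] z.
  rewrite -rcons_cons mem_rcons inE => /predU1P[->//|/IH zl].
  exact: le_trans zl (ltW lx).
move=> tau; elim/last_ind: tau => [|tau x IH].
  move=> _ _ {Ts}s {}phi s0.
  have -> : cov_lin mincov s s = 0.
    rewrite /cov_lin (eq_lin_mem (g := fun=> 0)) ?lin0// => p /s0.
    rewrite inE => /eqP ->; rewrite (eq_lin_mem (g := fun=> 0)) ?lin0// => q /s0.
    by rewrite inE => /eqP ->; rewrite /mincov minxx.
  rewrite mul0r oppr0 expR0 mulr1 -[RHS](Ex_cst P).
  have mW0 : measurable_fun setT (W 0) by exact: mW.
  have lE w : lin s (W^~ w) = lin s (fun=> 1) * W 0 w.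
    elim: s s0 => [|p s IH] s0; first by rewrite !lin_nil mul0r.
    rewrite !lin_cons IH; last by move=> q qs; apply: s0; rewrite inE qs orbT.
    have : p.2 \in [:: 0] by apply: s0; rewrite inE eqxx.
    by rewrite inE => /eqP ->; ring.
  under eq_fun do rewrite lE.
  rewrite /Ex /Rintegral; congr fine; apply: ae_eq_integral => //.
  - apply/measurable_EFinP.
    have [] := @bounded_mfun_cos _ _ _ (fun w => lin s (fun=> 1) * W 0 w + phi) _ => //.
    by apply: measurable_funD => //; exact: measurable_funM.
  - by apply: filterS W0 => w -> _; rewrite mulr0 add0r.
rewrite rcons_path => /andP[ptau yx] tauT {Ts}s {}phi sP.
set y := last 0 tau in yx.
have Tx : T x by apply: tauT; rewrite mem_rcons inE eqxx.
have tauT' t : t \in tau -> T t by move=> tt; apply: tauT; rewrite mem_rcons inE tt orbT.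
have ytau : y \in 0 :: tau by exact: mem_last.
have Ttau t : t \in 0 :: tau -> T t.
  by rewrite inE => /predU1P[->//|]; exact: tauT'.
have Ty : T y by exact: Ttau.
have sP' p : p \in s -> p.2 <= y \/ p.2 = x.
  move=> /sP; rewrite inE mem_rcons inE orbCA => /predU1P[->|h]; first by right.
  by left; apply: le_last; rewrite // inE.
pose s' := [seq (p.1, Num.min p.2 y) | p <- s].
pose A := lin s (fun t => (t == x)%:R : R).
have s'P p : p \in s' -> p.2 \in 0 :: tau.
  move=> /mapP[q qs ->] /=; have := sP _ qs.
  rewrite inE mem_rcons inE orbCA => /predU1P[->|h]; first by rewrite min_r// ltW.
  by rewrite min_l ?inE// le_last// inE.
(* Moving the mass at x down to y lowers the variance by that of the last increment; [A] is the
   total coefficient carried by time x. *)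
have covE : cov_lin mincov s s = cov_lin mincov s' s' + A ^+ 2 * (x - y).
  have minE t : 0 <= y -> lin s (mincov t) =
      lin s' (mincov t) + A * (mincov t x - mincov t y).
    by move=> _; exact: lin_min_split.
  have y0 : 0 <= y by apply: le_last => //; rewrite inE eqxx.
  rewrite /cov_lin; under eq_fun do rewrite minE//.
  rewrite linD -/mincov.
  have -> : lin s (fun t => lin s' (mincov t)) = cov_lin mincov s' s'.
    rewrite /cov_lin (lin_min_split _ yx sP') -/s' -/A.
    have -> : lin s' (mincov x) = lin s' (mincov y).
      apply: eq_lin_mem => p /s'P/(le_last _ ptau) py.
      by rewrite /mincov !min_r// (le_trans py)// ltW.
    by rewrite subrr mulr0 addr0.
  congr (_ + _); under eq_fun do rewrite mulrC.
  rewrite (_ : lin s _ = lin s (fun t => A * ((t == x)%:R * (x - y)))); last first.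
    apply: eq_lin_mem => p /sP' ps.
    rewrite mulrC; congr (_ * _); rewrite /mincov.
    case: ps => [py|->]; last by rewrite eqxx minxx min_r ?ltW// mul1r.
    rewrite !min_l ?(le_trans py) ?(ltW yx)// subrr lt_eqF ?mul0r//.
    exact: le_lt_trans py yx.
  rewrite linZ; under eq_fun do rewrite mulrC.
  by rewrite linZ -/A; ring.
have s'T : supported (T `&` `]-oo, y]) s'.
  apply/allP => p /s'P ps; apply/mem_set; split; first exact: Ttau.
  by rewrite /= in_itv/=; exact: le_last.
have mlin : measurable_fun setT ((fun w => lin s' (W^~ w)) :
    sigma_type (T `&` `]-oo, y]) W -> R).
  apply: measurable_lin s'T => i Ti; exact: sigma_type_measurable.
have mlin' : measurable_fun setT (fun w => lin s' (W^~ w)).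
  by apply: (measurable_lin (T := T)) => //; apply/allP => p /s'P/Ttau/mem_set.
have mD : measurable_fun setT (increment W y x).
  by apply: measurable_funB; exact: mW.
have ind (B C : set R) : measurable B -> measurable C ->
    P (increment W y x @^-1` B `&` (fun w => lin s' (W^~ w)) @^-1` C) =
    (P (increment W y x @^-1` B) * P ((fun w => lin s' (W^~ w)) @^-1` C))%E.
  move=> mB mC; rewrite setIC muleC; apply: Windep => //.
  exact: sigma_of_preimage mlin mC.
have bc (f : R -> R) c : measurable_fun setT f -> bounded_mfun (fun u : R => cos (f u + c)).
  by move=> mf; apply: bounded_mfun_cos; exact: measurable_funD.
have cfD c : Ex P (fun w => cos (A * increment W y x w + c)) =
    cos c * expR (- (A ^+ 2 * (x - y) / 2)).
  rewrite (@cf_of_normal_law _ _ _ P _ mD (Num.sqrt (x - y))).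
  - by rewrite sqr_sqrtr// subr_ge0 ltW.
  - by rewrite gt_eqF// sqrtr_gt0 subr_gt0.
  - by move=> B mB; exact: Wnormal.
(* The addition formula, with sines written as cosines of phase - pi / 2. The second product has
   expectation 0, because the increment is centred and cos (pi / 2) = 0. *)
have LE w : cos (lin s (W^~ w) + phi) =
    cos (A * increment W y x w + 0) * cos (lin s' (W^~ w) + phi) -
    cos (A * increment W y x w + (- (pi / 2))) * cos (lin s' (W^~ w) + (phi - pi / 2)).
  have sE z : cos (z - pi / 2) = sin z.
    by rewrite cosB cos_pihalf sin_pihalf mulr0 add0r mulr1.
  rewrite addr0 addrA !sE -cosD (lin_min_split _ yx sP') -/s' -/A.
  by congr cos; rewrite /increment; ring.
under eq_fun do rewrite LE.
have bD c : bounded_mfun (fun u : R => cos (A * u + c)).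
  by apply: bc; exact: measurable_funM.
have bS c : bounded_mfun (fun u : R => cos (u + c)) by exact: (bc id).
have bDW c : bounded_mfun (fun w => cos (A * increment W y x w + c)).
  exact: (bounded_mfun_comp mD (bD c)).
have bSW c : bounded_mfun (fun w => cos (lin s' (W^~ w) + c)).
  exact: (bounded_mfun_comp mlin' (bS c)).
rewrite ExB; [|exact: bounded_mfunM|exact: bounded_mfunM].
rewrite (Ex_indep mD mlin' ind (bD 0) (bS phi)).
rewrite (Ex_indep mD mlin' ind (bD (- (pi / 2))) (bS (phi - pi / 2))).
rewrite !cfD cosN cos_pihalf !mul0r subr0 cos0 mul1r IH// covE.
by rewrite mulrCA -expRD; congr (_ * expR _); ring.
Qed.

Lemma gaussian_ae0 (X : R -> Omega -> R) C t : gaussian_family T P X C -> T t ->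
  C t t = 0 -> {ae P, forall w, X t w = 0}.
Proof.
move=> gX Tt C0.
have Ts : supported T [:: (1 : R, t)] by rewrite /supported/= mem_set.
have := gaussian_family_law gX Ts (measurable_set1 0).
have -> : cov_lin C [:: (1 : R, t)] [:: (1 : R, t)] = 0.
  by rewrite /cov_lin !lin_seq1/= !mul1r.
rewrite sqrtr0 eqxx => h.
have m0 : measurable [set w | X t w = 0].
  have [mX _] := gX; rewrite -[X in measurable X]setTI.
  exact: (mX _ Tt measurableT [set (0 : R)]).
exists (~` [set w | X t w = 0]); split; first exact: measurableC.
  rewrite probability_setC//.
  have -> : P [set w | X t w = 0] = 1%E.
    move: h; rewrite (_ : [set w | _] = [set w | X t w = 0]); last first.
      by apply/seteqP; split => w/=; rewrite lin_seq1/= mul1r.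
    by move=> ->; rewrite diracE mem_set.
  by rewrite subee.
by [].
Qed.

(** Independence of the increments holds because min (u, t) - min (u, s) = 0 for u <= s <= t, so the
    increment is uncorrelated with the past. *)
Lemma gaussian_brownian : continuous_process T W ->
  gaussian_family T P W (fun s t => Num.min s t) -> brownian_motion T P W.
Proof.
move=> cW gW; have [mW _] := gW; split => //.
- by apply: (gaussian_ae0 gW T0); rewrite minxx.
- move=> s t Ts Tt st B mB.
  have Tl : supported T [:: (1 : R, t); (-1 : R, s)].
    by rewrite /supported/= !mem_set.
  have := gaussian_family_law gW Tl mB.
  have -> : cov_lin (fun s t => Num.min s t) [:: (1 : R, t); (-1 : R, s)]
      [:: (1 : R, t); (-1 : R, s)] = t - s.
    rewrite /cov_lin !lin_cons !lin_nil/= !minxx.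
    by rewrite (min_r (ltW st)) (min_l (ltW st)); ring.
  rewrite gt_eqF ?sqrtr_gt0 ?subr_gt0// => <-; congr (P _).
  apply/seteqP; split => w; rewrite /increment/= !lin_cons lin_nil/=;
    by rewrite mul1r mulN1r addr0.
- move=> s t Ts Tt st A B WA mB.
  have := @gaussian_family_indep _ _ _ P R R unit T (T `&` `]-oo, s]) setT W
    (fun s t => Num.min s t) (fun u => [:: (1, u)])
    (fun=> [:: (1, t); (-1, s)]) gW.
  have -> : (fun j w => lin [:: (1, j)] (W^~ w)) = W.
    by apply/funext => j; apply/funext => w; rewrite lin_seq1 mul1r.
  have -> : (fun (k : unit) w => lin [:: (1, t); (-1, s)] (W^~ w)) =
      (fun=> increment W s t).
    apply/funext => j; apply/funext => w; rewrite !lin_cons lin_nil /increment/=.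
    by rewrite mul1r mulN1r addr0.
  move=> h; apply: (trig_indep_sets _ _ (h _ _ _ _)) WA _.
  + by move=> i [Ti _]; exact: mW.
  + by move=> _ _; apply: measurable_funB; exact: mW.
  + by move=> i j; rewrite minC.
  + by move=> j [Tj _]; rewrite /supported/= mem_set.
  + by move=> k _; rewrite /supported/= !mem_set.
  + move=> u _ [_ /=]; rewrite in_itv/= => us _.
    rewrite /cov_lin !lin_cons !lin_nil/= !min_l// ?(le_trans us (ltW st))//.
    ring.
  + by apply: sub_sigma_algebra; exists tt => //; exists B => //; rewrite setTI.
Qed.

End brownian_gaussian.

(** * Riemann and Stieltjes sums *)

Section within_continuity.
Context {R : realType}.
Implicit Types (A : set R) (f g : R -> R).

Lemma within_continuousP A f : {within A, continuous f} <->
  forall x, A x -> forall e, 0 < e -> exists2 d, 0 < d &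
    forall y, A y -> `|x - y| < d -> `|f x - f y| < e.
Proof.
split=> [/subspace_continuousP cf x Ax e e0|h].
  have /cvgrPdist_lt/(_ _ e0) := cf _ Ax.
  rewrite /= near_withinE => /nbhs_ballP[d /= d0 dP].
  by exists d => // y Ay xy; exact: dP.
apply/subspace_continuousP => x Ax; apply/cvgrPdist_lt => e e0.
have [d d0 dP] := h _ Ax _ e0.
rewrite /= near_withinE; apply/nbhs_ballP; exists d => //= y xy Ay.
exact: dP.
Qed.

Lemma within_continuous_ext A f g : (forall x, A x -> f x = g x) ->
  {within A, continuous f} -> {within A, continuous g}.
Proof.
move=> fg /within_continuousP cf; apply/within_continuousP => x Ax e e0.
have [d d0 dP] := cf _ Ax _ e0; exists d => // y Ay xy.
by rewrite -!fg//; exact: dP.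
Qed.

(** Compactness is used as a near covering, with the radius as the parameter that tends to 0 from
    the right. *)
Lemma heine_cantor f (a b : R) : {within `[a, b], continuous f} ->
  forall e, 0 < e -> exists2 d, 0 < d &
    forall x y, a <= x <= b -> a <= y <= b -> `|x - y| < d -> `|f x - f y| < e.
Proof.
move=> /within_continuousP cf e e0.
have := @segment_compact R a b.
move/compact_near_coveringP/near_covering_withinP => /(_ R (0^'+)
  (fun d x => forall y, a <= y <= b -> `|x - y| < d -> `|f x - f y| < e)) H.
have : \forall d \near 0^'+, `[a, b]%classic `<=` (fun x => forall y, a <= y <= b ->
    `|x - y| < d -> `|f x - f y| < e).
  apply: H => x xab.
  have [d d0 dP] := cf _ xab _ (divr_gt0 e0 (ltr0n _ 2)).
  near=> z d'.
  have xz : `|x - z| < d / 2.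
    by near: z; apply/nbhs_ballP; exists (d / 2) => //=; rewrite divr_gt0.
  have d'd : d' <= d / 2.
    by near: d'; apply: nbhs_right_le; rewrite divr_gt0.
  move=> zab y yab zy.
  have xy : `|x - y| < d.
    rewrite (splitr d) -(subrKA z) (le_lt_trans (ler_normD _ _))// ltrD//.
    by rewrite (lt_le_trans zy).
  rewrite (splitr e) -(subrKA (f x)) (le_lt_trans (ler_normD _ _))// ltrD//.
    rewrite distrC; apply: dP => //; apply: (lt_trans xz).
    by rewrite ltr_pdivrMr// ltr_pMr// ltr1n.
  by apply: dP => //; rewrite /= in_itv.
case=> d /= d0 dP; exists (d / 2); first by rewrite divr_gt0.
move=> x y xab yab xy; apply: (dP (d / 2)) => //=.
- rewrite sub0r normrN ger0_norm ?ltr_pdivrMr ?ltr_pMr ?ltr1n//.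
  by rewrite ltW// divr_gt0.
- by rewrite divr_gt0.
Unshelve. all: by end_near. Qed.

Lemma within_continuous_bounded f (a b : R) : {within `[a, b], continuous f} ->
  exists2 K, 0 < K & forall x, a <= x <= b -> `|f x| <= K.
Proof.
have [ab|ab] := leP a b; last first.
  by move=> _; exists 1 => // x /andP[ax xb]; move: (le_trans ax xb); rewrite leNgt ab.
move=> cf; have cnf : {within `[a, b], continuous (fun x => `|f x|)}.
  move/within_continuousP : cf => cf; apply/within_continuousP => x Ax e e0.
  have [d d0 dP] := cf _ Ax _ e0; exists d => // y Ay xy.
  by rewrite (le_lt_trans (ler_dist_dist _ _))// dP.
have [c _ cM] := EVT_max ab cnf; exists (`|f c| + 1) => [|x xab].
  by rewrite ltr_wpDl.
by rewrite (le_trans (cM _ _)) ?in_itv//= lerDl.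
Qed.

Lemma within_continuousD A f g : {within A, continuous f} ->
  {within A, continuous g} -> {within A, continuous (fun x => f x + g x)}.
Proof. by move=> cf cg x; apply: cvgD; [exact: cf|exact: cg]. Qed.

Lemma within_continuousB A f g : {within A, continuous f} ->
  {within A, continuous g} -> {within A, continuous (fun x => f x - g x)}.
Proof. by move=> cf cg x; apply: cvgB; [exact: cf|exact: cg]. Qed.

Lemma within_continuousM A f g : {within A, continuous f} ->
  {within A, continuous g} -> {within A, continuous (fun x => f x * g x)}.
Proof. by move=> cf cg x; apply: cvgM; [exact: cf|exact: cg]. Qed.

Lemma within_continuous_cst A (c : R) : {within A, continuous (fun=> c)}.
Proof. by move=> x; exact: cvg_cst. Qed.

Lemma within_continuousN A f : {within A, continuous f} ->
  {within A, continuous (fun x => - f x)}.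
Proof. by move=> cf x; apply: cvgN; exact: cf. Qed.

Lemma continuous_within A f : continuous f -> {within A, continuous f}.
Proof. exact: continuous_subspaceT. Qed.

Lemma within_continuous_sub A B f : B `<=` A -> {within A, continuous f} ->
  {within B, continuous f}.
Proof. by move=> BA; exact: continuous_subspaceW. Qed.

End within_continuity.

Section antiderivative.
Context {R : realType}.
Implicit Types (f g F : R -> R).
Local Notation mu := (@lebesgue_measure R).

Lemma within_continuous_integrable f (a b : R) : {within `[a, b], continuous f} ->
  mu.-integrable `[a, b] (EFin \o f).
Proof. by apply: continuous_compact_integrable; exact: segment_compact. Qed.

Lemma is_derive_Rintegral f (b x : R) : {within `[0, b], continuous f} ->
  0 < x < b -> is_derive x 1 (fun t => \int[mu]_(u in `[0, t]) f u) (f x).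
Proof.
move=> cf /andP[x0 xb]; have b0 := lt_trans x0 xb.
have /(continuous_within_itvP _ b0)[cf' _ _] := cf.
have cx : {for x, continuous f} by apply: cf'; rewrite in_itv/= x0.
have [d1 d2] := continuous_FTC1_closed xb (within_continuous_integrable cf) x0 cx.
by apply: DeriveDef => //; rewrite -derive1E.
Qed.

Lemma within_continuous_Rintegral f (b : R) : 0 <= b ->
  {within `[0, b], continuous f} ->
  {within `[0, b], continuous (fun t => \int[mu]_(u in `[0, t]) f u)}.
Proof.
move=> b0 cf; exact: (parameterized_integral_continuous b0 (within_continuous_integrable cf)).
Qed.

Lemma Rintegral_itv00 f : \int[mu]_(u in `[0, 0]) f u = 0.
Proof. by rewrite set_itv1 Rintegral_set1. Qed.

End antiderivative.

(** The equidistant grid of [0, 1] stopped at [s]. The number of points does not depend on [s], and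
    grids for different [s] share their points below the smaller of the two; this makes covariances
    of sums up to different times computable. For s <= 1 the last point is [s]. *)
Definition grid (R : realType) (s : R) (n k : nat) : R := Num.min (k%:R / n.+1%:R) s.

Section stieltjes.
Context {R : realType}.
Implicit Types (s : R) (n k : nat).
Local Notation mu := (@lebesgue_measure R).

Lemma grid0 s n : 0 <= s -> grid s n 0 = 0.
Proof. by move=> s0; rewrite /grid mul0r min_l. Qed.

Lemma grid_last s n : s <= 1 -> grid s n n.+1 = s.
Proof. by move=> s0; rewrite /grid divff ?pnatr_eq0// min_r. Qed.

Lemma grid_le s n k : grid s n k <= s.
Proof. by rewrite /grid ge_min lexx orbT. Qed.

Lemma grid_ge0 s n k : 0 <= s -> 0 <= grid s n k.
Proof. by move=> s0; rewrite /grid le_min s0 divr_ge0. Qed.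

Lemma grid_step s n k : 0 <= grid s n k.+1 - grid s n k <= n.+1%:R^-1.
Proof.
have c0 : 0 < n.+1%:R^-1 :> R by rewrite invr_gt0.
rewrite /grid -[k.+1%:R]natr1 mulrDl mul1r.
set c := n.+1%:R^-1 in c0 *; set x := k%:R * c.
have [xs|sx] := leP x s; have [xcs|sxc] := leP (x + c) s;
  rewrite ?(min_l xs) ?(min_r (ltW sx)) ?(min_l xcs) ?(min_r (ltW sxc));
  apply/andP; split; lra.
Qed.

(* Stieltjes sums on the grid [k / (n + 1)] stopped at [s], with left ([e = 0])
   or right ([e = 1]) tags. *)
Lemma cvg_stieltjes (s : R) (g phi Phi : R -> R) (e : bool) : 0 <= s <= 1 ->
  {within `[0, s], continuous g} -> {within `[0, s], continuous phi} ->
  {within `[0, s], continuous Phi} ->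
  (forall x, 0 < x < s -> is_derive x 1 Phi (phi x)) ->
  \sum_(k < n.+1) g (grid s n (k + e)) * (Phi (grid s n k.+1) - Phi (grid s n k))
    @[n --> \oo] --> \int[mu]_(u in `[0, s]) (g u * phi u).
Proof.
move=> /andP[s0 s1] cg cphi cPhi dPhi.
have cgp := within_continuousM cg cphi.
pose H t := \int[mu]_(u in `[0, t]) (g u * phi u).
have [K K0 phiK] := within_continuous_bounded cphi.
apply/cvgrPdist_le => eps eps0.
have [d d0 gd] := heine_cantor cg (divr_gt0 eps0 K0).
near=> n.
have nd : n.+1%:R^-1 < d.
  near: n; exists (Num.truncn d^-1) => // m /= dm.
  rewrite -[ltRHS]invrK ltf_pV2 ?posrE ?invr_gt0//.
  by rewrite (lt_le_trans (truncnS_gt _))// ler_nat ltnS.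
have step k : `|H (grid s n k.+1) - H (grid s n k) -
    g (grid s n (k + e)) * (Phi (grid s n k.+1) - Phi (grid s n k))| <=
    eps * (grid s n k.+1 - grid s n k).
  set a := grid s n k; set b := grid s n k.+1; set t := grid s n (k + e).
  have /andP[ab0 abn] := grid_step s n k.
  have ab : a <= b by rewrite -subr_ge0.
  have a0 : 0 <= a by exact: grid_ge0.
  have bs : b <= s by exact: grid_le.
  have tab : a <= t <= b.
    rewrite /t; case: (e) => /=; first by rewrite addn1 lexx andbT.
    by rewrite addn0 lexx.
  have sub : `[a, b] `<=` `[0, s].
    by apply: subset_itv; rewrite bnd_simp.
  (* On one cell the mean value theorem is applied to [D], whose derivative (g x - g t) phi x is at
     most (eps / K) K by uniform continuity. Summing over the cells gives at most eps. *)
  pose D x := H x - g t * Phi x.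
  have dD x : x \in `]a, b[ -> is_derive x 1 D ((g x - g t) * phi x).
    rewrite in_itv/= => /andP[ax xb].
    have x0s : 0 < x < s by rewrite (le_lt_trans a0 ax) (lt_le_trans xb bs).
    have h1 := is_derive_Rintegral cgp x0s.
    have h2 := dPhi _ x0s.
    by rewrite /D /H; apply: is_derive_eq; rewrite /GRing.scale/=; ring.
  have cD : {within `[a, b], continuous D}.
    apply: (within_continuous_sub sub); apply: within_continuousB.
      exact: within_continuous_Rintegral.
    by apply: within_continuousM => //; exact: within_continuous_cst.
  have [c /[!in_itv]/= /andP[ac cb] DE] := MVT_segment ab dD cD.
  have -> : H b - H a - g t * (Phi b - Phi a) = D b - D a by rewrite /D; ring.
  rewrite DE normrM [X in _ * X <= _]ger0_norm// ler_wpM2r//.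
  have /andP[at_ tb] := tab.
  rewrite normrM -[leRHS](divfK (lt0r_neq0 K0)) ler_pM//.
    apply: ltW; apply: gd; first lra.
      lra.
    rewrite (le_lt_trans _ nd)// (le_trans _ abn)// -/a -/b ler_norml; apply/andP; split; lra.
  by apply: phiK; lra.
have HE : H s = \sum_(k < n.+1) (H (grid s n k.+1) - H (grid s n k)).
  rewrite -(big_mkord xpredT (fun k => H (grid s n k.+1) - H (grid s n k))).
  rewrite telescope_sumr// grid_last// grid0//.
  by rewrite [X in _ = _ - X]Rintegral_itv00 subr0.
have GE : \sum_(k < n.+1) (grid s n k.+1 - grid s n k) = s.
  rewrite -(big_mkord xpredT (fun k => grid s n k.+1 - grid s n k)).
  by rewrite telescope_sumr// grid_last// grid0// subr0.
rewrite -/(H s) HE -sumrB (le_trans (ler_norm_sum _ _ _))//.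
apply: (@le_trans _ _ (\sum_(k < n.+1) eps * (grid s n k.+1 - grid s n k))).
  by apply: ler_sum => k _; exact: step.
by rewrite -mulr_sumr GE ler_piMr// ltW.
Unshelve. all: by end_near. Qed.

End stieltjes.

(** Values, areas, Wiener integrals, the solution of the equation and its noise are all of this
    form, so measurability and the transfer of laws are proved once. *)
Definition path_functional (R : realType) (p : seq (R * R)) (s : R) (f x : R -> R) : R :=
  lin p x + \int[lebesgue_measure]_(u in `[0, s]) (x u * f u).

Definition riemann_comb (R : realType) (p : seq (R * R)) (s : R) (f : R -> R) (n : nat) :=
  p ++ [seq (f (grid s n k) * (grid s n k.+1 - grid s n k), grid s n k) | k <- iota 0 n.+1].

Section path_functional.
Context {R : realType}.
Implicit Types (p : seq (R * R)) (s : R) (f x : R -> R).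

Lemma cvg_riemann_comb p s f x : 0 <= s <= 1 ->
  {within `[0, s], continuous f} -> {within `[0, s], continuous x} ->
  lin (riemann_comb p s f n) x @[n --> \oo] --> path_functional p s f x.
Proof.
move=> s01 cf cx; under eq_fun do rewrite lin_cat.
apply: cvgD; first exact: cvg_cst.
have := @cvg_stieltjes R s (fun u => x u * f u) (fun=> 1) idfun false s01.
move=> /(_ (within_continuousM cx cf) (@within_continuous_cst R `[0, s] 1)).
have cid : {within `[0, s], continuous (idfun : R -> R)}.
  by apply: continuous_within => u; exact: cvg_id.
have did (u : R) : 0 < u < s -> is_derive u 1 (idfun : R -> R) 1.
  by move=> _; exact: is_derive_id.
move=> /(_ cid did).
under [X in _ --> X -> _]eq_Rintegral do rewrite mulr1.
apply: cvg_trans; apply: near_eq_cvg; near=> n.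
rewrite /lin big_map -[iota 0 _]/(index_iota 0 n.+1) big_mkord.
by apply: eq_bigr => k _; rewrite addn0 /=; ring.
Unshelve. all: by end_near. Qed.

Lemma supported_riemann (T : set R) p s f n : 0 <= s -> supported T p ->
  (forall u, 0 <= u <= s -> T u) -> supported T (riemann_comb p s f n).
Proof.
move=> s0 Tp Ts; rewrite supported_cat Tp /supported all_map; apply/allP => k _ /=.
by apply/mem_set/Ts; rewrite grid_ge0// grid_le.
Qed.

Lemma measurable_path_functional d (Omega : measurableType d) (T : set R)
    (X : R -> Omega -> R) p s f : 0 <= s <= 1 ->
  (forall u, 0 <= u <= s -> T u) -> supported T p ->
  {within `[0, s], continuous f} ->
  (forall w, {within `[0, s], continuous (X^~ w)}) ->
  (forall u, T u -> measurable_fun setT (X u)) ->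
  measurable_fun setT (fun w => path_functional p s f (X^~ w)).
Proof.
move=> s01 Ts Tp cf cX mX.
apply: (@measurable_fun_cvg _ _ _ _ (fun n w => lin (riemann_comb p s f n) (X^~ w))).
  move=> n; apply: (measurable_lin mX); apply: supported_riemann => //.
  by case/andP: s01.
by move=> w _; exact: cvg_riemann_comb.
Qed.

End path_functional.

Section same_cf_path_functional.
Context {R : realType} {T : set R}.
Context {d} {Omega : measurableType d} {P : probability Omega R} {X : R -> Omega -> R}.
Context {d'} {Omega' : measurableType d'} {P' : probability Omega' R}
  {X' : R -> Omega' -> R}.
Context {J : Type} {S : set J} (p : J -> seq (R * R)) (tau : J -> R) (f : J -> R -> R).
Hypothesis mX : forall u, T u -> measurable_fun setT (X u).
Hypothesis mX' : forall u, T u -> measurable_fun setT (X' u).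
Hypothesis tau01 : forall j, S j -> 0 <= tau j <= 1.
Hypothesis tauT : forall j u, S j -> 0 <= u <= tau j -> T u.
Hypothesis pT : forall j, S j -> supported T (p j).
Hypothesis cf : forall j, S j -> {within `[0, tau j], continuous (f j)}.
Hypothesis cX : forall j w, S j -> {within `[0, tau j], continuous (X^~ w)}.
Hypothesis cX' : forall j w, S j -> {within `[0, tau j], continuous (X'^~ w)}.

(** Both characteristic functions are limits of those of Riemann sums, which are finite combinations
    of values and agree at every stage. *)
Lemma same_cf_path_functional : same_cf T P X P' X' ->
  same_cf S P (fun j w => path_functional (p j) (tau j) (f j) (X^~ w))
            P' (fun j w => path_functional (p j) (tau j) (f j) (X'^~ w)).
Proof.
move=> XX s phi Ss.
pose r n := subst_comb (fun j => riemann_comb (p j) (tau j) (f j) n) s.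
have Tr n : supported T (r n).
  apply: supported_subst Ss => j Sj; apply: supported_riemann; [|exact: pT|].
    by case/andP: (tau01 Sj).
  by move=> u; exact: tauT.
have mcos d0 (O : measurableType d0) (Z : R -> O -> R) n :
    (forall u, T u -> measurable_fun setT (Z u)) ->
    measurable_fun setT (fun w => cos (lin (r n) (Z^~ w) + phi)).
  by move=> mZ; case: (bounded_trig mZ (trig_cos phi (Tr n))).
have lim d0 (O : measurableType d0) (Q : probability O R) (Z : R -> O -> R) :
    (forall u, T u -> measurable_fun setT (Z u)) ->
    (forall j w, S j -> {within `[0, tau j], continuous (Z^~ w)}) ->
    Ex Q (fun w => cos (lin (r n) (Z^~ w) + phi)) @[n --> \oo] -->
    Ex Q (fun w => cos (lin s (fun j => path_functional (p j) (tau j) (f j) (Z^~ w)) + phi)).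
  move=> mZ cZ.
  have cv w : cos (lin (r n) (Z^~ w) + phi) @[n --> \oo] -->
      cos (lin s (fun j => path_functional (p j) (tau j) (f j) (Z^~ w)) + phi).
    apply: (@cvg_comp _ _ _ _ cos); last exact: continuous_cos.
    apply: cvgD; last exact: cvg_cst.
    under eq_fun do rewrite lin_subst.
    apply: (cvg_lin Ss) => j Sj; apply: cvg_riemann_comb; [exact: tau01|exact: cf|exact: cZ].
  apply: (@Ex_cvg _ _ _ _ _ _ 1).
  - by move=> n; exact: mcos.
  - apply: (@measurable_fun_cvg _ _ _ _ (fun n w => cos (lin (r n) (Z^~ w) + phi))).
      by move=> n; exact: mcos.
    by move=> w _; exact: cv.
  - by move=> n w; rewrite ler_norml cos_geN1 cos_le1.
  - by apply: aeW => w; exact: cv.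
have c1 := lim _ _ P X mX cX.
have c2 := lim _ _ P' X' mX' cX'.
have e : (fun n => Ex P (fun w => cos (lin (r n) (X^~ w) + phi))) =
    (fun n => Ex P' (fun w => cos (lin (r n) (X'^~ w) + phi))).
  by apply/funext => n; exact: XX.
by rewrite e in c1; apply: (cvg_unique _ c1 c2).
Qed.

End same_cf_path_functional.

(** * Wiener integrals *)

Definition increment_comb (R : realType) (s : R) (phi : R -> R) (n : nat) : seq (R * R) :=
  flatten [seq [:: (phi (grid s n k), grid s n k.+1); (- phi (grid s n k), grid s n k)]
          | k <- iota 0 n.+1].

Section wiener.
Context {R : realType}.
Local Notation mu := (@lebesgue_measure R).

Lemma lin_increment_comb (s : R) (phi f : R -> R) n :
  lin (increment_comb s phi n) f =
  \sum_(k < n.+1) phi (grid s n k) * (f (grid s n k.+1) - f (grid s n k)).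
Proof.
rewrite -(big_mkord xpredT (fun k => phi (grid s n k) * (f (grid s n k.+1) - f (grid s n k)))).
rewrite /index_iota subn0 /increment_comb; elim: (iota 0 n.+1) => [|k l IH].
  by rewrite big_nil lin_nil.
by rewrite big_cons -IH /= !lin_cons /=; ring.
Qed.

(* Summation by parts. *)
Lemma cvg_increment_comb (s : R) (phi dphi f : R -> R) : 0 <= s <= 1 ->
  {within `[0, s], continuous phi} -> {within `[0, s], continuous dphi} ->
  (forall u, 0 < u < s -> is_derive u 1 phi (dphi u)) ->
  {within `[0, s], continuous f} ->
  lin (increment_comb s phi n) f @[n --> \oo] -->
  path_functional [:: (phi s, s)] s (fun u => - dphi u) f - phi 0 * f 0.
Proof.
move=> /[dup] s01 /andP[s0 s1] cphi cdphi dphiE cf.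
have := cvg_stieltjes true s01 cf cdphi cphi dphiE => h.
rewrite (_ : _ - _ = (phi s * f s - phi 0 * f 0) -
    \int[mu]_(u in `[0, s]) (f u * dphi u)); last first.
  have -> : \int[mu]_(u in `[0, s]) (f u * dphi u) =
      - \int[mu]_(u in `[0, s]) (f u * - dphi u).
    rewrite -mulN1r -RintegralZl//; last first.
      apply: within_continuous_integrable; apply: within_continuousM => //.
      exact: within_continuousN.
    by apply: eq_Rintegral => u _; rewrite mulN1r mulrN opprK.
  by rewrite /path_functional lin_seq1/=; ring.
have E n : lin (increment_comb s phi n) f = (phi s * f s - phi 0 * f 0) -
    \sum_(k < n.+1) f (grid s n (k + true)) * (phi (grid s n k.+1) - phi (grid s n k)).
  rewrite lin_increment_comb.
  have -> : phi s * f s - phi 0 * f 0 = \sum_(k < n.+1)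
      (phi (grid s n k.+1) * f (grid s n k.+1) - phi (grid s n k) * f (grid s n k)).
    rewrite -(big_mkord xpredT (fun k => phi (grid s n k.+1) * f (grid s n k.+1) -
      phi (grid s n k) * f (grid s n k))).
    by rewrite telescope_sumr// grid_last// grid0.
  rewrite -sumrB; apply: eq_bigr => k _; rewrite addn1; ring.
by under eq_fun do rewrite E; apply: cvgB => //; exact: cvg_cst.
Qed.

Lemma min_grid (s t : R) n k j :
  Num.min (grid s n k) (grid t n j) = grid (Num.min s t) n (minn k j).
Proof.
rewrite /grid minACA; congr (Num.min _ _).
have n0 : 0 < n.+1%:R^-1 :> R by rewrite invr_gt0.
case: (leqP k j) => kj; first by rewrite min_l// ler_pM2r// ler_nat.
by rewrite min_r// ler_pM2r// ler_nat ltnW.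
Qed.

(* Disjoint increments are uncorrelated for the covariance [min]. *)
Lemma cov_increment_comb (s t : R) (phi psi : R -> R) n :
  cov_lin (fun u v => Num.min u v) (increment_comb s phi n) (increment_comb t psi n) =
  \sum_(k < n.+1) phi (grid (Num.min s t) n (k + false)) *
    psi (grid (Num.min s t) n (k + false)) *
    (grid (Num.min s t) n k.+1 - grid (Num.min s t) n k).
Proof.
set m := Num.min s t.
rewrite /cov_lin lin_increment_comb; apply: eq_bigr => k _; rewrite addn0.
rewrite !lin_increment_comb -sumrB (bigD1 k)//= big1 ?addr0; last first.
  move=> j jk; rewrite -mulrBr !min_grid -/m.
  have [jlk|klj|/val_inj jE] := ltngtP j k.
  - have e1 : minn k.+1 j.+1 = j.+1 by apply/minn_idPr; rewrite ltnS ltnW.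
    have e2 : minn k.+1 j = j by apply/minn_idPr; rewrite ltnW// ltnW.
    have e3 : minn k j.+1 = j.+1 by exact/minn_idPr.
    have e4 : minn k j = j by apply/minn_idPr; rewrite ltnW.
    by rewrite e1 e2 e3 ?e4 subrr mulr0.
  - have e1 : minn k.+1 j.+1 = k.+1 by apply/minn_idPl; rewrite ltnS ltnW.
    have e2 : minn k.+1 j = k.+1 by exact/minn_idPl.
    have e3 : minn k j.+1 = k by apply/minn_idPl; rewrite ltnW// ltnW.
    have e4 : minn k j = k by apply/minn_idPl; rewrite ltnW.
    by rewrite e1 e2 e3 ?e4 !subrr mulr0.
  - by rewrite jE eqxx in jk.
rewrite !min_grid -/m minnn (minn_idPr (leqnSn k)) (minn_idPl (leqnSn k)) minnn.
rewrite subrr mulr0 subr0.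
(* Cells beyond min (s, t) are degenerate and contribute 0. On any other cell the left end is below
   both s and t, so the three stopped grids agree there. *)
have [kE|kE] := eqVneq (grid m n k.+1) (grid m n k); first by rewrite kE subrr !mulr0.
have km : k%:R / n.+1%:R < m.
  rewrite ltNge; apply/negP => mk; move/eqP: kE; apply.
  have mk1 : m <= k.+1%:R / n.+1%:R.
    by apply: (le_trans mk); rewrite ler_pM2r ?invr_gt0// ler_nat.
  by rewrite /grid (min_r mk) (min_r mk1).
have ks : k%:R / n.+1%:R <= s by rewrite (le_trans (ltW km))// ge_min lexx.
have kt : k%:R / n.+1%:R <= t by rewrite (le_trans (ltW km))// ge_min lexx orbT.
by rewrite /grid (min_l ks) (min_l kt) (min_l (ltW km)) mulrA.
Qed.

Lemma supported_increment_comb (T : set R) s phi n : 0 <= s ->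
  (forall u, 0 <= u <= s -> T u) -> supported T (increment_comb s phi n).
Proof.
move=> s0 Ts; rewrite /increment_comb.
elim: (iota 0 n.+1) => [//|k l IH] /=; rewrite -/(supported T _).
by rewrite !mem_set//=; apply: Ts; rewrite grid_ge0// grid_le.
Qed.

Context {T : set R} {d} {Omega : measurableType d} {P : probability Omega R}
  {W : R -> Omega -> R}.
Context {J : Type} {S : set J} (tau : J -> R) (phi dphi : J -> R -> R).
Hypothesis tau01 : forall j, S j -> 0 <= tau j <= 1.
Hypothesis tauT : forall j u, S j -> 0 <= u <= tau j -> T u.
Hypothesis cW : forall j w, S j -> {within `[0, tau j], continuous (W^~ w)}.
Hypothesis cphi : forall j, S j -> {within `[0, tau j], continuous (phi j)}.
Hypothesis cdphi : forall j, S j -> {within `[0, tau j], continuous (dphi j)}.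
Hypothesis dphiE : forall j, S j ->
  forall u, 0 < u < tau j -> is_derive u 1 (phi j) (dphi j u).

(* The Wiener integrals [\int phi dW] and Ito's isometry. *)
Lemma wiener_gaussian : {ae P, forall w, W 0 w = 0} ->
  gaussian_family T P W (fun s t => Num.min s t) ->
  gaussian_family S P
    (fun j w => path_functional [:: (phi j (tau j), tau j)] (tau j)
                  (fun u => - dphi j u) (W^~ w))
    (fun i j => \int[mu]_(u in `[0, Num.min (tau i) (tau j)]) (phi i u * phi j u)).
Proof.
move=> W0 gW; have [mW _] := gW.
apply: (@gaussian_family_lim _ _ _ _ _ _
  (fun n j w => lin (increment_comb (tau j) (phi j) n) (W^~ w)) _
  (fun n i j => cov_lin (fun s t => Num.min s t) (increment_comb (tau i) (phi i) n)
     (increment_comb (tau j) (phi j) n))).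
- move=> n; apply: gaussian_family_lin gW _ => j Sj.
  have /andP[t0 t1] := tau01 Sj.
  by apply: supported_increment_comb => // u; exact: tauT.
- move=> j Sj; have /andP[t0 t1] := tau01 Sj.
  apply: (measurable_path_functional (T := T)) => //.
  + exact: tau01.
  + by move=> u; exact: tauT.
  + by rewrite /supported/= mem_set//; apply: (tauT Sj); rewrite t0 lexx.
  + by apply: within_continuousN; exact: cdphi.
  + by move=> w; exact: cW.
- move=> j Sj; apply: filterS W0 => w W0.
  have := cvg_increment_comb (tau01 Sj) (cphi Sj) (cdphi Sj) (dphiE Sj) (@cW j w Sj).
  by rewrite W0 mulr0 subr0.
- move=> i j Si Sj; under eq_fun do rewrite cov_increment_comb.
  set m := Num.min _ _.
  have /andP[i0 i1] := tau01 Si; have /andP[j0 j1] := tau01 Sj.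
  have mi : m <= tau i by rewrite ge_min lexx.
  have mj : m <= tau j by rewrite ge_min lexx orbT.
  have m01 : 0 <= m <= 1 by rewrite le_min i0 j0 (le_trans mi).
  have ci : {within `[0, m], continuous (phi i)}.
    apply: within_continuous_sub (cphi Si); exact: subset_itvl.
  have cj : {within `[0, m], continuous (phi j)}.
    apply: within_continuous_sub (cphi Sj); exact: subset_itvl.
  have cid : {within `[0, m], continuous (idfun : R -> R)}.
    by apply: continuous_within => u; exact: cvg_id.
  have did (u : R) : 0 < u < m -> is_derive u 1 (idfun : R -> R) 1.
    by move=> _; exact: is_derive_id.
  have := cvg_stieltjes false m01 (within_continuousM ci cj)
    (@within_continuous_cst R `[0, m] 1) cid did.
  by under [X in _ --> X -> _]eq_Rintegral do rewrite mulr1.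
Qed.

End wiener.

(** * The equation of the bridge, path by path *)

(* [bridge_kernel s] and [bridge_integrand s] represent the solution of the
   equation as [w s + \int_0^s k(s,u) w_u du = \int_0^s h(s,u) dw_u]; they are
   read off the fundamental solutions [(1-s)^2] and [(1-s)^3] of the linear
   equation [J'' + 4 J' / (1-s) + 6 J / (1-s)^2 = 0]. *)
Definition bridge_kernel (R : realType) (s u : R) : R :=
  2 * (1 - s) * (1 - u)^-1 ^+ 2 - 6 * (1 - s) ^+ 2 * (1 - u)^-1 ^+ 3.

Definition bridge_integrand (R : realType) (s u : R) : R :=
  3 * (1 - s) ^+ 2 * (1 - u)^-1 ^+ 2 - 2 * (1 - s) * (1 - u)^-1.

(** The density of the integrated drift with respect to m, after exchanging the order of
    integration: 4 / (1-u) plus the integral of 6 / (1-r)^2 over r from u to s. *)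
Definition noise_kernel (R : realType) (s u : R) : R :=
  6 * (1 - s)^-1 - 2 * (1 - u)^-1.

Definition bridge_of (R : realType) (w : R -> R) (s : R) : R :=
  path_functional [:: (1, s)] s (bridge_kernel s) w.

Definition noise_of (R : realType) (m : R -> R) (s : R) : R :=
  path_functional [:: (1, s)] s (noise_kernel s) m.

Section bridge_ode.
Context {R : realType}.
Implicit Types (m w f g : R -> R) (s x b : R).
Local Notation mu := (@lebesgue_measure R).
Local Notation Int f := (fun t => \int[mu]_(u in `[0, t]) f u).

Lemma is_derive_inv1 x : x < 1 ->
  is_derive x 1 (fun u : R => (1 - u)^-1) ((1 - x)^-1 ^+ 2).
Proof.
move=> x1; have x0 : 1 - x != 0 by rewrite subr_eq0 gt_eqF.
have h : is_derive x 1 (fun u : R => 1 - u) (-1).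
  by apply: is_derive_eq; rewrite /GRing.scale/=; ring.
have h2 := @is_deriveV R (fun u : R => 1 - u) x _ 1 x0 h.
by apply: is_derive_eq; rewrite /GRing.scale/= exprVn; ring.
Qed.

Lemma within_continuous_inv1 s : s < 1 ->
  {within `[0, s], continuous (fun u : R => (1 - u)^-1)}.
Proof.
move=> s1; apply: continuous_in_subspaceT => x /set_mem/=.
rewrite in_itv/= => /andP[_ xs]; have x1 : x < 1 by exact: le_lt_trans xs s1.
by apply/differentiable_continuous/derivable1_diffP; case: (is_derive_inv1 x1).
Qed.

Lemma within_continuousX (A : set R) f n : {within A, continuous f} ->
  {within A, continuous (fun x => f x ^+ n)}.
Proof.
move=> cf; elim: n => [|n IH]; first exact: within_continuous_cst.
by under eq_fun do rewrite exprS; exact: within_continuousM.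
Qed.

Lemma within_continuous_inv2 s : s < 1 ->
  {within `[0, s], continuous (fun u : R => ((1 - u) ^+ 2)^-1)}.
Proof.
move=> s1; apply: (@within_continuous_ext _ _ (fun u : R => (1 - u)^-1 ^+ 2)).
  by move=> x _; rewrite exprVn.
exact/within_continuousX/within_continuous_inv1.
Qed.

Lemma within_continuous_halfopen f :
  (forall b, 0 <= b < 1 -> {within `[0, b], continuous f}) ->
  {within `[0, 1[, continuous f}.
Proof.
move=> cf; apply/within_continuousP => x /=; rewrite in_itv/= => /andP[x0 x1] e e0.
(* The midpoint of x and 1 leaves room to the right of x inside [0, b]. *)
pose b := (1 + x) / 2.
have b01 : 0 <= b < 1 by rewrite /b; lra.
have xb : `[0, b]%classic x by rewrite /= in_itv/= x0 /b; lra.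
have /within_continuousP/(_ x xb e e0)[d d0 dP] := cf _ b01.
exists (Num.min d (b - x)); first by rewrite lt_min d0 /b; lra.
move=> y /=; rewrite in_itv/= => /andP[y0 y1]; rewrite lt_min => /andP[xyd xyb].
by apply: dP => //=; rewrite in_itv/= y0; move: xyb; rewrite ltr_norml; lra.
Qed.

Lemma halfopen_within_continuous f : {within `[0, 1[, continuous f} ->
  forall b, b < 1 -> {within `[0, b], continuous f}.
Proof.
move=> cf b b1; apply: within_continuous_sub cf => x /=.
by rewrite !in_itv/= => /andP[-> xb]; exact: le_lt_trans xb b1.
Qed.

Lemma continuous_affine (c d : R) : continuous (fun x : R => c + d * x).
Proof.
move=> x; apply: cvgD; first exact: cvg_cst.
by apply: cvgM; [exact: cvg_cst|exact: cvg_id].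
Qed.

Lemma within_continuous_onem (A : set R) : {within A, continuous (fun x : R => 1 - x)}.
Proof.
by under eq_fun do rewrite -mulN1r; apply: continuous_within; exact: continuous_affine.
Qed.

Lemma eq_Rintegral_itv s f g : (forall u, 0 <= u <= s -> f u = g u) ->
  \int[mu]_(u in `[0, s]) f u = \int[mu]_(u in `[0, s]) g u.
Proof.
by move=> fg; apply: eq_Rintegral => u /set_mem/=; rewrite in_itv/=; exact: fg.
Qed.

Lemma within_continuous_bridge_kernel s : s < 1 ->
  {within `[0, s], continuous (bridge_kernel s)}.
Proof.
move=> s1; have ci := within_continuous_inv1 s1; rewrite /bridge_kernel.
by apply: within_continuousB; apply: within_continuousM;
  (exact: within_continuous_cst || exact: within_continuousX).
Qed.

Lemma within_continuous_noise_kernel s : s < 1 ->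
  {within `[0, s], continuous (noise_kernel s)}.
Proof.
move=> s1; have ci := within_continuous_inv1 s1; rewrite /noise_kernel.
apply: within_continuousB; first exact: within_continuous_cst.
by apply: within_continuousM => //; exact: within_continuous_cst.
Qed.

Lemma within_continuous_bridge_integrand s t : t < 1 ->
  {within `[0, t], continuous (bridge_integrand s)}.
Proof.
move=> t1; have ci := within_continuous_inv1 t1; rewrite /bridge_integrand.
apply: within_continuousB; apply: within_continuousM => //;
  by [exact: within_continuous_cst|exact: within_continuousX].
Qed.

Lemma is_derive_bridge_integrand s x : x < 1 ->
  is_derive x 1 (bridge_integrand s) (- bridge_kernel s x).
Proof.
move=> x1; have h := is_derive_inv1 x1; rewrite /bridge_integrand.
by apply: is_derive_eq; rewrite /GRing.scale/= /bridge_kernel; ring.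
Qed.

Lemma bridge_integrand_diag s : s < 1 -> bridge_integrand s s = 1.
Proof.
move=> s1; have s0 : 1 - s != 0 by rewrite subr_eq0 gt_eqF.
by rewrite /bridge_integrand; field.
Qed.

Section existence.
Variable w : R -> R.
Hypothesis cw : {within `[0, 1[, continuous w}.

(** [A] and [B] are the weighted integrals attached to the fundamental solutions (1-s)^2 and (1-s)^3
    by variation of constants; they are differentiable although w is not. *)
Let A t := \int[mu]_(u in `[0, t]) (w u * (1 - u)^-1 ^+ 2).
Let B t := \int[mu]_(u in `[0, t]) (w u * (1 - u)^-1 ^+ 3).

Let cwb b : b < 1 -> {within `[0, b], continuous w}.
Proof. exact: halfopen_within_continuous. Qed.

Let cwi b n : b < 1 -> {within `[0, b], continuous (fun u => w u * (1 - u)^-1 ^+ n)}.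
Proof.
move=> b1; apply: within_continuousM; first exact: cwb.
exact/within_continuousX/within_continuous_inv1.
Qed.

Let bridgeE s : s < 1 ->
  bridge_of w s = w s + 2 * (1 - s) * A s - 6 * (1 - s) ^+ 2 * B s.
Proof.
move=> s1; rewrite /bridge_of /path_functional lin_seq1/= mul1r -addrA; congr (_ + _).
rewrite /A /B -!RintegralZl//; try exact/within_continuous_integrable/cwi.
rewrite -RintegralB//; last 2 first.
- apply: within_continuous_integrable; apply: within_continuousM; last exact: cwi.
  exact: within_continuous_cst.
- apply: within_continuous_integrable; apply: within_continuousM; last exact: cwi.
  exact: within_continuous_cst.
by apply: eq_Rintegral => u _; rewrite /bridge_kernel; ring.
Qed.

Let cA b : 0 <= b < 1 -> {within `[0, b], continuous A}.
Proof. by move=> /andP[b0 b1]; apply: within_continuous_Rintegral => //; exact: cwi. Qed.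

Let cB b : 0 <= b < 1 -> {within `[0, b], continuous B}.
Proof. by move=> /andP[b0 b1]; apply: within_continuous_Rintegral => //; exact: cwi. Qed.

Lemma within_continuous_bridge_of : {within `[0, 1[, continuous (bridge_of w)}.
Proof.
apply: within_continuous_halfopen => b /[dup] b01 /andP[b0 b1].
apply: (@within_continuous_ext _ _
    (fun s => w s + 2 * (1 - s) * A s - 6 * (1 - s) ^+ 2 * B s)).
  by move=> x /=; rewrite in_itv/= => /andP[x0 xb]; rewrite bridgeE// (le_lt_trans xb).
have co := @within_continuous_onem `[0, b].
apply: within_continuousB.
  apply: within_continuousD; first exact: cwb.
  apply: within_continuousM; last exact: cA.
  by apply: within_continuousM => //; exact: within_continuous_cst.
apply: within_continuousM; last exact: cB.
by apply: within_continuousM; [exact: within_continuous_cst|exact: within_continuousX].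
Qed.

Let cm b : b < 1 -> {within `[0, b], continuous (bridge_of w)}.
Proof. exact/halfopen_within_continuous/within_continuous_bridge_of. Qed.

(** The area of the solution in closed form. In its derivative the contributions of B' and A' add up
    to 2w - w = w, which leaves exactly [bridge_of w]. *)
Let J s := 2 * (1 - s) ^+ 3 * B s - (1 - s) ^+ 2 * A s.

Let area_bridge_of s : 0 <= s < 1 -> \int[mu]_(u in `[0, s]) bridge_of w u = J s.
Proof.
move=> /[dup] s01 /andP[s0 s1].
have E0 : \int[mu]_(u in `[0, s]) bridge_of w u = J s - J 0.
  refine (@Rintegral_FTC2 R _ J 0 s s0 _ _ _).
  - exact: cm.
  - have co := @within_continuous_onem `[0, s].
    apply: within_continuousB; apply: within_continuousM; try exact: cA; try exact: cB.
      by apply: within_continuousM; [exact: within_continuous_cst|exact: within_continuousX].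
    exact: within_continuousX.
  - move=> x /andP[x0 xs]; have x1 := lt_trans xs s1.
    have xb : 0 < x < s by rewrite x0.
    have hA := is_derive_Rintegral (@cwi s 2 s1) xb.
    have hB := is_derive_Rintegral (@cwi s 3 s1) xb.
    have q0 : 1 - x != 0 by rewrite subr_eq0 gt_eqF.
    rewrite /J; apply: is_derive_eq; rewrite bridgeE// /GRing.scale/=.
    by rewrite -/(A x) -/(B x); field.
rewrite E0.
by rewrite /J /A /B !Rintegral_itv00 !mulr0 !subr0.
Qed.

Lemma bridge_of_solves s : 0 <= s < 1 ->
  bridge_of w s = w s - \int[mu]_(u in `[0, s]) (4 * bridge_of w u / (1 - u))
    - \int[mu]_(u in `[0, s])
        (6 * (\int[mu]_(x in `[0, u]) bridge_of w x) / (1 - u) ^+ 2).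
Proof.
move=> /[dup] s01 /andP[s0 s1].
have ci := within_continuous_inv1 s1.
have co := @within_continuous_onem `[0, s].
have cJ : {within `[0, s], continuous J}.
  apply: within_continuousB; apply: within_continuousM; try exact: cA; try exact: cB.
    by apply: within_continuousM; [exact: within_continuous_cst|exact: within_continuousX].
  exact: within_continuousX.
pose f1 u := 4 * bridge_of w u / (1 - u).
pose f2 u := 6 * J u * (1 - u)^-1 ^+ 2.
have c1 : {within `[0, s], continuous f1}.
  apply: within_continuousM => //; apply: within_continuousM; last exact: cm.
  exact: within_continuous_cst.
have c2 : {within `[0, s], continuous f2}.
  apply: within_continuousM; last exact: within_continuousX.
  by apply: within_continuousM => //; exact: within_continuous_cst.
have -> : \int[mu]_(u in `[0, s])
    (6 * (\int[mu]_(x in `[0, u]) bridge_of w x) / (1 - u) ^+ 2) =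
    \int[mu]_(u in `[0, s]) f2 u.
  apply: eq_Rintegral_itv => u /andP[u0 us].
  by rewrite area_bridge_of ?u0 ?(le_lt_trans us)// /f2 exprVn.
rewrite -/(f1 _) -addrA -opprD -RintegralD//; try exact: within_continuous_integrable.
(* This is w minus the solution, hence the expected value of the integrated drift; unlike w itself
   it can be differentiated. *)
pose E t := 6 * (1 - t) ^+ 2 * B t - 2 * (1 - t) * A t.
have E0 : \int[mu]_(u in `[0, s]) (f1 u + f2 u) = E s - E 0.
  refine (@Rintegral_FTC2 R _ E 0 s s0 _ _ _).
  - exact: within_continuousD.
  - apply: within_continuousB; apply: within_continuousM; try exact: cA; try exact: cB.
      by apply: within_continuousM; [exact: within_continuous_cst|exact: within_continuousX].
    by apply: within_continuousM => //; exact: within_continuous_cst.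
  - move=> x /andP[x0 xs]; have x1 := lt_trans xs s1.
    have xb : 0 < x < s by rewrite x0.
    have hA := is_derive_Rintegral (@cwi s 2 s1) xb.
    have hB := is_derive_Rintegral (@cwi s 3 s1) xb.
    have q0 : 1 - x != 0 by rewrite subr_eq0 gt_eqF.
    rewrite /E; apply: is_derive_eq; rewrite /f1 /f2 /J bridgeE// /GRing.scale/=.
    by rewrite -/(A x) -/(B x); field.
rewrite E0.
rewrite /E /A /B !Rintegral_itv00 !mulr0 !subr0 -/(A s) -/(B s) bridgeE//.
ring.
Qed.

End existence.

Section noise.
Variable m : R -> R.
Hypothesis cm : {within `[0, 1[, continuous m}.

Let cmb b : b < 1 -> {within `[0, b], continuous m}.
Proof. exact: halfopen_within_continuous. Qed.

Let cJ b : 0 <= b < 1 -> {within `[0, b], continuous (Int m)}.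
Proof. by move=> /andP[b0 b1]; apply: within_continuous_Rintegral => //; exact: cmb. Qed.

Let cmi b : b < 1 -> {within `[0, b], continuous (fun u => m u * (1 - u)^-1)}.
Proof.
by move=> b1; apply: within_continuousM; [exact: cmb|exact: within_continuous_inv1].
Qed.

Lemma noise_ofE s : 0 <= s < 1 ->
  noise_of m s = m s + \int[mu]_(u in `[0, s]) (4 * m u / (1 - u))
    + \int[mu]_(u in `[0, s]) (6 * (\int[mu]_(x in `[0, u]) m x) / (1 - u) ^+ 2).
Proof.
move=> /[dup] s01 /andP[s0 s1].
have ci := within_continuous_inv1 s1.
have c0 := cmb s1.
pose f1 u := 4 * m u / (1 - u).
pose f2 u := 6 * Int m u / (1 - u) ^+ 2.
have c1 : {within `[0, s], continuous f1}.
  apply: within_continuousM => //; apply: within_continuousM => //.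
  exact: within_continuous_cst.
have c2 : {within `[0, s], continuous f2}.
  apply: within_continuousM.
    by apply: within_continuousM; [exact: within_continuous_cst|exact: cJ].
  exact: within_continuous_inv2.
rewrite /noise_of /path_functional lin_seq1/= mul1r -addrA; congr (_ + _).
rewrite -[X in _ = X + _]/(\int[mu]_(u in `[0, s]) f1 u).
rewrite -[X in _ = _ + X]/(\int[mu]_(u in `[0, s]) f2 u).
rewrite -RintegralD//; try exact: within_continuous_integrable.
(* A primitive of both drift terms together: the product rule on 6 J / (1-t) gives the area term
   plus 6 m / (1-t), of which 2 m / (1-t) is removed. *)
pose E t := 6 * Int m t * (1 - t)^-1 - 2 * \int[mu]_(u in `[0, t]) (m u * (1 - u)^-1).
have E0 : \int[mu]_(u in `[0, s]) (f1 u + f2 u) = E s - E 0.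
  refine (@Rintegral_FTC2 R _ E 0 s s0 _ _ _).
  - exact: within_continuousD.
  - apply: within_continuousB.
      by apply: within_continuousM => //; apply: within_continuousM;
        [exact: within_continuous_cst|exact: cJ].
    apply: within_continuousM; first exact: within_continuous_cst.
    by apply: within_continuous_Rintegral => //; exact: cmi.
  - move=> x /andP[x0 xs]; have x1 := lt_trans xs s1.
    have xb : 0 < x < s by rewrite x0.
    have h1 := is_derive_Rintegral c0 xb.
    have h2 := is_derive_Rintegral (cmi s1) xb.
    have h3 := is_derive_inv1 x1.
    have q0 : 1 - x != 0 by rewrite subr_eq0 gt_eqF.
    rewrite /E; apply: is_derive_eq; rewrite /f1 /f2 /GRing.scale/=.
    by field.
rewrite E0.
rewrite /E !Rintegral_itv00 !mulr0 !mul0r !subr0.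
rewrite (_ : 6 * Int m s * (1 - s)^-1 = (6 * (1 - s)^-1) * Int m s); last by ring.
have imm : mu.-integrable `[0, s] (EFin \o m) by exact: within_continuous_integrable.
have immi : mu.-integrable `[0, s] (EFin \o (fun u => m u * (1 - u)^-1)).
  exact/within_continuous_integrable/cmi.
rewrite -!RintegralZl// -RintegralB//; [|exact: integrable_EFinZ..].
by apply: eq_Rintegral => u _; rewrite /noise_kernel; ring.
Qed.

Lemma within_continuous_noise_of : {within `[0, 1[, continuous (noise_of m)}.
Proof.
apply: within_continuous_halfopen => b /[dup] b01 /andP[b0 b1].
have ci := within_continuous_inv1 b1.
apply: (@within_continuous_ext _ _ (fun s => m s + (6 * (1 - s)^-1 * Int m s -
    2 * \int[mu]_(u in `[0, s]) (m u * (1 - u)^-1)))).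
  move=> x /=; rewrite in_itv/= => /andP[x0 xb].
  have x1 : x < 1 by exact: le_lt_trans xb b1.
  rewrite /noise_of /path_functional lin_seq1/= mul1r; congr (_ + _).
  have imm : mu.-integrable `[0, x] (EFin \o m) by exact/within_continuous_integrable/cmb.
  have immi : mu.-integrable `[0, x] (EFin \o (fun u => m u * (1 - u)^-1)).
    exact/within_continuous_integrable/cmi.
  rewrite -!RintegralZl// -RintegralB//; [|exact: integrable_EFinZ..].
  by apply: eq_Rintegral => u _; rewrite /noise_kernel; ring.
apply: within_continuousD; first exact: cmb.
apply: within_continuousB; apply: within_continuousM; try exact: cJ.
- by apply: within_continuousM => //; exact: within_continuous_cst.
- exact: within_continuous_cst.
- by apply: within_continuous_Rintegral => //; exact: cmi.
Qed.

End noise.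

Lemma constant_within (f : R -> R) s : 0 <= s -> {within `[0, s], continuous f} ->
  (forall x, 0 < x < s -> is_derive x 1 f 0) -> f s = f 0.
Proof.
move=> s0 cf df; have df' x : x \in `]0, s[ -> is_derive x 1 f 0.
  by rewrite in_itv/=; exact: df.
have [c _] := @MVT_segment R f (fun=> 0) 0 s s0 df' cf.
by rewrite mul0r => /eqP; rewrite subr_eq0 => /eqP.
Qed.

(** Variation of constants replaces a Gronwall estimate: the coordinates of (J, J') in the
    fundamental system have derivative 0 and start at 0. *)
Lemma bridge_ode_zero (D : R -> R) : {within `[0, 1[, continuous D} ->
  (forall s, 0 <= s < 1 ->
     D s = - (\int[mu]_(u in `[0, s]) (4 * D u / (1 - u)))
           - \int[mu]_(u in `[0, s]) (6 * Int D u / (1 - u) ^+ 2)) ->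
  forall s, 0 <= s < 1 -> D s = 0.
Proof.
move=> cD DE s /[dup] s01 /andP[s0 s1].
have ci := within_continuous_inv1 s1.
have c0 := halfopen_within_continuous cD s1.
have cJ : {within `[0, s], continuous (Int D)} by exact: within_continuous_Rintegral.
pose f1 u := 4 * D u / (1 - u).
pose f2 u := 6 * Int D u / (1 - u) ^+ 2.
have c1 : {within `[0, s], continuous f1}.
  apply: within_continuousM => //; apply: within_continuousM => //.
  exact: within_continuous_cst.
have c2 : {within `[0, s], continuous f2}.
  apply: within_continuousM.
    by apply: within_continuousM => //; exact: within_continuous_cst.
  exact: within_continuous_inv2.
pose E1 := Int f1; pose E2 := Int f2.
have cE1 : {within `[0, s], continuous E1} by exact: within_continuous_Rintegral.
have cE2 : {within `[0, s], continuous E2} by exact: within_continuous_Rintegral.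
have DE' x : 0 <= x < 1 -> D x = - (E1 x + E2 x).
  by move=> x01; rewrite (DE _ x01) opprD.
(* If J = a (1-t)^2 + b (1-t)^3, then [al] recovers a and [be] recovers b, with - J' written as E1 +
   E2. The latter form is used because D is differentiable only through the integral equation. *)
pose al t := 3 * Int D t * (1 - t)^-1 ^+ 2 - (E1 t + E2 t) * (1 - t)^-1.
pose be t := (E1 t + E2 t) * (1 - t)^-1 ^+ 2 - 2 * Int D t * (1 - t)^-1 ^+ 3.
have cE : {within `[0, s], continuous (fun t => E1 t + E2 t)}.
  exact: within_continuousD.
have cal : {within `[0, s], continuous al}.
  apply: within_continuousB; apply: within_continuousM => //.
    by apply: within_continuousM => //; exact: within_continuous_cst.
  exact: within_continuousX.
have cbe : {within `[0, s], continuous be}.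
  apply: within_continuousB; apply: within_continuousM => //; try exact: within_continuousX.
  by apply: within_continuousM => //; exact: within_continuous_cst.
have al0 : al s = 0.
  transitivity (al 0); last by rewrite /al /E1 /E2 !Rintegral_itv00; ring.
  refine (constant_within s0 cal _).
  move=> x xb; have /andP[x0 xs] := xb; have x1 := lt_trans xs s1.
  have h1 := is_derive_Rintegral c0 xb.
  have h2 := is_derive_Rintegral c1 xb.
  have h3 := is_derive_Rintegral c2 xb.
  have h4 := is_derive_inv1 x1.
  have q0 : 1 - x != 0 by rewrite subr_eq0 gt_eqF.
  have x01 : 0 <= x < 1 by rewrite ltW.
  have := DE' _ x01; move=> e; have {}e : E1 x + E2 x = - D x by rewrite e opprK.
  rewrite /al /E1 /E2; apply: is_derive_eq; rewrite /GRing.scale/=.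
  rewrite -/(E1 x) -/(E2 x) e /f1 /f2.
  by field.
have be0 : be s = 0.
  transitivity (be 0); last by rewrite /be /E1 /E2 !Rintegral_itv00; ring.
  refine (constant_within s0 cbe _).
  move=> x xb; have /andP[x0 xs] := xb; have x1 := lt_trans xs s1.
  have h1 := is_derive_Rintegral c0 xb.
  have h2 := is_derive_Rintegral c1 xb.
  have h3 := is_derive_Rintegral c2 xb.
  have h4 := is_derive_inv1 x1.
  have q0 : 1 - x != 0 by rewrite subr_eq0 gt_eqF.
  have x01 : 0 <= x < 1 by rewrite ltW.
  have := DE' _ x01; move=> e; have {}e : E1 x + E2 x = - D x by rewrite e opprK.
  rewrite /be /E1 /E2; apply: is_derive_eq; rewrite /GRing.scale/=.
  rewrite -/(E1 x) -/(E2 x) e /f1 /f2.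
  by field.
have q0 : 1 - s != 0 by rewrite subr_eq0 gt_eqF.
rewrite (DE' _ s01).
have -> : - (E1 s + E2 s) = - (2 * (1 - s) * al s + 3 * (1 - s) ^+ 2 * be s).
  by rewrite /al /be; field.
by rewrite al0 be0 !mulr0 addr0 oppr0.
Qed.

Lemma bridge_of_unique m w : {within `[0, 1[, continuous m} ->
  {within `[0, 1[, continuous w} ->
  (forall s, 0 <= s < 1 ->
     m s = w s - \int[mu]_(u in `[0, s]) (4 * m u / (1 - u))
           - \int[mu]_(u in `[0, s]) (6 * Int m u / (1 - u) ^+ 2)) ->
  forall s, 0 <= s < 1 -> m s = bridge_of w s.
Proof.
move=> cm cw mE s s01; have cb := within_continuous_bridge_of cw.
apply/eqP; rewrite -subr_eq0; apply/eqP.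
apply: (@bridge_ode_zero (fun s => m s - bridge_of w s)) s01.
  exact: within_continuousB.
move=> {}s /[dup] s01 /andP[s0 s1].
have ci := within_continuous_inv1 s1.
have cmb b : b < 1 -> {within `[0, b], continuous m} by exact: halfopen_within_continuous.
have cbb b : b < 1 -> {within `[0, b], continuous (bridge_of w)}.
  by exact: halfopen_within_continuous.
rewrite [in LHS]mE// [in LHS]bridge_of_solves//.
have c4 f : {within `[0, s], continuous f} ->
    mu.-integrable `[0, s] (EFin \o (fun u => 4 * f u / (1 - u))).
  move=> cf; apply: within_continuous_integrable.
  apply: within_continuousM => //; apply: within_continuousM => //.
  exact: within_continuous_cst.
have c6 f : {within `[0, s], continuous f} ->
    mu.-integrable `[0, s] (EFin \o (fun u => 6 * Int f u / (1 - u) ^+ 2)).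
  move=> cf; apply: within_continuous_integrable; apply: within_continuousM.
    apply: within_continuousM; first exact: within_continuous_cst.
    exact: within_continuous_Rintegral.
  exact: within_continuous_inv2.
have e4 : \int[mu]_(u in `[0, s]) (4 * (m u - bridge_of w u) / (1 - u)) =
    \int[mu]_(u in `[0, s]) (4 * m u / (1 - u)) -
    \int[mu]_(u in `[0, s]) (4 * bridge_of w u / (1 - u)).
  rewrite -RintegralB//; [|exact/c4/cmb|exact/c4/cbb].
  by apply: eq_Rintegral => u _; ring.
have e6 : \int[mu]_(u in `[0, s]) (6 * Int (fun x => m x - bridge_of w x) u / (1 - u) ^+ 2) =
    \int[mu]_(u in `[0, s]) (6 * Int m u / (1 - u) ^+ 2) -
    \int[mu]_(u in `[0, s]) (6 * Int (bridge_of w) u / (1 - u) ^+ 2).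
  rewrite -RintegralB//; [|exact/c6/cmb|exact/c6/cbb].
  apply: eq_Rintegral_itv => u /andP[u0 us]; have u1 := le_lt_trans us s1.
  by rewrite RintegralB; [ring| |exact/within_continuous_integrable/cmb|
    exact/within_continuous_integrable/cbb].
rewrite e4 e6; ring.
Qed.

End bridge_ode.

(** * Covariances of the bridge and of its area *)

(** The covariance of the ordinary Brownian bridge minus the part explained by its area: the area
    has variance 1/12 and covariance s (1-s) / 2 with the bridge at s, and 12 times the product of
    two such terms is the cubic correction. *)
Definition bridge_cov (R : realType) (s t : R) : R :=
  Num.min s t - s * t - 3 * s * t * (1 - s) * (1 - t).

(** The pair (M, J) as one real family: index (true, s) is the value at s, index (false, s) the area
    up to s. Joint Gaussianity of the pair is then an instance of [gaussian_family]. *)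
Definition with_area (R : realType) (Omega : Type) (X : R -> Omega -> R)
    (j : bool * R) (w : Omega) : R :=
  if j.1 then X j.2 w else \int[lebesgue_measure]_(u in `[0, j.2]) X u w.

(** Ito's isometry for W_s, the Wiener integral of 1 over [0, s], and for the area up to s, that of
    s - u. *)
Definition brownian_area_cov (R : realType) (i j : bool * R) : R :=
  let m := Num.min i.2 j.2 in
  match i.1, j.1 with
  | true, true => m
  | true, false => j.2 * m - m ^+ 2 / 2
  | false, true => i.2 * m - m ^+ 2 / 2
  | false, false => i.2 * j.2 * m - (i.2 + j.2) * m ^+ 2 / 2 + m ^+ 3 / 3
  end.

(** In the area case the coefficients are the primitives s^3 - s^2 and 3 s^2 - 2 s^3 of those in the
    value case. *)
Definition bridge_comb (R : realType) (j : bool * R) : seq (R * (bool * R)) :=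
  if j.1 then
    [:: (1, j); (- (j.2 * (3 * j.2 - 2)), (true, 1)); (- (6 * j.2 * (1 - j.2)), (false, 1))]
  else
    [:: (1, j); (- (j.2 ^+ 3 - j.2 ^+ 2), (true, 1));
        (- (3 * j.2 ^+ 2 - 2 * j.2 ^+ 3), (false, 1))].

Definition bridge_area_cov (R : realType) (i j : bool * R) : R :=
  cov_lin (@brownian_area_cov R) (bridge_comb i) (bridge_comb j).

Definition anticipative_bridge (R : realType) (Omega : Type) (W : R -> Omega -> R)
    (s : R) (w : Omega) : R :=
  W s w - s * (3 * s - 2) * W 1 w -
    6 * s * (1 - s) * \int[lebesgue_measure]_(u in `[0, 1]) W u w.

Lemma brownian_area_covC (R : realType) (i j : bool * R) :
  brownian_area_cov i j = brownian_area_cov j i.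
Proof.
by case: i => [] [] s; case: j => [] [] t; rewrite /brownian_area_cov/= minC//; ring.
Qed.

Section covariances.
Context {R : realType}.
Implicit Types (s t u m : R) (i j : bool * R).
Local Notation mu := (@lebesgue_measure R).
Local Notation S01 := [set j : bool * R | 0 <= j.2 <= 1].

Lemma Rintegral_poly (f F : R -> R) m : 0 <= m -> continuous f ->
  (forall x : R, is_derive x 1 F (f x)) ->
  \int[mu]_(u in `[0, m]) f u = F m - F 0.
Proof.
move=> m0 cf dF; apply: Rintegral_FTC2 => //.
- exact: continuous_within.
- apply: continuous_within => x.
  by apply/differentiable_continuous/derivable1_diffP; case: (dF x).
Qed.

Let phi j u : R := if j.1 then 1 else j.2 - u.
Let dphi j (u : R) : R := if j.1 then 0 else -1.

Lemma brownian_area_covE i j : 0 <= i.2 -> 0 <= j.2 ->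
  \int[mu]_(u in `[0, Num.min i.2 j.2]) (phi i u * phi j u) = brownian_area_cov i j.
Proof.
case: i => [] bi s; case: j => [] bj t /= s0 t0.
set m := Num.min s t; have m0 : 0 <= m by rewrite le_min s0.
(* Each integrand is affine, c0 - c1 u, so a single primitive settles the four cases. *)
pose c0 (b : bool) (x : R) := if b then 1 else x.
pose c1 (b : bool) := if b then 0 else 1 : R.
have -> : \int[mu]_(u in `[0, m]) (phi (bi, s) u * phi (bj, t) u) =
    \int[mu]_(u in `[0, m]) (c0 bi s * c0 bj t - (c1 bi * c0 bj t + c0 bi s * c1 bj) * u + c1 bi * c1 bj * u ^+ 2).
  apply: eq_Rintegral => u _; rewrite /phi /c0 /c1.
  by case: bi; case: bj => /=; ring.
have ci : continuous (idfun : R -> R) by move=> u; exact: cvg_id.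
have cX2 : continuous (fun x : R => x ^+ 2) by exact: exprn_continuous.
pose F u := c0 bi s * c0 bj t * u -
  (c1 bi * c0 bj t + c0 bi s * c1 bj) * u ^+ 2 / 2 + c1 bi * c1 bj * u ^+ 3 / 3.
transitivity (F m - F 0).
  refine (@Rintegral_poly _ F m m0 _ _) => u.
    apply: cvgD; last by apply: cvgMr; exact: cX2.
    by apply: cvgB; [exact: cvg_cst|apply: cvgMr; exact: ci].
  by rewrite /F; apply: is_derive_eq; rewrite /GRing.scale/=; field.
rewrite /F /brownian_area_cov/= /c0 /c1 -/m => {F}.
by case: bi; case: bj => /=; field.
Qed.

Context {T : set R} {d} {Omega : measurableType d} {P : probability Omega R}
  {W : R -> Omega -> R}.
Hypothesis T01 : forall t, T t <-> 0 <= t <= 1.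

(** For the integrand s - u the boundary term at u = s vanishes and minus the derivative is 1, so
    the functional of [wiener_gaussian] is the area itself. *)
Lemma brownian_area_gaussian : (forall w, {within `[0, 1], continuous (W^~ w)}) ->
  {ae P, forall w, W 0 w = 0} ->
  gaussian_family T P W (fun s t => Num.min s t) ->
  gaussian_family S01 P (with_area W) (@brownian_area_cov R).
Proof.
move=> cW W0 gW.
have := @wiener_gaussian R T _ _ P W _ S01 (fun j => j.2) phi dphi.
have e : (fun j w => path_functional [:: (phi j j.2, j.2)] j.2 (fun u => - dphi j u) (W^~ w))
    = with_area W.
  apply/funext => -[[] s]; apply/funext => w; rewrite /path_functional lin_seq1/= /with_area/phi/dphi/=.
    rewrite mul1r (_ : \int[mu]_(u in _) _ = 0) ?addr0//.
    by under eq_Rintegral do rewrite oppr0 mulr0; rewrite Rintegral_cst ?mul0r.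
  rewrite subrr mul0r add0r.
  by apply: eq_Rintegral => u _; rewrite opprK mulr1.
rewrite e => H; apply: gaussian_family_cov (H _ _ _ _ _ _ W0 gW).
- by move=> i j /andP[i0 _] /andP[j0 _]; exact: brownian_area_covE.
- by [].
- move=> j u /andP[j0 j1] /andP[u0 uj]; apply/T01; rewrite u0/=.
  exact: le_trans uj j1.
- move=> j w /andP[j0 j1]; apply: within_continuous_sub (cW w).
  by apply: subset_itvl; rewrite bnd_simp.
- move=> j _; rewrite /phi; case: j.1; first exact: within_continuous_cst.
  apply: (@within_continuous_ext _ _ (fun u => j.2 + -1 * u)).
    by move=> u _; rewrite mulN1r.
  by apply: continuous_within; exact: continuous_affine.
- move=> j _; rewrite /dphi; case: j.1; exact: within_continuous_cst.
- move=> j _ u _; rewrite /phi /dphi; case: j.1; first exact: is_derive_cst.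
  by apply: is_derive_eq; rewrite /GRing.scale/=; ring.
Qed.

End covariances.

Section bridge_covariance.
Context {R : realType}.
Implicit Types (s t u m : R) (i j : bool * R) (b : bool).
Local Notation mu := (@lebesgue_measure R).
Local Notation S01 := [set j : bool * R | 0 <= j.2 <= 1].

(* For [u <= t] the covariance of [M_u] (or of [J_u], if [b] is [false]) with
   [J_t] is [cov_al b u * (1 - t)^2 + cov_be b u * (1 - t)^3], and the one with
   [M_t] is its derivative in [t]. *)
Definition cov_al b u : R := if b then - (u * (3 * u - 2)) / 2 else - (u ^+ 3 - u ^+ 2) / 2.
Definition cov_be b u : R := if b then - (u * (1 - u)) else - (u ^+ 2 / 2 - u ^+ 3 / 3).

Lemma bridge_area_covE b b' u t : 0 <= u -> u <= t -> t <= 1 ->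
  bridge_area_cov (b, u) (b', t) =
  if b' then - 2 * cov_al b u * (1 - t) - 3 * cov_be b u * (1 - t) ^+ 2
  else cov_al b u * (1 - t) ^+ 2 + cov_be b u * (1 - t) ^+ 3.
Proof.
move=> u0 ut t1; have u1 := le_trans ut t1.
rewrite /bridge_area_cov /cov_lin /bridge_comb /cov_al /cov_be.
case: b; case: b'; rewrite !lin_cons !lin_nil/= /brownian_area_cov/=;
  rewrite (min_l ut) (min_l u1) (min_r t1) minxx; by field.
Qed.

Lemma bridge_area_covC i j : bridge_area_cov i j = bridge_area_cov j i.
Proof.
rewrite /bridge_area_cov /cov_lin lin_exchange.
by congr lin; apply/funext => k; congr lin; apply/funext => l; exact: brownian_area_covC.
Qed.

Lemma bridge_area_cov_value s t : 0 <= s <= 1 -> 0 <= t <= 1 ->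
  bridge_area_cov (true, s) (true, t) = bridge_cov s t.
Proof.
wlog st : s t / s <= t.
  move=> H s01 t01; have [st|/ltW ts] := leP s t; first exact: H.
  by rewrite bridge_area_covC H// /bridge_cov minC; ring.
move=> /andP[s0 s1] /andP[t0 t1]; rewrite bridge_area_covE// /bridge_cov min_l//.
by rewrite /cov_al /cov_be; field.
Qed.

(** These are the normal equations of the regression of W_s on (W_1, I_1), whose covariance matrix
    has entries 1, 1/2, 1/3; they are where the coefficients of the anticipative formula come
    from. *)
Lemma bridge_comb_orth s b : 0 <= s <= 1 ->
  cov_lin (@brownian_area_cov R) (bridge_comb (true, s)) [:: (1, (b, 1))] = 0.
Proof.
move=> /andP[s0 s1]; rewrite /cov_lin /bridge_comb.
case: b; rewrite !lin_cons !lin_nil/= /brownian_area_cov/=;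
  by rewrite (min_l s1) minxx; field.
Qed.

Lemma supported_bridge_comb j : S01 j -> supported S01 (bridge_comb j).
Proof.
move=> Sj; have S1 b : S01 (b, 1) by rewrite /= ler01 lexx.
by rewrite /bridge_comb; case: ifP => _; rewrite /supported/= !mem_set.
Qed.

Lemma lin_bridge_comb (Omega : Type) (W : R -> Omega -> R) j w : S01 j ->
  {within `[0, 1], continuous (W^~ w)} ->
  lin (bridge_comb j) (with_area W ^~ w) = with_area (anticipative_bridge W) j w.
Proof.
case: j => [] [] s /= /andP[s0 s1] cW; rewrite /bridge_comb !lin_cons lin_nil /with_area/=.
  by rewrite /anticipative_bridge; ring.
set I1 := \int[mu]_(u in `[0, 1]) W u w.
have cWs : {within `[0, s], continuous (W^~ w)}.
  by apply: within_continuous_sub cW; apply: subset_itvl; rewrite bnd_simp.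
pose f u := - ((3 * u ^+ 2 - 2 * u) * W 1 w + (6 * u - 6 * u ^+ 2) * I1).
have cX2 : continuous (fun x : R => x ^+ 2) by exact: exprn_continuous.
have ci : continuous (idfun : R -> R) by move=> u; exact: cvg_id.
have cf : continuous f.
  move=> u; apply: cvgN; apply: cvgD; apply: cvgMl.
    by apply: cvgB; apply: cvgMr; [exact: cX2|exact: ci].
  by apply: cvgB; apply: cvgMr; [exact: ci|exact: cX2].
rewrite [RHS](_ : _ = \int[mu]_(u in `[0, s]) (W u w + f u)); last first.
  by apply: eq_Rintegral => u _; rewrite /anticipative_bridge /f -/I1; ring.
rewrite RintegralD//; last 2 first.
- exact: within_continuous_integrable.
- by apply: within_continuous_integrable; exact: continuous_within.
pose F u := - ((u ^+ 3 - u ^+ 2) * W 1 w + (3 * u ^+ 2 - 2 * u ^+ 3) * I1).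
have -> : \int[mu]_(u in `[0, s]) f u = F s - F 0.
  refine (@Rintegral_poly _ f F s s0 cf _) => u.
  by rewrite /F /f; apply: is_derive_eq; rewrite /GRing.scale/=; ring.
by rewrite /F; ring.
Qed.

Lemma bridge_area_gaussian d (Omega : measurableType d) (P : probability Omega R)
    (W : R -> Omega -> R) :
  (forall w, {within `[0, 1], continuous (W^~ w)}) ->
  gaussian_family S01 P (with_area W) (@brownian_area_cov R) ->
  gaussian_family S01 P (with_area (anticipative_bridge W)) (@bridge_area_cov R).
Proof.
move=> cW gW; have gl := gaussian_family_lin gW supported_bridge_comb.
have E j w : S01 j -> with_area (anticipative_bridge W) j w =
    lin (bridge_comb j) (with_area W ^~ w).
  by move=> Sj; rewrite lin_bridge_comb.
apply: (gaussian_family_ae gl) => [j Sj|j Sj]; last first.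
  by apply: aeW => w; rewrite E.
rewrite (_ : with_area _ j = fun w => lin (bridge_comb j) (with_area W ^~ w)).
  by have [ml _] := gl; exact: ml.
by apply/funext => w; rewrite E.
Qed.

(** With x = (1-u)^-1 the product is a polynomial in x without terms of degree below 2, and k
    x^(k+1) is the derivative of x^k in u. *)
Lemma bridge_integrand_isometry s t : 0 <= s < 1 -> 0 <= t < 1 ->
  \int[mu]_(u in `[0, Num.min s t]) (bridge_integrand s u * bridge_integrand t u) =
  bridge_cov s t.
Proof.
move=> /andP[s0 s1] /andP[t0 t1]; rewrite /bridge_cov.
set m := Num.min s t; have m0 : 0 <= m by rewrite le_min s0.
have m1 : m < 1 by rewrite gt_min s1.
pose f u := bridge_integrand s u * bridge_integrand t u.
pose r := 1 - s; pose rho := 1 - t.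
pose F u := 4 * r * rho * (1 - u)^-1 -
  3 * (r * rho ^+ 2 + r ^+ 2 * rho) * (1 - u)^-1 ^+ 2 +
  3 * r ^+ 2 * rho ^+ 2 * (1 - u)^-1 ^+ 3.
have ci := within_continuous_inv1 m1.
have -> : \int[mu]_(u in `[0, m]) f u = F m - F 0.
  refine (@Rintegral_FTC2 R f F 0 m m0 _ _ _).
  - by apply: within_continuousM; exact: within_continuous_bridge_integrand.
  - apply: within_continuousD; first apply: within_continuousB;
      apply: within_continuousM => //; try exact: within_continuousX;
      exact: within_continuous_cst.
  - move=> x /andP[x0 xm]; have x1 := lt_trans xm m1.
    have h := is_derive_inv1 x1.
    have q0 : 1 - x != 0 by rewrite subr_eq0 gt_eqF.
    rewrite /F /f /bridge_integrand; apply: is_derive_eq; rewrite /GRing.scale/=.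
    by rewrite -/r -/rho; field.
have r0 : 1 - s != 0 by rewrite subr_eq0 gt_eqF.
have rho0 : 1 - t != 0 by rewrite subr_eq0 gt_eqF.
rewrite /F subr0 invr1 /r /rho /m; case: leP => _; by field.
Qed.

(* The propagator from [s] to [t] of the noiseless equation for [(M, J)]. *)
Definition transition_coef (b b' : bool) s t : R :=
  let r := (1 - s)^-1 in let q := 1 - t in
  match b, b' with
  | true, true => - 2 * q * r + 3 * q ^+ 2 * r ^+ 2
  | true, false => - 6 * q * r ^+ 2 + 6 * q ^+ 2 * r ^+ 3
  | false, true => q ^+ 2 * r - q ^+ 3 * r ^+ 2
  | false, false => 3 * q ^+ 2 * r ^+ 2 - 2 * q ^+ 3 * r ^+ 3
  end.

Definition innovation_comb s t b : seq (R * (bool * R)) :=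
  [:: (1, (b, t)); (- transition_coef b true s t, (true, s));
      (- transition_coef b false s t, (false, s))].

(** For u <= s, the covariances of the past with (M, J) evolve after s by the noiseless equation, so
    the propagator carries them exactly from s to t. *)
Lemma innovation_orth s t u b b' : 0 <= u -> u <= s -> s <= t -> t <= 1 ->
  cov_lin (@bridge_area_cov R) [:: (1, (b', u))] (innovation_comb s t b) = 0.
Proof.
move=> u0 us st t1; have s1 := le_trans st t1; have ut := le_trans us st.
rewrite /cov_lin lin_seq1 mul1r/= !lin_cons lin_nil/= !bridge_area_covE//=.
move: (cov_al b' u) (cov_be b' u) => al be.
(* At s = 1 the inverse in the propagator is 0 by convention and all coefficients vanish; the claim
   survives because t = 1 and the covariances with M_1 and J_1 are 0. *)
have [sE|sne] := eqVneq s 1.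
  have tE : t = 1 by apply/eqP; rewrite eq_le t1 -sE.
  by rewrite sE tE /transition_coef subrr; case: b; ring.
have s0 : 1 - s != 0 by rewrite subr_eq0 eq_sym.
by rewrite /transition_coef; case: b => /=; field.
Qed.

(** J_s minus its regression on M_s. It makes (M_s, J_s) a triangular image of two independent
    Gaussians. *)
Definition area_residual s : seq (R * (bool * R)) :=
  [:: (1, (false, s));
      (- (bridge_area_cov (true, s) (false, s) / bridge_area_cov (true, s) (true, s)),
       (true, s))].

Lemma bridge_var_gt0 s : 0 < s < 1 -> 0 < bridge_area_cov (true, s) (true, s).
Proof.
move=> /andP[s0 s1]; rewrite (bridge_area_covE _ _ (ltW s0) (lexx s) (ltW s1)) /cov_al /cov_be.
rewrite (_ : _ - _ = s * (1 - s) * (1 - 3 * (s * (1 - s)))); last by field.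
have h : 0 < s * (1 - s) by rewrite mulr_gt0// subr_gt0.
(* The square yields s (1-s) <= 1/4, hence 1 - 3 s (1-s) >= 1/4. *)
by rewrite mulr_gt0//; have := sqr_ge0 (s - 1 / 2); nra.
Qed.

Lemma area_residual_orth s : 0 < s < 1 ->
  cov_lin (@bridge_area_cov R) [:: (1, (true, s))] (area_residual s) = 0.
Proof.
move=> s01; have v0 := bridge_var_gt0 s01.
rewrite /cov_lin lin_seq1 mul1r/= !lin_cons lin_nil/=.
by field; rewrite gt_eqF.
Qed.

Lemma area_residual_var_gt0 s : 0 < s < 1 ->
  0 < cov_lin (@bridge_area_cov R) (area_residual s) (area_residual s).
Proof.
move=> s01; have v0 := bridge_var_gt0 s01.
rewrite (_ : cov_lin _ _ _ = (bridge_area_cov (false, s) (false, s) *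
    bridge_area_cov (true, s) (true, s) - bridge_area_cov (true, s) (false, s) ^+ 2) /
    bridge_area_cov (true, s) (true, s)); last first.
  rewrite /cov_lin !lin_cons !lin_nil/= (bridge_area_covC (false, s) (true, s)).
  by field; rewrite gt_eqF.
rewrite divr_gt0//; move: s01 => /andP[s0 s1]; rewrite !(bridge_area_covE _ _ (ltW s0) (lexx s) (ltW s1)).
rewrite /cov_al /cov_be.
(* The determinant of the covariance matrix of (M_s, J_s), positive strictly inside the time
   interval. *)
rewrite (_ : _ - _ = s ^+ 4 * (1 - s) ^+ 4 / 12); last by field.
by rewrite divr_gt0// mulr_gt0// exprn_gt0// subr_gt0.
Qed.

End bridge_covariance.

(** * Integrability and centring of Gaussian variables *)

Section sin_bounds.
Context {R : realType}.
Implicit Types x y : R.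

Lemma sin_mean_value y : 0 <= y -> exists2 c, 0 <= c <= y & sin y = y * cos c.
Proof.
move=> y0; have [c] := @MVT_segment R sin cos 0 y y0
  (fun x _ => is_derive_sin x) (continuous_within (@continuous_sin R)).
rewrite in_itv/= => c0y; rewrite sin0 !subr0 mulrC => E.
by exists c.
Qed.

Lemma normr_sin_le y : `|sin y| <= `|y|.
Proof.
wlog y0 : y / 0 <= y => [H|].
  have [/H//|/ltW y0] := leP 0 y.
  by rewrite -[y]opprK sinN !normrN -[leRHS]normrN H ?oppr_ge0.
have [c _ ->] := sin_mean_value y0.
by rewrite normrM ler_piMr// ler_norml cos_geN1 cos_le1.
Qed.

Lemma onem_cos_le y : 0 <= 1 - cos y <= y ^+ 2 / 2.
Proof.
rewrite subr_ge0 cos_le1/=.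
have -> : 1 - cos y = 2 * sin (y / 2) ^+ 2.
  by have := cos2Dsin2 (y / 2); rewrite {3}[y]splitr cosD -!expr2; lra.
have : sin (y / 2) ^+ 2 <= (y / 2) ^+ 2.
  by rewrite -[leLHS]real_normK ?num_real// -[leRHS]real_normK ?num_real//
    lerXn2r ?nnegrE// normr_sin_le.
by rewrite expr_div_n; lra.
Qed.

Lemma sin_taylor y : `|sin y - y| <= `|y| ^+ 3 / 2.
Proof.
wlog y0 : y / 0 <= y => [H|].
  have [/H//|/ltW y0] := leP 0 y.
  rewrite -[y]opprK sinN -opprD normrN [`|- - y|]normrN.
  by rewrite H// oppr_ge0.
have [c /andP[c0 cy] ->] := sin_mean_value y0.
rewrite -[X in _ - X]mulr1 -mulrBr normrM exprS -mulrA ler_wpM2l// distrC.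
have /andP[h0 h] := onem_cos_le c; rewrite ger0_norm// (le_trans h)//.
by rewrite (ger0_norm y0) ler_wpM2r// lerXn2r.
Qed.

(** A bounded truncation of the identity whose expectations can be read off characteristic
    functions. *)
Lemma cvg_mul_sin_div x : n.+1%:R * sin (x / n.+1%:R) @[n --> \oo] --> x.
Proof.
apply/subr_cvg0/norm_cvg0P.
apply: (@squeeze_cvgr _ _ _ _ (cst 0) (fun n => `|x| ^+ 3 / 2 * n.+1%:R^-1)).
- near=> n; rewrite normr_ge0/=.
  have n1 : 1 <= n.+1%:R :> R by rewrite ler1n.
  move: (n.+1%:R : R) n1 => N N1; have N0 : 0 < N by exact: lt_le_trans N1.
  have -> : N * sin (x / N) - x = N * (sin (x / N) - x / N).
    by field; rewrite gt_eqF.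
  rewrite normrM (gtr0_norm N0).
  apply: (@le_trans _ _ (N * (`|x / N| ^+ 3 / 2))).
    by rewrite ler_pM2l// sin_taylor.
  rewrite normrM normfV (gtr0_norm N0).
  rewrite (_ : N * ((`|x| / N) ^+ 3 / 2) = `|x| ^+ 3 / 2 * N^-1 * N^-1); last first.
    by field; rewrite gt_eqF.
  apply: ler_piMr; last by rewrite invf_le1.
  by rewrite !mulr_ge0// ?invr_ge0// ltW.
- exact: cvg_cst.
- rewrite -[X in _ --> X](mulr0 (`|x| ^+ 3 / 2)); apply: cvgMr; exact: cvg_harmonic.
Unshelve. all: by end_near. Qed.

Lemma sin_cos_shift x : sin x = cos (x - pi / 2).
Proof. by rewrite cosB cos_pihalf sin_pihalf mulr0 add0r mulr1. Qed.

Lemma sqr_sin y : sin y ^+ 2 = (1 - cos (2 * y)) / 2.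
Proof.
have -> : 2 * y = y + y by ring.
by have := cos2Dsin2 y; rewrite cosD -!expr2; lra.
Qed.

End sin_bounds.

Section gaussian_integrable.
Context {R : realType} {d} {Omega : measurableType d} {P : probability Omega R}.
Variables (X : Omega -> R) (v : R).
Hypothesis mX : measurable_fun setT X.
Hypothesis v0 : 0 <= v.
Hypothesis cfX : forall a phi, Ex P (fun w => cos (a * X w + phi)) =
  cos phi * expR (- (a ^+ 2 * v / 2)).

Let mscale (c : R) : measurable_fun setT (fun w => c * X w).
Proof. exact: measurable_funM. Qed.

(** With N = n + 1, the square is N^2 / 2 times 1 - cos (2X / N), of expectation N^2 / 2 times 1 -
    exp (- 2v / N^2); then 1 - exp (- x) <= x gives a bound independent of n. *)
Let sqr_bound n : Ex P (fun w => (n.+1%:R * sin (n.+1%:R^-1 * X w)) ^+ 2) <= v.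
Proof.
have n0 : 0 < n.+1%:R :> R by rewrite ltr0n.
have -> : (fun w => (n.+1%:R * sin (n.+1%:R^-1 * X w)) ^+ 2) =
    (fun w => n.+1%:R ^+ 2 / 2 * (1 - cos (2 / n.+1%:R * X w + 0))).
  apply/funext => w; rewrite exprMn sqr_sin addr0 mulrA.
  by rewrite (_ : 2 * (_ * X w) = 2 / n.+1%:R * X w); ring.
have bc : bounded_mfun (fun w => cos (2 / n.+1%:R * X w + 0)).
  by apply: bounded_mfun_cos; apply: measurable_funD => //; exact: mscale.
rewrite ExZ; last first.
  rewrite (_ : (fun w => _) = fun w => 1 + -1 * cos (2 / n.+1%:R * X w + 0)).
    apply: bounded_mfunD; first exact: bounded_mfun_cst.
    by apply: bounded_mfunM => //; exact: bounded_mfun_cst.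
  by apply/funext => w; ring.
rewrite ExB//; last exact: bounded_mfun_cst.
rewrite Ex_cst cfX cos0 mul1r.
have he := expR_ge1Dx (- ((2 / n.+1%:R) ^+ 2 * v / 2)).
apply: (@le_trans _ _ (n.+1%:R ^+ 2 / 2 * ((2 / n.+1%:R) ^+ 2 * v / 2))).
  apply: ler_wpM2l; first by rewrite divr_ge0// sqr_ge0.
  by rewrite lerBlDr -lerBlDl.
by move: n.+1%:R n0 => N N0; rewrite (_ : _ * _ = v)//; field; rewrite gt_eqF.
Qed.

(* Fatou's lemma along [(n sin (X / n))^2 --> X^2]. *)
Lemma gaussian_integrable : P.-integrable setT (EFin \o X).
Proof.
pose h n w := (n.+1%:R * sin (n.+1%:R^-1 * X w)) ^+ 2.
have bh n : bounded_mfun (h n).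
  apply: bounded_mfunX; apply: bounded_mfunM; first exact: bounded_mfun_cst.
  by apply: bounded_mfun_sin; exact: mscale.
have ch w : h n w @[n --> \oo] --> X w ^+ 2.
  rewrite /h; apply: (@cvg_comp _ _ _ _ (fun x => x ^+ 2)); last exact: exprn_continuous.
  by under eq_fun do rewrite (mulrC _^-1); exact: cvg_mul_sin_div.
have F := @fatou _ _ _ P setT measurableT (fun n w => (h n w)%:E).
have {}F : (\int[P]_w (X w ^+ 2)%:E <= v%:E)%E.
  have mh n : measurable_fun setT (fun w => (h n w)%:E).
    by apply/measurable_EFinP; case: (bh n).
  have h0 n w : setT w -> (0 <= (h n w)%:E)%E by move=> _; rewrite lee_fin sqr_ge0.
  have := F mh h0.
  rewrite (eq_integral (fun w => (X w ^+ 2)%:E)); last first.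
    move=> w _; have ce : (h n w)%:E @[n --> \oo] --> (X w ^+ 2)%:E.
      by apply: cvg_EFin; [exact: nearW|exact: ch].
    by have [-> _] := cvg_limn_einf_sup ce.
  move=> /le_trans; apply.
  rewrite limn_einf_lim; apply: lime_le.
    exact: is_cvg_einfs.
  apply: nearW => n; apply: (@le_trans _ _ (\int[P]_w (h n w)%:E)%E).
    by apply: ereal_inf_lbound; exists n => /=.
  rewrite -[X in (X <= _)%E]fineK ?lee_fin; first exact: sqr_bound.
  by apply: integrable_fin_num => //; exact: bounded_mfun_integrable (bh n).
have iX2 : P.-integrable setT (EFin \o (fun w => X w ^+ 2)).
  apply/integrableP; split.
    by apply/measurable_EFinP; exact: measurable_funX.
  apply: (le_lt_trans _ (ltry v)); apply: le_trans F.
  rewrite le_eqVlt; apply/orP; left; apply/eqP; apply: eq_integral => w _ /=.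
  by rewrite ger0_norm// sqr_ge0.
have i1 : P.-integrable setT (EFin \o (fun w => 1 + X w ^+ 2)).
  have := integrableD measurableT (bounded_mfun_integrable P (bounded_mfun_cst 1)) iX2.
  by congr integrable; apply/funext => w.
apply: le_integrable i1 => //; first exact/measurable_EFinP.
move=> w _ /=; rewrite lee_fin [leRHS]ger0_norm ?addr_ge0 ?sqr_ge0//.
have -> : X w ^+ 2 = `|X w| ^+ 2 by rewrite real_normK ?num_real.
by have := sqr_ge0 (`|X w| - 1); nra.
Qed.

(* [E[X 1_A]] is the limit of [E[n sin (X / n) 1_A]]. *)
Lemma gaussian_centered (A : set Omega) : measurable A ->
  (forall a, Ex P (fun w => sin (a * X w) * \1_A w) = 0) ->
  \int[P]_(w in A) X w = 0.
Proof.
move=> mA sA; rewrite -Ex_mul_indic.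
have c : Ex P (fun w => n.+1%:R * sin (n.+1%:R^-1 * X w) * \1_A w) @[n --> \oo] -->
    Ex P (fun w => X w * \1_A w).
  apply: (@Rintegral_dominated_cvg _ _ _ P
    (fun n w => n.+1%:R * sin (n.+1%:R^-1 * X w) * \1_A w) _ (fun w => `|X w|)).
  - move=> n; apply: measurable_funM => //; apply: measurable_funM => //.
    by case: (bounded_mfun_sin (mscale n.+1%:R^-1)).
  - exact: measurable_funM.
  - have := integrable_norm gaussian_integrable; congr integrable.
  - move=> n w; rewrite 2!normrM ger0_norm// -[leRHS]mulr1 ler_pM//.
      rewrite (le_trans (ler_wpM2l _ (normr_sin_le _)))//.
      by rewrite normrM ger0_norm ?invr_ge0// mulrA divff ?mul1r// pnatr_eq0.
    by rewrite indicE; case: (_ \in _); rewrite ?normr1 ?normr0.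
  - apply: aeW => w; apply: cvgMl.
    by under eq_fun do rewrite (mulrC _^-1); exact: cvg_mul_sin_div.
suff e : (fun n => Ex P (fun w => n.+1%:R * sin (n.+1%:R^-1 * X w) * \1_A w)) = cst 0.
  by rewrite e in c; apply/esym; apply: (cvg_unique _ _ c) => //; exact: cvg_cst.
apply/funext => n; under eq_fun do rewrite -mulrA.
rewrite ExZ ?sA ?mulr0//; apply: bounded_mfunM; last exact: bounded_mfun_indic.
by apply: bounded_mfun_sin; exact: mscale.
Qed.

End gaussian_integrable.

(** * Conditioning on the endpoint and the area *)

Section C01_dual.
Context {R : realType}.
Implicit Types (f g : R -> R) (b : (R -> R) -> R).

Lemma C01_norm_le f (e : R) : (forall x, 0 <= x <= 1 -> `|f x| <= e) -> C01_norm f <= e.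
Proof.
move=> fe; apply: ge_sup; first by exists `|f 0|; exists 0 => //=; rewrite in_itv/= lexx ler01.
by move=> _ [x /= x01 <-]; apply: fe; move: x01; rewrite in_itv.
Qed.

Lemma le_C01_norm f x : C01 f -> 0 <= x <= 1 -> `|f x| <= C01_norm f.
Proof.
move=> cf x01; have [K _ fK] := within_continuous_bounded cf.
apply: ub_le_sup; last by exists x => //=; rewrite in_itv.
by exists K => _ [y /= y01 <-]; apply: fK; move: y01; rewrite in_itv.
Qed.

Lemma C01_cst (c : R) : C01 (fun=> c).
Proof. exact: within_continuous_cst. Qed.

Lemma C01_comb (I : Type) (s : seq (R * I)) (e : I -> R -> R) :
  (forall i, C01 (e i)) -> C01 (fun x => lin s (fun i => e i x)).
Proof.
move=> ce; elim: s => [|p s IH].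
  by under eq_fun do rewrite lin_nil; exact: C01_cst.
under eq_fun do rewrite lin_cons.
apply: within_continuousD => //; apply: within_continuousM; [exact: C01_cst|exact: ce].
Qed.

Lemma dual0 b : C01_dual b -> b (fun=> 0) = 0.
Proof.
move=> [blin _]; have := blin (-1) (fun=> 0) (fun=> 0) (@C01_cst 0) (@C01_cst 0).
by rewrite (_ : (fun _ => _) = (fun=> 0)) ?mulN1r ?addNr//; apply/funext => x; rewrite mulr0 addr0.
Qed.

Lemma dual_comb b (I : Type) (s : seq (R * I)) (e : I -> R -> R) :
  C01_dual b -> (forall i, C01 (e i)) ->
  b (fun x => lin s (fun i => e i x)) = lin s (fun i => b (e i)).
Proof.
move=> db ce; elim: s => [|p s IH].
  by rewrite lin_nil -[RHS](dual0 db); congr b; apply/funext => x; rewrite lin_nil.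
rewrite lin_cons -IH; have [blin _] := db; rewrite -blin//; last exact: C01_comb.
by congr b; apply/funext => x; rewrite lin_cons.
Qed.

Lemma eval_dual (s : seq (R * R)) : supported `[0, 1] s -> C01_dual (lin s).
Proof.
move=> Ts; split => [c f g _ _|]; first by rewrite linD linZ.
elim: s Ts => [_|p s IH /supportedP[Tp /IH[K sK]]].
  by exists 0 => f _; rewrite lin_nil normr0 mul0r.
exists (`|p.1| + K) => f cf; rewrite lin_cons (le_trans (ler_normD _ _))// mulrDl.
rewrite lerD ?sK// normrM ler_wpM2l// le_C01_norm//.
Qed.

(* Piecewise linear interpolation at the points [k / (n + 1)]. *)
Definition ramp (n k : nat) (x : R) : R := Num.max 0 (Num.min 1 (n.+1%:R * x - k%:R)).

Definition node (n k : nat) : R := k%:R / n.+1%:R.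

(** The interpolant is f 0 plus the sum of the increments of f over the cells times the ramps. The
    weights [e] of the constant ([None]) and of the ramps are left open: with their values at x one
    gets the interpolant at x, with their images under b its image under b. *)
Definition interp_comb (n : nat) (e : option nat -> R) : seq (R * R) :=
  (e None, 0) :: flatten [seq [:: (e (Some k), node n k.+1); (- e (Some k), node n k)]
                         | k <- iota 0 n.+1].

Lemma lin_interp_comb n (e : option nat -> R) f : lin (interp_comb n e) f =
  e None * f 0 + \sum_(k < n.+1) e (Some (k : nat)) * (f (node n k.+1) - f (node n k)).
Proof.
rewrite lin_cons; congr (_ + _).
rewrite -(big_mkord xpredT (fun k => e (Some k) * (f (node n k.+1) - f (node n k)))).
rewrite /index_iota subn0; elim: (iota 0 n.+1) => [|k l IH].
  by rewrite big_nil lin_nil.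
by rewrite big_cons -IH /= !lin_cons /=; ring.
Qed.

Definition interp_basis (n : nat) (o : option nat) (x : R) : R :=
  if o is Some k then ramp n k x else 1.

Lemma C01_interp_basis n o : C01 (interp_basis n o).
Proof.
case: o => [k|]; last exact: C01_cst.
apply: continuous_within => x.
apply: (@continuous_max _ R (cst 0) (fun x => Num.min 1 (n.+1%:R * x - k%:R)) x).
  exact: cvg_cst.
apply: (@continuous_min _ R (cst 1) (fun x => n.+1%:R * x - k%:R) x).
  exact: cvg_cst.
apply: cvgB; last exact: cvg_cst.
by apply: cvgM; [exact: cvg_cst|exact: cvg_id].
Qed.

(** Ramps are 1 before x and 0 after it, so only the cell that contains x contributes: one true
    increment and one interpolated increment, each at most [e]. *)
Lemma interp_error n f (e : R) x : 0 <= e -> 0 <= x <= 1 ->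
  (forall y z, 0 <= y <= 1 -> 0 <= z <= 1 -> `|y - z| <= n.+1%:R^-1 -> `|f y - f z| <= e) ->
  `|f x - lin (interp_comb n (fun o => interp_basis n o x)) f| <= 2 * e.
Proof.
move=> e0 /andP[x0 x1] fe; have N0 : 0 < n.+1%:R :> R by rewrite ltr0n.
(* The increments of f along the grid stopped at x are matched cell by cell with those of the
   interpolant. *)
have fE : f x = f 0 + \sum_(k < n.+1) (f (grid x n k.+1) - f (grid x n k)).
  rewrite -(big_mkord xpredT (fun k => f (grid x n k.+1) - f (grid x n k))).
  by rewrite telescope_sumr// grid_last// grid0// addrC subrK.
rewrite lin_interp_comb /interp_basis mul1r {1}fE opprD addrACA subrr add0r -sumrB.
pose D k := f (grid x n k.+1) - f (grid x n k) -
  ramp n k x * (f (node n k.+1) - f (node n k)).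
rewrite -/(D _) (eq_bigr (fun k : 'I_n.+1 => D k))//.
have nodeS k : node n k < node n k.+1 by rewrite /node ltr_pM2r ?invr_gt0// ltr_nat.
have nodeM k l : (k <= l)%N -> node n k <= node n l.
  by move=> kl; rewrite /node ler_pM2r ?invr_gt0// ler_nat.
have gridE k : grid x n k = Num.min (node n k) x by [].
have D0 k : ~ (node n k < x /\ x < node n k.+1) -> D k = 0.
  move=> nk; have [xk|kx] := leP x (node n k).
    have xk1 : x <= node n k.+1 by exact: le_trans xk (ltW (nodeS k)).
    rewrite /D !gridE (min_r xk) (min_r xk1) subrr /ramp.
    have h : n.+1%:R * x - k%:R <= 0 by rewrite subr_le0 mulrC -ler_pdivlMr.
    by rewrite min_r ?(le_trans h)// max_l// mul0r subr0.
  have k1x : node n k.+1 <= x by rewrite leNgt; apply/negP => ?; exact: nk.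
  rewrite /D !gridE (min_l k1x) (min_l (ltW kx)) /ramp.
  have h : 1 <= n.+1%:R * x - k%:R.
    by rewrite lerBrDr nat1r mulrC -ler_pdivrMr.
  by rewrite min_l// max_r// mul1r subrr.
have Dle k : (k < n.+1)%N -> `|D k| <= 2 * e.
  move=> kn; have [[kx xk]|nk] := pselect (node n k < x /\ x < node n k.+1); last first.
    by rewrite D0// normr0 mulr_ge0.
  rewrite /D !gridE (min_r (ltW xk)) (min_l (ltW kx)).
  have nk0 : 0 <= node n k by rewrite /node divr_ge0.
  have nk1 : node n k.+1 <= 1 by rewrite /node ler_pdivrMr// mul1r ler_nat.
  have nd : node n k.+1 - node n k = n.+1%:R^-1.
    by rewrite /node -mulrBl -natrB// subSnn mul1r.
  rewrite (le_trans (ler_normB _ _))// mulrDl mul1r lerD//.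
    apply: fe; rewrite ?x0//; first by rewrite nk0 (le_trans (ltW kx)).
    by rewrite ger0_norm -?nd ?lerD2r ?subr_ge0 ltW.
  rewrite normrM -[leRHS]mul1r ler_pM//.
    rewrite ger0_norm /ramp ?le_max ?lexx// ge_max ler01/=.
    by rewrite ge_min lexx.
  apply: fe.
  - by rewrite nk1 andbT (le_trans nk0)// ltW.
  - by rewrite nk0 (le_trans (ltW (nodeS k))).
  - by rewrite nd ger0_norm.
have [[k0 [k0x xk0]]|nk] := pselect (exists k : 'I_n.+1, node n k < x /\ x < node n k.+1).
  rewrite (bigD1 k0)//= big1 ?addr0; first exact: Dle.
  move=> k kk0; apply: D0 => -[kx xk].
  have [kl|kl|/val_inj kE] := ltngtP k k0.
  - by move: (nodeM _ _ kl); rewrite leNgt (lt_trans k0x xk).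
  - by move: (nodeM _ _ kl); rewrite leNgt (lt_trans kx xk0).
  - by rewrite kE eqxx in kk0.
rewrite big1 ?normr0 ?mulr_ge0// => k _; apply: D0 => h; apply: nk; by exists k.
Qed.

(** A substitute for the Riesz representation: b of the interpolant of f is a finite combination of
    values of f, and by the bound on b it tends to b f. *)
Lemma dual_limit b : C01_dual b ->
  exists l : nat -> seq (R * R), (forall n, supported `[0, 1] (l n)) /\
    forall f, C01 f -> lin (l n) f @[n --> \oo] --> b f.
Proof.
move=> db; have [blin [K bK]] := db.
exists (fun n => interp_comb n (fun o => b (interp_basis n o))); split.
  move=> n; have N0 : 0 < n.+1%:R :> R by rewrite ltr0n.
  have nd k : (k <= n.+1)%N -> node n k \in (`[0, 1]%classic : set R).
    move=> kn; apply/mem_set; rewrite /= in_itv/= /node divr_ge0//=.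
    by rewrite ler_pdivrMr// mul1r ler_nat.
  have H l (e : nat -> R) : all (fun k => k <= n)%N l -> supported `[0, 1]
      (flatten [seq [:: (e k, node n k.+1); (- e k, node n k)] | k <- l]).
    elim: l => [//|k l IH] /= /andP[kn ln].
    by rewrite /supported/= (nd k.+1 kn) (nd k (leqW kn)); exact: IH.
  apply/supportedP; split; first by rewrite /= in_itv/= lexx ler01.
  by apply: H; apply/allP => k; rewrite mem_iota.
move=> f cf; apply/cvgrPdist_le => eps eps0.
(* The constant in [C01_dual] may be negative or 0; [K1] dominates it and is positive. *)
pose K1 := `|K| + 1; have K10 : 0 < K1 by rewrite ltr_wpDl.
have e0 : 0 < eps / (2 * K1) by rewrite divr_gt0// mulr_gt0.
have [d d0 fd] := heine_cantor cf e0.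
near=> n.
have nd : n.+1%:R^-1 < d.
  near: n; exists (Num.truncn d^-1) => // m /= dm.
  rewrite -[ltRHS]invrK ltf_pV2 ?posrE ?invr_gt0//.
  by rewrite (lt_le_trans (truncnS_gt _))// ler_nat ltnS.
pose g x := lin (interp_comb n (fun o => interp_basis n o x)) f.
(* The same bilinear expression with the roles exchanged: coefficients from f, indices in the basis.
   This is the form in which b can be pulled inside. *)
pose s := (f 0, None) :: [seq (f (node n k.+1) - f (node n k), Some k) | k <- iota 0 n.+1].
have sE (e : option nat -> R) : lin s e = lin (interp_comb n e) f.
  rewrite lin_interp_comb /s lin_cons mulrC; congr (_ + _).
  rewrite -(big_mkord xpredT (fun k => e (Some k) * (f (node n k.+1) - f (node n k)))).
  rewrite /lin big_map /index_iota subn0; apply: eq_bigr => k _; exact: mulrC.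
have cg : C01 g.
  rewrite (_ : g = fun x => lin s (fun o => interp_basis n o x)).
    by apply: C01_comb => o; exact: C01_interp_basis.
  by apply/funext => x; rewrite sE.
have bg : b g = lin (interp_comb n (fun o => b (interp_basis n o))) f.
  rewrite -sE -dual_comb//; last by move=> o; exact: C01_interp_basis.
  by congr b; apply/funext => x; rewrite sE.
rewrite -bg.
have -> : b f - b g = b (fun x => -1 * g x + f x).
  by rewrite blin// mulN1r addrC.
have cfg : C01 (fun x => -1 * g x + f x).
  by apply: within_continuousD => //; apply: within_continuousM => //; exact: C01_cst.
apply: (le_trans (bK _ cfg)).
have nfg : C01_norm (fun x => -1 * g x + f x) <= 2 * (eps / (2 * K1)).
  apply: C01_norm_le => x x01; rewrite mulN1r addrC.
  apply: interp_error => //; first exact: ltW.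
  by move=> y z y01 z01 yz; apply/ltW/fd => //; exact: le_lt_trans nd.
apply: (@le_trans _ _ (K1 * (2 * (eps / (2 * K1))))).
  apply: (@le_trans _ _ (K1 * C01_norm (fun x => -1 * g x + f x))).
    apply: ler_wpM2r; last by rewrite /K1 (le_trans (ler_norm _))// lerDl.
    apply: le_trans (le_C01_norm (x := 0) cfg _); first exact: normr_ge0.
    by rewrite lexx ler01.
  by rewrite ler_wpM2l// ltW.
by rewrite (_ : K1 * (2 * (eps / (2 * K1))) = eps)//; field; rewrite gt_eqF.
Unshelve. all: by end_near. Qed.

End C01_dual.

(** * Limits of Gaussian variables and uniqueness of conditional expectations *)

Section limits.
Context {R : realType} {d} {Omega : measurableType d} {P : probability Omega R}.

Lemma Ex_cos_cvg (X : nat -> Omega -> R) (Y : Omega -> R) :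
  (forall n, measurable_fun setT (X n)) ->
  (forall w, X n w @[n --> \oo] --> Y w) ->
  Ex P (fun w => cos (X n w)) @[n --> \oo] --> Ex P (fun w => cos (Y w)).
Proof.
move=> mX XY.
have mY : measurable_fun setT Y.
  by apply: measurable_fun_cvg mX _ => w _; exact: XY.
apply: (@Ex_cvg _ _ _ _ _ _ 1).
- by move=> n; case: (bounded_mfun_cos (mX n)).
- by case: (bounded_mfun_cos mY).
- by move=> n w; rewrite ler_norml cos_geN1 cos_le1.
- by apply: aeW => w; apply: (@cvg_comp _ _ _ _ cos); [exact: XY|exact: continuous_cos].
Qed.

(** Convergence of the variances [v n] is part of what is obtained: their limit is recovered from
    the logarithm of the characteristic function at one point [a] where the limiting one is
    positive. *)
Lemma gaussian_cf_lim (X : nat -> Omega -> R) (Y : Omega -> R) (v : nat -> R) :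
  (forall n, measurable_fun setT (X n)) ->
  (forall w, X n w @[n --> \oo] --> Y w) ->
  (forall n, 0 <= v n) ->
  (forall n a phi, Ex P (fun w => cos (a * X n w + phi)) =
     cos phi * expR (- (a ^+ 2 * v n / 2))) ->
  exists2 v0, 0 <= v0 & forall a phi, Ex P (fun w => cos (a * Y w + phi)) =
     cos phi * expR (- (a ^+ 2 * v0 / 2)).
Proof.
move=> mX XY v0 cf.
have mY : measurable_fun setT Y.
  by apply: measurable_fun_cvg mX _ => w _; exact: XY.
have cl a phi : cos phi * expR (- (a ^+ 2 * v n / 2)) @[n --> \oo] -->
    Ex P (fun w => cos (a * Y w + phi)).
  under eq_fun do rewrite -cf.
  apply: Ex_cos_cvg => [n|w].
    by apply: measurable_funD => //; exact: measurable_funM.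
  by apply: cvgD; [apply: cvgMr; exact: XY|exact: cvg_cst].
pose kappa a := Ex P (fun w => cos (a * Y w)).
have clk a : expR (- (a ^+ 2 * v n / 2)) @[n --> \oo] --> kappa a.
  have e0 : (fun w => cos (a * Y w + 0)) = (fun w => cos (a * Y w)).
    by apply/funext => w; rewrite addr0.
  by have := cl a 0; rewrite cos0 e0; under eq_fun do rewrite mul1r.
(* the characteristic function of [Y] is continuous at [0] *)
have [a a0 ka] : exists2 a, 0 < a & 0 < kappa a.
  have k1 : kappa n.+1%:R^-1 @[n --> \oo] --> (1 : R).
    rewrite -[X in _ --> X](Ex_cst P (1:R)).
    rewrite (_ : (fun=> 1) = (fun w : Omega => cos 0)); last by rewrite cos0.
    apply: Ex_cos_cvg => [n|w]; first exact: measurable_funM.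
    by rewrite -[X in _ --> X](mul0r (Y w)); apply: cvgMl; exact: cvg_harmonic.
  have [n _ /(_ n (leqnn n)) kn] : \forall n \near \oo, 0 < kappa n.+1%:R^-1.
    by apply: (cvgr_gt _ k1).
  by exists n.+1%:R^-1 => //; rewrite invr_gt0.
pose l := - 2 * ln (kappa a) / a ^+ 2.
have vl : v n @[n --> \oo] --> l.
  have : - 2 * ln (expR (- (a ^+ 2 * v n / 2))) / a ^+ 2 @[n --> \oo] --> l.
    apply: cvgMl; apply: cvgMr; apply: (@cvg_comp _ _ _ _ (@ln R)); first exact: clk.
    exact: continuous_ln.
  apply: cvg_trans; apply: near_eq_cvg; apply: nearW => n.
  by rewrite expRK; field; rewrite gt_eqF.
exists l.
  rewrite leNgt; apply/negP => l0.
  have [n _ /(_ n (leqnn n)) vn] : \forall n \near \oo, v n < 0.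
    exact: (cvgr_lt _ vl).
  by move: (v0 n); rewrite leNgt vn.
move=> b phi; have := cl b phi => h.
have h' : cos phi * expR (- (b ^+ 2 * v n / 2)) @[n --> \oo] -->
    cos phi * expR (- (b ^+ 2 * l / 2)).
  apply: cvgMr; apply: (@cvg_comp _ _ _ _ expR); last exact: continuous_expR.
  by apply: cvgN; apply: cvgMl; apply: cvgMr.
exact: (cvg_unique _ h h').
Qed.

Lemma trig_indep_lim (I : Type) (T : set I) (Y : I -> Omega -> R)
    (J : Type) (S : set J) (G : nat -> J -> Omega -> R) (H : J -> Omega -> R) :
  (forall i, T i -> measurable_fun setT (Y i)) ->
  (forall n j, S j -> measurable_fun setT (G n j)) ->
  (forall j w, S j -> G n j w @[n --> \oo] --> H j w) ->
  (forall n, trig_indep P T Y S (G n)) -> trig_indep P T Y S H.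
Proof.
move=> mY mG GH ind s r phi psi Ts Sr.
have mr n : measurable_fun setT (fun w => lin r (G n ^~ w) + psi).
  by apply: measurable_funD => //; exact: measurable_lin (mG n) Sr.
have ms : measurable_fun setT (fun w => lin s (Y^~ w) + phi).
  by apply: measurable_funD => //; exact: measurable_lin mY Ts.
have cr w : lin r (G n ^~ w) + psi @[n --> \oo] --> lin r (H^~ w) + psi.
  by apply: cvgD; [apply: (cvg_lin Sr) => j Sj; exact: GH|exact: cvg_cst].
have mH : measurable_fun setT (fun w => lin r (H^~ w) + psi).
  by apply: (measurable_fun_cvg mr) => w _; exact: cr.
have c1 : Ex P (fun w => cos (lin r (G n ^~ w) + psi) * cos (lin s (Y^~ w) + phi))
    @[n --> \oo] --> Ex P (fun w => cos (lin r (H^~ w) + psi) * cos (lin s (Y^~ w) + phi)).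
  apply: (@Ex_cvg _ _ _ _ _ _ 1).
  - by move=> n; apply: measurable_funM; [case: (bounded_mfun_cos (mr n))|case: (bounded_mfun_cos ms)].
  - by apply: measurable_funM; [case: (bounded_mfun_cos mH)|case: (bounded_mfun_cos ms)].
  - move=> n w; rewrite normrM -[leRHS]mulr1.
    by rewrite ler_pM// ler_norml cos_geN1 cos_le1.
  - apply: aeW => w; apply: cvgMl; apply: (@cvg_comp _ _ _ _ cos); first exact: cr.
    exact: continuous_cos.
have c2 := Ex_cos_cvg mr cr.
have c3 : Ex P (fun w => cos (lin r (G n ^~ w) + psi)) *
    Ex P (fun w => cos (lin s (Y^~ w) + phi)) @[n --> \oo] -->
    Ex P (fun w => cos (lin r (H^~ w) + psi)) * Ex P (fun w => cos (lin s (Y^~ w) + phi)).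
  by apply: cvgMl.
have e : (fun n => Ex P (fun w => cos (lin r (G n ^~ w) + psi) * cos (lin s (Y^~ w) + phi))) =
    (fun n => Ex P (fun w => cos (lin r (G n ^~ w) + psi)) *
              Ex P (fun w => cos (lin s (Y^~ w) + phi))).
  by apply/funext => n; exact: ind.
by rewrite e in c1; exact: (cvg_unique _ c1 c3).
Qed.

Lemma cond_exp_unique d' (E : measurableType d') (I : Type) (T : set I)
    (Y : I -> Omega -> E) (X Z1 Z2 : Omega -> R) :
  (forall i, T i -> measurable_fun setT (Y i)) ->
  cond_exp P (sigma_of T Y) X Z1 -> cond_exp P (sigma_of T Y) X Z2 ->
  {ae P, forall w, Z1 w = Z2 w}.
Proof.
move=> mY [iX iZ1 mZ1 E1] [_ iZ2 mZ2 E2].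
have mZ (Z : Omega -> R) : (forall B, measurable B -> sigma_of T Y (Z @^-1` B)) ->
    measurable_fun setT (Z : sigma_type T Y -> R).
  by move=> h _ B mB; rewrite setTI; exact: h.
have half (Z Z' : Omega -> R) : P.-integrable setT (EFin \o Z) ->
    P.-integrable setT (EFin \o Z') ->
    measurable_fun setT (Z : sigma_type T Y -> R) ->
    measurable_fun setT (Z' : sigma_type T Y -> R) ->
    (forall A, sigma_of T Y A -> (\int[P]_(w in A) (Z w)%:E = \int[P]_(w in A) (Z' w)%:E)%E) ->
    {ae P, forall w, Z w <= Z' w}.
  move=> iZ iZ' mZm mZ'm EE.
  (* This event lies in the conditioning sigma-algebra, so the positive function Z - Z' has integral
     0 over it; hence it is null. *)
  pose A := [set w | 0 < Z w - Z' w].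
  have sA : sigma_of T Y A.
    have := sigma_of_preimage (measurable_funB mZm mZ'm) (measurable_itv `]0, +oo[%R).
    by congr (sigma_of _ _); apply/seteqP; split => w; rewrite /A/= in_itv/= andbT.
  have mA := sigma_of_measurable mY sA.
  have iZA : P.-integrable A (EFin \o Z) by exact: integrableS iZ.
  have iZ'A : P.-integrable A (EFin \o Z') by exact: integrableS iZ'.
  have E0 : (\int[P]_(w in A) (Z w - Z' w)%:E = 0)%E.
    under eq_integral do rewrite EFinB.
    rewrite integralB// EE// subee//.
    exact: integrable_fin_num.
  have mD : measurable_fun A (fun w => (Z w - Z' w)%:E).
    apply/measurable_EFinP; apply: measurable_funB.
      by have /measurable_int/measurable_EFinP := iZA.
    by have /measurable_int/measurable_EFinP := iZ'A.
  have := (ae_eq_integral_abs P mA mD).1 _.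
  rewrite (eq_integral (fun w => (Z w - Z' w)%:E)); last first.
    by move=> w /set_mem; rewrite /A/= => /ltW h; rewrite ger0_norm.
  move=> /(_ E0); apply: filterS => w h; rewrite leNgt; apply/negP => lt0.
  have Aw : A w by rewrite /A/= subr_gt0.
  by have [] := h Aw; move/eqP; rewrite subr_eq0 => /eqP e; rewrite e ltxx in lt0.
have E12 A : sigma_of T Y A -> (\int[P]_(w in A) (Z1 w)%:E = \int[P]_(w in A) (Z2 w)%:E)%E.
  by move=> sA; rewrite -E1// E2.
have h1 := half _ _ iZ1 iZ2 (mZ _ mZ1) (mZ _ mZ2) E12.
have h2 := half _ _ iZ2 iZ1 (mZ _ mZ2) (mZ _ mZ1) (fun A sA => esym (E12 A sA)).
by apply: filterS2 h1 h2 => w l1 l2; apply/eqP; rewrite eq_le l1.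
Qed.

End limits.

(** * The anticipative representation *)

Section part1.
Context {R : realType} {d} {Omega : measurableType d} {P : probability Omega R}
  {W : R -> Omega -> R}.
Hypothesis hW : brownian_motion `[0, 1] P W.
Local Notation T01 := (`[0, 1]%classic : set R).
Local Notation S01 := [set j : bool * R | 0 <= j.2 <= 1].
Local Notation mu := (@lebesgue_measure R).
Let N := anticipative_bridge W.

Let T0 : T01 0. Proof. by rewrite /= in_itv/= lexx ler01. Qed.
Let T1 : T01 1. Proof. by rewrite /= in_itv/= lexx ler01. Qed.
Let Tge0 t : T01 t -> 0 <= t. Proof. by rewrite /= in_itv/= => /andP[]. Qed.

Let mW t : T01 t -> measurable_fun setT (W t).
Proof. by case: hW => [[mW _] _ _ _]; exact: mW. Qed.

Let cW w : {within `[0, 1], continuous (W^~ w)}.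
Proof. by case: hW => [[_ cW] _ _ _]; exact: cW. Qed.

Let gWA : gaussian_family S01 P (with_area W) (@brownian_area_cov R).
Proof.
apply: (brownian_area_gaussian (T := T01)).
- by move=> t; rewrite /= in_itv.
- exact: cW.
- by case: hW.
- exact: brownian_gaussian T0 Tge0 hW.
Qed.

Let gNA : gaussian_family S01 P (with_area N) (@bridge_area_cov R).
Proof. exact: bridge_area_gaussian. Qed.

Lemma continuous_anticipative : continuous_process T01 N.
Proof.
split=> [t Tt|w].
  have [mN _] := gNA; have := mN (true, t); rewrite /with_area/=; apply.
  by move: Tt; rewrite /= in_itv.
set I1 := \int[mu]_(u in `[0, 1]) W u w.
apply: (@within_continuous_ext _ _ (fun t => W t w +
    ((2 * W 1 w - 6 * I1) * t + (6 * I1 - 3 * W 1 w) * t ^+ 2))).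
  by move=> t _; rewrite /N /anticipative_bridge -/I1; ring.
apply: within_continuousD; first exact: cW.
apply: continuous_within => t; apply: cvgD; apply: cvgMr; first exact: cvg_id.
exact: exprn_continuous.
Qed.

Let e1 (x : R) : R := x * (3 * x - 2).
Let e2 (x : R) : R := 6 * x * (1 - x).
Let I1 w := \int[mu]_(u in `[0, 1]) W u w.

Let C01e1 : C01 e1.
Proof.
apply: continuous_within => x; apply: cvgM; first exact: cvg_id.
by apply: cvgB; [apply: cvgMr; exact: cvg_id|exact: cvg_cst].
Qed.

Let C01e2 : C01 e2.
Proof.
apply: continuous_within => x; apply: cvgM; first by apply: cvgMr; exact: cvg_id.
by apply: cvgB; [exact: cvg_cst|exact: cvg_id].
Qed.

Let C01N w : C01 (N^~ w).
Proof. by case: continuous_anticipative => _; exact. Qed.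

(** Path by path, W is N plus two fixed continuous functions with random coefficients W_1 and I_1,
    so linearity of b suffices. *)
Let dualN b w : C01_dual b -> b (W^~ w) = b (N^~ w) + (b e1 * W 1 w + b e2 * I1 w).
Proof.
move=> [blin _].
have -> : (W^~ w) = (fun x => W 1 w * e1 x + (fun x => I1 w * e2 x + N x w) x).
  by apply/funext => x; rewrite /N /anticipative_bridge /e1 /e2 -/(I1 w); ring.
rewrite blin//; last first.
  apply: within_continuousD; last exact: C01N.
  by apply: within_continuousM => //; exact: C01_cst.
by rewrite blin//; ring.
Qed.

(** The conditioning variables as a family on booleans: W_1 at [true], I_1 at [false]. *)
Let Y (i : bool) (w : Omega) : R := with_area W (i, 1) w.

Let mY i : measurable_fun setT (Y i).
Proof. by have [mWA _] := gWA; apply: (mWA (i, 1)) => /=; rewrite lexx ler01. Qed.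

Section dual.
Variable b : (R -> R) -> R.
Hypothesis db : C01_dual b.

Let bN w := b (N^~ w).

(** All three facts hold for finite combinations of values of N, by [bridge_comb_orth] for the
    independence, and pass to the limit along [dual_limit]. *)
Lemma dual_bridge_gaussian : measurable_fun setT bN /\
  (exists2 v, 0 <= v & forall a phi, Ex P (fun w => cos (a * bN w + phi)) =
     cos phi * expR (- (a ^+ 2 * v / 2))) /\
  trig_indep P setT Y setT (fun _ : unit => bN).
Proof.
have [l [Tl lb]] := dual_limit db.
pose lN n := [seq (p.1, (true, p.2)) | p <- l n].
have SlN n : supported S01 (lN n).
  rewrite /supported /lN all_map; apply: sub_all (Tl n) => p /set_mem/=.
  by rewrite in_itv/= => h; apply/mem_set.
have lNE n w : lin (l n) (N^~ w) = lin (lN n) (with_area N ^~ w).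
  by rewrite /lin big_map.
have mlN n : measurable_fun setT (fun w => lin (l n) (N^~ w)).
  rewrite (_ : (fun w => _) = (fun w => lin (lN n) (with_area N ^~ w))).
    by have [mNA _] := gNA; exact: measurable_lin mNA (SlN n).
  by apply/funext.
have cv w : lin (l n) (N^~ w) @[n --> \oo] --> bN w by exact: lb.
split; first by apply: (measurable_fun_cvg mlN) => w _; exact: cv.
split.
  apply: (gaussian_cf_lim (v := fun n => cov_lin (@bridge_area_cov R) (lN n) (lN n)) mlN cv).
    by move=> n; exact: cov_lin_ge0 gNA (SlN n).
  move=> n a phi; rewrite -(gaussian_family_cf gNA (SlN n)).
  by congr Ex; apply/funext => w; rewrite lNE.
have mY' : forall i : bool, [set: bool] i -> measurable_fun setT (Y i) by move=> i _; exact: mY.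
have mG n (j : unit) : [set: unit] j -> measurable_fun setT (fun w => lin (l n) (N^~ w)).
  by move=> _; exact: mlN.
apply: (@trig_indep_lim _ _ _ _ _ _ _ _ _ (fun n (_ : unit) w => lin (l n) (N^~ w))
  (fun=> bN) mY' mG (fun _ w _ => cv w)).
move=> n.
have SB : supported S01 (subst_comb (@bridge_comb R) (lN n)).
  by apply: supported_subst (SlN n) => j; exact: supported_bridge_comb.
have S1 (i : bool) : S01 (i, 1) by rewrite /= lexx ler01.
have := @gaussian_family_indep _ _ _ P _ bool unit S01 setT setT (with_area W)
  (@brownian_area_cov R) (fun i => [:: (1, (i, 1))])
  (fun=> subst_comb (@bridge_comb R) (lN n)) gWA (@brownian_area_covC R).
have -> : (fun (j : bool) w => lin [:: (1, (j, 1))] (with_area W ^~ w)) = Y.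
  by apply/funext => i; apply/funext => w; rewrite lin_seq1 mul1r.
have -> : (fun (k : unit) w => lin (subst_comb (@bridge_comb R) (lN n)) (with_area W ^~ w)) =
    (fun _ w => lin (l n) (N^~ w)).
  apply/funext => k; apply/funext => w; rewrite lin_subst lNE.
  apply: (eq_lin (SlN n)) => j Sj.
  by rewrite lin_bridge_comb.
apply => //.
- by move=> i _; rewrite /supported/= mem_set.
- move=> i k _ _; rewrite /cov_lin lin_seq1/= mul1r lin_subst.
  rewrite {1}/lin big_map -/(lin (l n) (fun s => lin (bridge_comb (true, s)) (brownian_area_cov (i, 1)))).
  rewrite (eq_lin (Tl n) (f' := fun=> 0)) ?lin0// => s.
  rewrite /= in_itv/= => s01; rewrite -[RHS](@bridge_comb_orth _ s i s01) /cov_lin.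
  by congr lin; apply/funext => j; rewrite lin_seq1 mul1r brownian_area_covC.
Qed.

Let lin1 (f : unit -> R) a : lin [:: (a, tt)] f = a * f tt.
Proof. exact: lin_seq1. Qed.

Lemma dual_bridge_integrable : P.-integrable setT (EFin \o bN).
Proof.
by have [mb [[v v0 cf] _]] := dual_bridge_gaussian; exact: gaussian_integrable cf.
Qed.

(** By independence the expectation of sin (a b(N)) over A factors, and the sine, a cosine of phase
    - pi / 2, has mean 0; [gaussian_centered] removes the sine. *)
Lemma dual_bridge_centered A : sigma_of setT Y A -> \int[P]_(w in A) bN w = 0.
Proof.
have [mb [[v v0 cf] ind]] := dual_bridge_gaussian.
have mY' : forall i : bool, [set: bool] i -> measurable_fun setT (Y i) by move=> i _; exact: mY.
move=> sA; refine (@gaussian_centered _ _ _ _ bN v mb cf A _ _); first exact: sigma_of_measurable mY' sA.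
move=> a; have := @trig_indep_Ex _ _ _ P _ _ Y _ setT (fun _ : unit => bN) mY'
   (fun _ _ => mb) ind [:: (a, tt)] (- (pi / 2)) A.
have -> : (fun w => cos (lin [:: (a, tt)] (fun=> bN w) - pi / 2) * \1_A w) =
    (fun w => sin (a * bN w) * \1_A w).
  by apply/funext => w; rewrite lin1 -sin_cos_shift.
have -> : (fun w => cos (lin [:: (a, tt)] (fun=> bN w) - pi / 2)) =
    (fun w => cos (a * bN w + - (pi / 2))).
  by apply/funext => w; rewrite lin1.
move=> -> //; last by rewrite /supported/= in_setT.
by rewrite cf cosN cos_pihalf !mul0r.
Qed.

End dual.

Local Notation cond_set := [set (fun f : R -> R => f 1);
   (fun f => \int[lebesgue_measure]_(x in `[0, 1]) f x)].
Local Notation cond_sigma := (sigma_of cond_set (fun a w => a (W^~ w))).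

Let Yint i : P.-integrable setT (EFin \o Y i).
Proof.
have S1 : supported S01 [:: (1 : R, (i, 1 : R))] by rewrite /supported/= mem_set//= lexx ler01.
apply: (@gaussian_integrable _ _ _ _ _ (cov_lin (@brownian_area_cov R) [:: (1, (i, 1))] [:: (1, (i, 1))]) (mY i)) => a phi.
rewrite -(gaussian_family_cf gWA S1).
by congr Ex; apply/funext => w; rewrite lin_seq1 mul1r.
Qed.

Lemma bridge_cond_exp b : C01_dual b -> cond_exp P cond_sigma (fun w => b (W^~ w))
  (fun w => b e1 * W 1 w + b e2 * I1 w).
Proof.
move=> db; have ib := dual_bridge_integrable db.
pose Z w := b e1 * W 1 w + b e2 * I1 w.
have iZ : P.-integrable setT (EFin \o Z).
  rewrite (_ : _ \o _ = (fun w => (b e1)%:E * (EFin \o Y true) w +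
      (b e2)%:E * (EFin \o Y false) w)%E); last first.
    by apply/funext => w; rewrite /= -!EFinM -EFinD.
  by apply: integrableD => //; exact: integrableZl.
have EW : (EFin \o (fun w => b (W^~ w))) = (fun w => (EFin \o (fun w => b (N^~ w))) w + (EFin \o Z) w)%E.
  by apply/funext => w; rewrite /= (dualN _ db) EFinD.
have sub : cond_sigma `<=` sigma_of setT Y.
  apply: sigma_of_sub => a [] ->.
    exact: (@sigma_type_measurable _ _ _ _ _ setT Y true).
  exact: (@sigma_type_measurable _ _ _ _ _ setT Y false).
split => //.
- by rewrite EW; exact: integrableD.
- move=> B mB; apply: sigma_of_preimage mB.
  apply: measurable_funD; apply: measurable_funM => //.
    exact: (@sigma_type_measurable _ _ _ _ _ cond_set (fun a w => a (W^~ w)) (fun f => f 1) (or_introl erefl)).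
  exact: (@sigma_type_measurable _ _ _ _ _ cond_set (fun a w => a (W^~ w)) (fun f => \int[lebesgue_measure]_(x in `[0, 1]) f x) (or_intror erefl)).
- move=> A sA.
  have mA : measurable A.
    by apply: (@sigma_of_measurable _ setT _ _ _ _ Y) => [i _|]; [exact: mY|exact: sub].
  transitivity (\int[P]_(w in A) ((EFin \o (fun w => b (N^~ w))) w + (EFin \o Z) w))%E.
    by apply: eq_integral => w _; exact: (congr1 (@^~ w) EW).
  have ibA := integrableS measurableT mA (@subsetT _ _) ib.
  have iZA := integrableS measurableT mA (@subsetT _ _) iZ.
  rewrite integralD//.
  have := dual_bridge_centered db (sub _ sA); rewrite /Rintegral => E0.
  have fN := integrable_fin_num mA ibA.
  by rewrite -(fineK fN) E0 add0e.
Qed.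

Lemma gaussian_anticipative : gaussian_process T01 P N.
Proof.
move=> n t a Tt.
pose s := [seq (a k, (true, t k)) | k <- enum 'I_n].
have Ss : supported S01 s.
  rewrite /supported all_map; apply/allP => k _ /=; apply/mem_set => /=.
  by move: (Tt k); rewrite /= in_itv.
have E : (fun w => \sum_(k < n) a k * N (t k) w) = (fun w => lin s (with_area N ^~ w)).
  by apply/funext => w; rewrite /lin big_map big_enum.
rewrite E; split; first by have [mN _] := gNA; exact: measurable_lin mN Ss.
exists 0, (Num.sqrt (cov_lin (@bridge_area_cov R) s s)) => B mB.
by rewrite -(gaussian_family_law gNA Ss mB).
Qed.

Lemma zero_area_bridge_anticipative : zero_area_bridge P W P N.
Proof.
split; [exact: continuous_anticipative|exact: gaussian_anticipative|].
move=> n b db; exists (fun k w => b k e1 * W 1 w + b k e2 * I1 w).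
split=> [k|A cA]; first exact: bridge_cond_exp.
congr (P _); apply/seteqP; split => w /=.
  by congr A; apply/funext => k; rewrite (dualN _ (db k)) addrK.
by congr A; apply/funext => k; rewrite (dualN _ (db k)) addrK.
Qed.

Lemma zero_area_bridge_same_cf d' (Omega' : measurableType d')
    (P' : probability Omega' R) (M : R -> Omega' -> R) :
  zero_area_bridge P W P' M -> same_cf T01 P N P' M.
Proof.
move=> [[mM _] _ cM] s phi Ts.
have ds := eval_dual Ts.
(* The definition is applied to one functional at a time. Its version [Z] is unknown, but almost
   surely equal to the explicit one of [bridge_cond_exp]. *)
have [//|Z [/(_ ord0) cZ sl]] := cM 1%N (fun=> lin s).
have mYc a : cond_set a -> measurable_fun setT (fun w => a (W^~ w)).
  by move=> [] ->; [exact: (mY true)|exact: (mY false)].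
have EZ := cond_exp_unique mYc cZ (bridge_cond_exp ds).
have mlW : measurable_fun setT (fun w => lin s (W^~ w)) by exact: measurable_lin mW Ts.
have mZ : measurable_fun setT (Z ord0).
  move=> _ B mB; rewrite setTI; case: cZ => _ _ /(_ B mB) + _.
  exact: sigma_of_measurable.
have mWZ : measurable_fun setT (fun w => lin s (W^~ w) - Z ord0 w) by exact: measurable_funB.
have mlM : measurable_fun setT (fun w => lin s (M^~ w)) by exact: measurable_lin mM Ts.
have mlN : measurable_fun setT (fun w => lin s (N^~ w)).
  by apply: measurable_lin Ts; case: continuous_anticipative.
have bc : bounded_mfun (fun x : R => cos (x + phi)).
  by apply: bounded_mfun_cos; exact: measurable_funD.
have EM : Ex P' (fun w => cos (lin s (M^~ w) + phi)) =
    Ex P (fun w => cos (lin s (W^~ w) - Z ord0 w + phi)).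
  rewrite -(Ex_law mlM bc) -(Ex_law mWZ bc); apply: eq_Ex => B mB.
  have cB : cylinder_sigma setT [set f : 'I_1 -> R | B (f ord0)].
    by apply: sub_gen_smallest; exists ord0 => //; exists B => //; rewrite setTI.
  have slB := sl _ cB.
  by rewrite (lawE mlM B) (lawE mWZ B); exact: slB.
rewrite EM.
have mcW : measurable_fun setT (fun w => cos (lin s (W^~ w) - Z ord0 w + phi)).
  by case: (bounded_mfun_comp mWZ bc).
have mcN : measurable_fun setT (fun w => cos (lin s (N^~ w) + phi)).
  by case: (bounded_mfun_comp mlN bc).
(* Dominated convergence along a constant sequence: almost sure equality of the arguments gives
   equality of the expectations. *)
have h : Ex P (fun w => cos (lin s (N^~ w) + phi)) @[_ --> \oo] -->
    Ex P (fun w => cos (lin s (W^~ w) - Z ord0 w + phi)).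
  apply: (@Ex_cvg _ _ _ _ (fun _ w => cos (lin s (N^~ w) + phi)) _ 1) => //.
    by move=> n w; rewrite ler_norml cos_geN1 cos_le1.
  apply: filterS EZ => w ->.
  by rewrite (dualN _ ds) addrK; exact: cvg_cst.
exact: (cvg_unique _ (cvg_cst _) h).
Qed.

Lemma zero_area_bridge_same_law d' (Omega' : measurableType d')
    (P' : probability Omega' R) (M : R -> Omega' -> R) :
  zero_area_bridge P W P' M -> same_law T01 P N P' M.
Proof.
move=> zM; apply: same_law_of_cf; last exact: zero_area_bridge_same_cf.
  by case: continuous_anticipative.
by case: zM => [[]].
Qed.

End part1.

(** * Strong solutions of the equation *)

Section bridge_process.
Context {R : realType}.
Local Notation T1 := (`[0, 1[%classic : set R).

Let T1P t : T1 t <-> 0 <= t < 1.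
Proof. by rewrite /= in_itv. Qed.

Let supported1 s : T1 s -> supported T1 [:: (1 : R, s)].
Proof. by move=> Ts; rewrite /supported/= mem_set. Qed.

Let T1sub t u : T1 t -> 0 <= u <= t -> T1 u.
Proof.
by move=> /T1P/andP[_ t1] /andP[u0 ut]; apply/T1P; rewrite u0 (le_lt_trans ut t1).
Qed.

Let T1le t : T1 t -> 0 <= t <= 1.
Proof. by move=> /T1P/andP[-> /ltW]. Qed.

Let T1lt t : T1 t -> t < 1.
Proof. by move=> /T1P/andP[]. Qed.

Lemma noise_of_bridge_of (w : R -> R) s : {within T1, continuous w} -> 0 <= s < 1 ->
  noise_of (bridge_of w) s = w s.
Proof.
move=> cw s01; rewrite noise_ofE//; last exact: within_continuous_bridge_of.
by rewrite {1}bridge_of_solves//; ring.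
Qed.

(** With [noise_of_bridge_of], this makes the two path maps mutually inverse. Here uniqueness for
    the equation is used, since m solves it for the noise [noise_of m] by construction. *)
Lemma bridge_of_noise_of (m : R -> R) s : {within T1, continuous m} -> 0 <= s < 1 ->
  bridge_of (noise_of m) s = m s.
Proof.
move=> cm s01; apply/esym; apply: bridge_of_unique s01 => //.
  exact: within_continuous_noise_of.
by move=> u u01; rewrite noise_ofE//; ring.
Qed.

(** [measurable_path_functional] read on the sample space that carries only the sigma-algebra of the
    past up to s. *)
Lemma adapted_path_functional d (Omega : measurableType d) (W : R -> Omega -> R)
    (k : R -> R -> R) : (forall s, s < 1 -> {within `[0, s], continuous (k s)}) ->
  (forall w, {within T1, continuous (W^~ w)}) ->
  adapted_to T1 W (fun s w => path_functional [:: (1, s)] s (k s) (W^~ w)).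
Proof.
move=> ck cW s Ts B mB; apply: sigma_of_preimage mB.
pose Ts' := T1 `&` `]-oo, s].
have Tu u : 0 <= u <= s -> Ts' u.
  move=> u0s; split; first exact: T1sub u0s.
  by rewrite /= in_itv/=; case/andP: u0s.
apply: (@measurable_path_functional _ _ (sigma_type Ts' W) Ts' W) => //.
- exact: T1le.
- by rewrite /supported/= mem_set//; apply: Tu; rewrite lexx andbT; case/T1P/andP: Ts.
- by apply: ck; exact: T1lt.
- by move=> w; apply: halfopen_within_continuous => //; exact: T1lt.
- by move=> u Tsu; exact: sigma_type_measurable.
Qed.

Lemma adapted_measurable d (Omega : measurableType d) (W M : R -> Omega -> R) :
  (forall t, T1 t -> measurable_fun setT (W t)) -> adapted_to T1 W M ->
  forall t, T1 t -> measurable_fun setT (M t).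
Proof.
move=> mW aM t Tt _ B mB; rewrite setTI.
by apply: sigma_of_measurable (aM t Tt B mB) => u [Tu _]; exact: mW.
Qed.

Section driven.
Context {d} {Omega : measurableType d} {P : probability Omega R} {W : R -> Omega -> R}.
Hypothesis mW : forall t, T1 t -> measurable_fun setT (W t).
Hypothesis cW : forall w, {within T1, continuous (W^~ w)}.
Hypothesis W0 : {ae P, forall w, W 0 w = 0}.
Hypothesis gW : gaussian_family T1 P W (fun s t => Num.min s t).
Let B s w := bridge_of (W^~ w) s.

(** [bridge_integrand s] is 1 at u = s and its derivative is minus [bridge_kernel s], so summation
    by parts identifies its Wiener integral with [bridge_of]; the isometry supplies the
    covariance. *)
Lemma bridge_of_gaussian : gaussian_family T1 P B (@bridge_cov R).
Proof.
have cWb t w : t < 1 -> {within `[0, t], continuous (W^~ w)}.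
  by move=> t1; exact: halfopen_within_continuous.
have := @wiener_gaussian R T1 _ _ P W R T1 id (@bridge_integrand R)
   (fun s u => - bridge_kernel s u) T1le T1sub
   (fun j w Tj => cWb j w (T1lt Tj))
   (fun j Tj => within_continuous_bridge_integrand (T1lt Tj))
   (fun j Tj => within_continuousN (within_continuous_bridge_kernel (T1lt Tj))).
case.
- by move=> j Tj u /andP[_ uj]; apply: is_derive_bridge_integrand; exact: lt_trans uj (T1lt Tj).
- exact: W0.
- exact: gW.
move=> mF cf.
have FB s w : T1 s -> path_functional [:: (bridge_integrand s s, s)] s
    (fun u => - - bridge_kernel s u) (W^~ w) = B s w.
  move=> Ts; rewrite bridge_integrand_diag ?T1lt//.
  by rewrite /B /bridge_of; congr path_functional; apply/funext => u; rewrite opprK.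
have g : gaussian_family T1 P (fun s w => path_functional [:: (bridge_integrand s s, s)] s
    (fun u => - - bridge_kernel s u) (W^~ w)) (@bridge_cov R).
  apply: gaussian_family_cov (conj mF cf) => s t Ts Tt.
  by apply: bridge_integrand_isometry; apply/T1P.
apply: (gaussian_family_ae g) => s Ts.
  rewrite (_ : B s = fun w => path_functional [:: (bridge_integrand s s, s)] s
    (fun u => - - bridge_kernel s u) (W^~ w)); first exact: mF.
  by apply/funext => w; rewrite FB.
by apply: aeW => w; exact: FB.
Qed.

Lemma bridge_of_adapted : adapted_to T1 W B.
Proof.
by apply: adapted_path_functional => // s; exact: within_continuous_bridge_kernel.
Qed.

Lemma bridge_of_sde : bridge_sde P W B.
Proof.
have mB := adapted_measurable mW bridge_of_adapted.
split.
- by split => // w; exact: within_continuous_bridge_of.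
- apply: (gaussian_ae0 bridge_of_gaussian); first by apply/T1P; rewrite lexx ltr01.
  by rewrite /bridge_cov minxx; ring.
- by apply: aeW => w s s01; rewrite /B {1}bridge_of_solves.
Qed.

Lemma bridge_sde_gaussian M : bridge_sde P W M -> gaussian_family T1 P M (@bridge_cov R).
Proof.
move=> [[mM cM] _ eqM]; apply: (gaussian_family_ae bridge_of_gaussian) => // s Ts.
apply: filterS eqM => w e; apply/esym.
exact: (bridge_of_unique (cM w) (@cW w) e (proj1 (T1P s) Ts)).
Qed.

Context {d'} {Omega' : measurableType d'} {P' : probability Omega' R}
  {M : R -> Omega' -> R}.
Hypothesis mM : forall t, T1 t -> measurable_fun setT (M t).
Hypothesis cM : forall w, {within T1, continuous (M^~ w)}.
Hypothesis gM : gaussian_family T1 P' M (@bridge_cov R).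
Let W' s w := noise_of (M^~ w) s.

(** The reference Brownian motion W lives on another space. M and the solution B driven by W have
    the same law; applying [noise_of] to both turns B back into W. *)
Lemma noise_of_brownian : brownian_motion T1 P' W'.
Proof.
have cW' w : {within T1, continuous (W'^~ w)} by exact: within_continuous_noise_of.
have mW' : forall t, T1 t -> measurable_fun setT (W' t).
  apply: (adapted_measurable mM); apply: adapted_path_functional => // s.
  exact: within_continuous_noise_kernel.
have mB := adapted_measurable mW bridge_of_adapted.
apply: gaussian_brownian.
- by apply/T1P; rewrite lexx ltr01.
- exact: (conj mW' cW').
apply: (gaussian_family_transfer gW mW') => s phi Ts.
have := @same_cf_path_functional R T1 _ _ P B _ _ P' M R T1 (fun s => [:: (1, s)]) id
  (@noise_kernel R) mB mM T1le T1sub supported1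
  (fun s Ts => within_continuous_noise_kernel (T1lt Ts)).
move=> /(_ _ _ (gaussian_family_same_cf bridge_of_gaussian gM) s phi Ts) <-.
- congr Ex; apply/funext => w; congr (cos (_ + _)); apply: (eq_lin Ts) => u /T1P u01.
  exact: esym (noise_of_bridge_of (@cW w) u01).
- move=> j w Tj; apply: halfopen_within_continuous (T1lt Tj).
  exact: within_continuous_bridge_of.
- by move=> j w Tj; apply: halfopen_within_continuous (T1lt Tj).
Qed.

Lemma noise_of_sde : bridge_sde P' W' M.
Proof.
split.
- exact: (conj mM cM).
- apply: (gaussian_ae0 gM); first by apply/T1P; rewrite lexx ltr01.
  by rewrite /bridge_cov minxx; ring.
- by apply: aeW => w s s01; rewrite /W' noise_ofE//; rewrite /area; ring.
Qed.

Lemma noise_of_adapted : adapted_to T1 W' M.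
Proof.
move=> s Ts B0 mB0.
have cW' w : {within T1, continuous (W'^~ w)} by exact: within_continuous_noise_of.
have := @adapted_path_functional _ Omega' W' (@bridge_kernel R)
  (@within_continuous_bridge_kernel R) cW' s Ts B0 mB0.
congr (sigma_of _ _); apply/seteqP; split => w /=.
  by rewrite -/(bridge_of (W'^~ w) s) bridge_of_noise_of//; exact/T1P.
by rewrite -/(bridge_of (W'^~ w) s) bridge_of_noise_of//; exact/T1P.
Qed.

End driven.
End bridge_process.

(** * The Markov property *)

Section random_map.
Context {R : realType} d1 d2 d3 (E1 : measurableType d1) (E2 : measurableType d2)
  (E3 : measurableType d3).
Variables (mu : probability E2 R) (f : E1 * E2 -> E3) (mf : measurable_fun setT f).

Let mfx x : measurable_fun setT (fun y => f (x, y)).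
Proof. exact: (measurableT_comp mf (pair1_measurable x)). Qed.

(** The Markov kernel that sends x to the law of f (x, G), where G has law [mu]. *)
Definition random_map (x : E1) : {measure set E3 -> \bar R} := law mu (mfx x).

Lemma random_mapE x B : random_map x B = mu [set y | B (f (x, y))].
Proof. by []. Qed.

Let measurable_random_map U : measurable U ->
  measurable_fun setT (random_map ^~ U).
Proof.
move=> mU.
have mS : measurable (f @^-1` U) by rewrite -[X in measurable X]setTI; exact: mf.
apply: (eq_measurable_fun _ _ (measurable_fun_xsection mu mS)) => x _ /=.
by rewrite random_mapE; congr (mu _); apply/seteqP; split => y /=; rewrite /xsection/= inE.
Qed.

HB.instance Definition _ := isKernel.Build _ _ _ _ _ random_map measurable_random_map.

Let random_map_prob x : random_map x setT = 1%E.
Proof. by rewrite random_mapE; exact: probability_setT. Qed.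

HB.instance Definition _ := Kernel_isProbability.Build _ _ _ _ _ random_map
  random_map_prob.

End random_map.

Section indep_cond_exp.
Context {R : realType} {d} {Omega : measurableType d} {P : probability Omega R}.
Context {dE} {E : measurableType dE} {I : Type} {T : set I} {X : I -> Omega -> E}.
Hypothesis mX : forall i, T i -> measurable_fun setT (X i).
Context {d1 d2 d3} {E1 : measurableType d1} {E2 : measurableType d2}
  {E3 : measurableType d3}.
Context {V : Omega -> E1} {G : Omega -> E2} {f : E1 * E2 -> E3}.
Hypothesis mV : measurable_fun setT (V : sigma_type T X -> E1).
Hypothesis mG : measurable_fun setT G.
Hypothesis mf : measurable_fun setT f.
Hypothesis indep : forall A B, sigma_of T X A -> measurable B ->
  P (A `&` G @^-1` B) = (P A * P (G @^-1` B))%E.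

(** The freezing lemma: V is known from the past and G is independent of it, so conditioning
    integrates G out with V held fixed. *)
Lemma indep_cond_exp (B : set E3) : measurable B ->
  cond_exp P (sigma_of T X) \1_((fun w => f (V w, G w)) @^-1` B)
    (fun w => fine (random_map (law P mG) mf (V w) B)).
Proof.
move=> mB; pose kappa := random_map (law P mG) mf.
have mid : measurable_fun setT (id : Omega -> sigma_type T X).
  by move=> _ C mC; rewrite setTI; exact: sigma_of_measurable mX mC.
have mVO : measurable_fun setT V by exact: (measurableT_comp mV mid).
have mY : measurable_fun setT (fun w => f (V w, G w)).
  by apply: (measurableT_comp mf); exact: measurable_fun_pair.
have mYB : measurable ((fun w => f (V w, G w)) @^-1` B).
  by rewrite -[X in measurable X]setTI; exact: mY.
have mkap : measurable_fun setT (kappa ^~ B) by exact: measurable_kernel.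
have mZ : measurable_fun setT (fun w : sigma_type T X => fine (kappa (V w) B)).
  by apply: (measurableT_comp (measurableT_comp _ mkap) mV).
have mZO : measurable_fun setT (fun w => fine (kappa (V w) B)).
  exact: (measurableT_comp mZ mid).
have kfin x : kappa x B \is a fin_num by exact: fin_num_measure.
split.
- by apply: bounded_mfun_integrable; exact: bounded_mfun_indic.
- apply: bounded_mfun_integrable; split=> //; exists 1 => w.
  rewrite ger0_norm ?fine_ge0// -lee_fin fineK//.
  by rewrite -(@prob_kernel _ _ _ _ _ kappa (V w)) le_measure// inE.
- by move=> C mC; exact: sigma_of_preimage mZ mC.
- move=> A sA; have mA := sigma_of_measurable mX sA.
  rewrite integral_indic//.
  (* The first coordinate is the sample point itself, seen in the sigma-algebra of the past. The
     event A and the condition on f then form one set for the product law. *)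
  pose S : set (sigma_type T X * E2) := [set p | A p.1 /\ B (f (V p.1, p.2))].
  have mS : measurable S.
    apply: measurableI.
      by rewrite -[X in measurable X]setTI; apply: measurable_fst.
    have : measurable_fun setT (fun p : sigma_type T X * E2 => f (V p.1, p.2)).
      apply: (measurableT_comp mf); apply: measurable_fun_pair => //.
      exact: (measurableT_comp mV).
    by move=> /(_ measurableT B mB); rewrite setTI.
  have SE w : xsection S w = [set y | A w /\ B (f (V w, y))].
    by apply/seteqP; split => y; rewrite /xsection/= inE.
  have ind (C : set (sigma_type T X)) (D : set E2) : measurable C -> measurable D ->
    P (id @^-1` C `&` G @^-1` D) = (P (id @^-1` C) * P (G @^-1` D))%E by exact: indep.
  transitivity ((law P mid \x law P mG)%E S).
    rewrite -(law_indep_pair mid mG ind mS); congr (P _).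
    by apply/seteqP; split => w [].
  transitivity (\int[P]_w (law P mG (xsection S w)))%E.
    refine (@ge0_integral_distribution _ _ _ _ _ P (mfun_Sub (mem_set mid))
      (fun x => law P mG (xsection S x)) (measurable_fun_xsection (law P mG) mS) _).
    by move=> x; exact: measure_ge0.
  rewrite [RHS]integral_mkcond; apply: eq_integral => w _; rewrite patchE SE.
  case: ifPn => [/set_mem wA|/negP wA].
    rewrite fineK// random_mapE; congr (law P mG _).
    by apply/seteqP; split => y //= [].
  rewrite (_ : [set y | _] = set0) ?measure0//.
  by apply/seteqP; split => y //= [wA' _]; apply: wA; exact: mem_set.
Qed.

End indep_cond_exp.

(** A Markov process asks for a kernel at all real s and t; clamping keeps the innovations
    measurable outside the time interval too. *)
Definition clamp (R : realType) (t : R) : R := Num.max 0 (Num.min 1 t).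

Definition innovation (R : realType) (Omega : Type) (M : R -> Omega -> R) (s t : R)
    (b : bool) (w : Omega) : R :=
  lin (innovation_comb (clamp s) (clamp t) b) (with_area M ^~ w).

Definition bridge_step (R : realType) (s t : R) (p : (R * R) * (R * R)) : R * R :=
  (transition_coef true true s t * p.1.1 + transition_coef true false s t * p.1.2 + p.2.1,
   transition_coef false true s t * p.1.1 + transition_coef false false s t * p.1.2 + p.2.2).

Section bridge_markov.
Context {R : realType} {d} {Omega : measurableType d} {P : probability Omega R}
  {M : R -> Omega -> R}.
Local Notation S01 := [set j : bool * R | 0 <= j.2 <= 1].
Local Notation T01 := (`[0, 1]%classic : set R).
Hypothesis gM : gaussian_family S01 P (with_area M) (@bridge_area_cov R).
Let X s w := (M s w, area M s w).
Let G s t w := (innovation M s t true w, innovation M s t false w).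

Let clamp01 (t : R) : 0 <= clamp t <= 1.
Proof. by rewrite /clamp le_max lexx/= ge_max ler01/= ge_min lexx. Qed.

Let clamp_id (t : R) : 0 <= t <= 1 -> clamp t = t.
Proof. by move=> /andP[t0 t1]; rewrite /clamp (min_idPr t1) (max_idPr t0). Qed.

Let supported_innovation s t b : supported S01 (innovation_comb (clamp s) (clamp t) b).
Proof. by rewrite /supported/= !mem_set//=; exact: clamp01. Qed.

Let mMA j : S01 j -> measurable_fun setT (with_area M j).
Proof. by case: gM => mM _; exact: mM. Qed.

Lemma measurable_bridge_area s : 0 <= s <= 1 -> measurable_fun setT (X s).
Proof.
by move=> s01; apply: measurable_fun_pair; [exact: (@mMA (true, s) s01)|exact: (@mMA (false, s) s01)].
Qed.

Let mGb s t b : measurable_fun setT (innovation M s t b).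
Proof. by case: gM => mM _; apply: measurable_lin mM _; exact: supported_innovation. Qed.

Let mG s t : measurable_fun setT (G s t).
Proof. by apply: measurable_fun_pair; exact: mGb. Qed.

Lemma measurable_bridge_step s t : measurable_fun setT (@bridge_step R s t).
Proof.
have m1 : measurable_fun setT (fun p : (R * R) * (R * R) => p.1.1).
  exact: (measurableT_comp measurable_fst measurable_fst).
have m2 : measurable_fun setT (fun p : (R * R) * (R * R) => p.1.2).
  exact: (measurableT_comp measurable_snd measurable_fst).
have m3 : measurable_fun setT (fun p : (R * R) * (R * R) => p.2.1).
  exact: (measurableT_comp measurable_fst measurable_snd).
have m4 : measurable_fun setT (fun p : (R * R) * (R * R) => p.2.2).
  exact: (measurableT_comp measurable_snd measurable_snd).
by apply: measurable_fun_pair; apply: measurable_funD => //;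
   apply: measurable_funD; apply: measurable_funM.
Qed.

Let stepE s t w : 0 <= s <= 1 -> 0 <= t <= 1 ->
  bridge_step (clamp s) (clamp t) (X s w, G s t w) = X t w.
Proof.
move=> s01 t01; rewrite /G /innovation !clamp_id// /bridge_step/= /innovation_comb.
by rewrite !lin_cons !lin_nil /with_area/= /X /area; congr pair; ring.
Qed.

Let indepG s t : 0 <= s -> s <= t -> t <= 1 -> forall A B,
  sigma_of (T01 `&` `]-oo, s]) X A -> measurable B ->
  P (A `&` G s t @^-1` B) = (P A * P (G s t @^-1` B))%E.
Proof.
move=> s0 st t1 A B sA mB.
have s1 := le_trans st t1.
have t0 := le_trans s0 st.
pose Ss := [set j : bool * R | 0 <= j.2 <= s].
have SsS : Ss `<=` S01 by move=> j /andP[j0 js]; rewrite /= j0 (le_trans js s1).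
have ind : trig_indep P Ss (with_area M) setT (innovation M s t).
  have := @gaussian_family_indep _ _ _ P _ _ _ S01 Ss setT (with_area M)
    (@bridge_area_cov R) (fun j => [:: (1, j)]) (fun b => innovation_comb (clamp s) (clamp t) b)
    gM (@bridge_area_covC R).
  have -> : (fun j w => lin [:: (1, j)] (with_area M ^~ w)) = with_area M.
    by apply/funext => j; apply/funext => w; rewrite lin_seq1 mul1r.
  apply => //.
    by move=> j Sj; rewrite /supported/= mem_set//; exact: SsS.
  move=> [b' u] b /andP[/= u0 us] _; rewrite !clamp_id ?s0 ?s1 ?t0//.
  exact: innovation_orth.
have mSs j : Ss j -> measurable_fun setT (with_area M j) by move=> Sj; exact/mMA/SsS.
apply: (trig_indep_sets mSs (fun b _ => mGb s t b) ind).
  apply: sigma_of_sub sA => u [/= u01 us].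
  have Su b : Ss (b, u) by move: u01 us; rewrite !in_itv/= /Ss/= => /andP[-> _] ->.
  apply: measurable_fun_pair.
    exact: (@sigma_type_measurable _ Omega _ _ _ Ss (with_area M) (true, u) (Su true)).
  exact: (@sigma_type_measurable _ Omega _ _ _ Ss (with_area M) (false, u) (Su false)).
apply: sigma_of_preimage mB; apply: measurable_fun_pair.
  exact: (@sigma_type_measurable _ _ _ _ _ setT (innovation M s t) true).
exact: (@sigma_type_measurable _ _ _ _ _ setT (innovation M s t) false).
Qed.

Lemma bridge_area_markov : markov_process T01 P X.
Proof.
exists (fun s t => random_map (law P (mG s t)) (@measurable_bridge_step (clamp s) (clamp t))).
have T01P t : T01 t -> 0 <= t <= 1 by rewrite /= in_itv.
split=> [t /T01P|s t /T01P s01 /T01P t01 st B mB].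
  exact: measurable_bridge_area.
pose Ts := T01 `&` `]-oo, s].
have Tss : Ts s by split => /=; rewrite in_itv//=.
have mXs u : Ts u -> measurable_fun setT (X u).
  by move=> [/T01P u01 _]; exact: measurable_bridge_area.
have := @indep_cond_exp _ _ _ P _ _ _ Ts X mXs _ _ _ _ _ _ (X s) (G s t)
  (@bridge_step R (clamp s) (clamp t)) (@sigma_type_measurable _ Omega _ _ _ Ts X s Tss) (mG s t)
  (@measurable_bridge_step (clamp s) (clamp t)).
have -> : (fun w => bridge_step (clamp s) (clamp t) (X s w, G s t w)) = X t.
  by apply/funext => w; exact: stepE.
apply => //.
by apply: indepG => //; [case/andP: s01|case/andP: t01].
Qed.

End bridge_markov.

(** * Failure of time homogeneity *)

Section null_sets.
Context {R : realType}.
Local Notation mu := (@lebesgue_measure R).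

Lemma ge0_integral_eq0_ae d (T : measurableType d) (nu : {measure set T -> \bar R})
    (D : set T) (f : T -> \bar R) : measurable D -> measurable_fun D f ->
  (forall x, D x -> (0 <= f x)%E) -> (\int[nu]_(x in D) f x = 0)%E ->
  {ae nu, forall x, D x -> f x = 0%E}.
Proof.
move=> mD mf f0 i0; have [h _] := ae_eq_integral_abs nu mD mf; apply: h.
by rewrite -[RHS]i0; apply: eq_integral => x /set_mem Dx; rewrite gee0_abs// f0.
Qed.

(** The density is positive everywhere, so its integral over B can vanish only if B is null. *)
Lemma normal_prob_null (m s : R) (B : set (measurableTypeR R)) : s != 0 ->
  measurable B -> normal_prob m s B = 0%E -> mu B = 0%E.
Proof.
move=> s0 mB B0.
have mf : measurable_fun B (fun x => (normal_pdf m s x)%:E).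
  apply: measurable_funTS; apply/measurable_EFinP; exact: measurable_normal_pdf.
have /= := @ge0_integral_eq0_ae _ _ mu B _ mB mf _ B0.
move=> h; apply/(negligibleP mu mB).
have {h} : {ae mu, forall x, B x -> (normal_pdf m s x)%:E = 0%E}.
  by apply: h => x _; rewrite lee_fin normal_pdf_ge0.
apply: negligibleS => x Bx /= /(_ Bx)[] /eqP.
by rewrite normal_pdfE// mulf_eq0 !gt_eqF ?normal_peak_gt0// expR_gt0.
Qed.

Lemma lebesgue_measure_shift (c : R) (A : set (measurableTypeR R)) : measurable A ->
  mu ((fun y => c + y) @^-1` A) = mu A.
Proof.
move=> mA; have mc : measurable_fun setT (fun y : measurableTypeR R => c + y : measurableTypeR R).
  exact: measurable_funD.
rewrite -[LHS]/(pushforward mu (fun y : measurableTypeR R => c + y : measurableTypeR R) A).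
apply/esym/lebesgue_measure_unique => //= _ [[a b]] _ <-.
rewrite /pushforward (_ : _ @^-1` _ = `]a - c, b - c]%classic).
  rewrite !lebesgue_measure_itv/= !lte_fin ltrD2r; case: ifPn => // _.
  by rewrite -!EFinD; congr EFin; ring.
by apply/seteqP; split => x /=; rewrite !in_itv/= ltrBlDl lerBrDl.
Qed.

End null_sets.

Section bridge_not_homogeneous.
Context {R : realType} {d} {Omega : measurableType d} {P : probability Omega R}
  {M : R -> Omega -> R}.
Local Notation S01 := [set j : bool * R | 0 <= j.2 <= 1].
Local Notation T01 := (`[0, 1]%classic : set R).
Local Notation mu := (@lebesgue_measure R).
Hypothesis gM : gaussian_family S01 P (with_area M) (@bridge_area_cov R).
Let X s w := (M s w, area M s w).

Let mlin l : supported S01 l -> measurable_fun setT (fun w => lin l (with_area M ^~ w)).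
Proof. by case: gM => mM _; exact: measurable_lin. Qed.

Lemma gaussian_comb_null l (B : set R) : supported S01 l ->
  0 < cov_lin (@bridge_area_cov R) l l -> measurable B ->
  P [set w | B (lin l (with_area M ^~ w))] = 0%E <-> mu B = 0%E.
Proof.
move=> Sl v0 mB; rewrite (gaussian_family_law gM Sl mB).
have s0 : Num.sqrt (cov_lin (@bridge_area_cov R) l l) != 0 by rewrite sqrtr_eq0 -ltNge.
rewrite (negbTE s0); split; first exact: normal_prob_null.
by move: mB; apply: (proj1 (null_content_dominatesP _ mu) (normal_prob_dominates _ _)).
Qed.

(** M_s and the residual of J_s are independent and nondegenerate, so Fubini yields null sections
    for almost every value of M_s, first for their Gaussian laws and then for Lebesgue measure. *)
Lemma bridge_area_null s (S : set (R * R)) : 0 < s < 1 -> measurable S ->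
  P [set w | S (X s w)] = 0%E -> {ae mu, forall x, mu (xsection S x) = 0%E}.
Proof.
move=> s01 mS S0; have /andP[sgt0 slt1] := s01.
pose l : seq (R * (bool * R)) := [:: (1, (true, s))].
have Ss b : S01 (b, s) by rewrite /= !ltW.
have Sl : supported S01 l by rewrite /supported/= mem_set.
have Sr : supported S01 (area_residual s) by rewrite /supported/= !mem_set.
pose U w := lin l (with_area M ^~ w).
pose V w := lin (area_residual s) (with_area M ^~ w).
pose c := bridge_area_cov (true, s) (false, s) / bridge_area_cov (true, s) (true, s).
have mU : measurable_fun setT U by exact: mlin.
have mV : measurable_fun setT V by exact: mlin.
have ind : forall A B, measurable A -> measurable B ->
    P (U @^-1` A `&` V @^-1` B) = (P (U @^-1` A) * P (V @^-1` B))%E.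
  move=> A B mA mB.
  have := @gaussian_family_indep _ _ _ P _ unit unit S01 setT setT (with_area M)
    (@bridge_area_cov R) (fun=> l) (fun=> area_residual s)
    gM (@bridge_area_covC R) (fun _ _ => Sl) (fun _ _ => Sr)
    (fun _ _ _ _ => area_residual_orth s01).
  move=> /(trig_indep_sets (fun _ _ => mU) (fun _ _ => mV)); apply.
    by apply: sigma_of_preimage mA; exact: (@sigma_type_measurable _ _ _ _ _ setT (fun=> U) tt).
  by apply: sigma_of_preimage mB; exact: (@sigma_type_measurable _ _ _ _ _ setT (fun=> V) tt).
(* The set [S] in the coordinates (U, V): J_s = c U + V. Its sections are translates of those of
   [S], hence the appeal to translation invariance below. *)
pose S' := [set p : R * R | S (p.1, c * p.1 + p.2)].
have mS' : measurable S'.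
  have : measurable_fun setT (fun p : R * R => (p.1, c * p.1 + p.2)).
    apply: measurable_fun_pair => //; apply: measurable_funD => //.
    exact: measurable_funM.
  by move=> /(_ measurableT S mS); rewrite setTI.
have i0 : (\int[law P mU]_x law P mV (xsection S' x) = 0)%E.
  rewrite -[LHS]/((law P mU \x law P mV)%E S') -(law_indep_pair mU mV ind mS') -[RHS]S0.
  congr (P _); apply/seteqP; split => w.
    rewrite /preimage/= /S'/= /U /V /area_residual !lin_cons !lin_nil/= -/c.
    by congr (S (_, _)); rewrite /with_area/= /area; ring.
  rewrite /preimage/= /S'/= /U /V /area_residual !lin_cons !lin_nil/= -/c.
  by congr (S (_, _)); rewrite /with_area/= /area; ring.
have mh := measurable_fun_xsection (law P mV) mS'.
have h0 := ge0_integral_eq0_ae measurableT mh (fun x _ => measure_ge0 _ _) i0.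
pose N : set R := [set x | law P mV (xsection S' x) <> 0%E].
have mN : measurable N.
  have := mh measurableT (~` [set 0%E]) (measurableC (emeasurable_set1 0%E)).
  by rewrite setTI.
have N0 : law P mU N = 0%E.
  apply/(negligibleP _ mN); apply: negligibleS h0 => x /= Nx /(_ I); exact: Nx.
have v1 : 0 < cov_lin (@bridge_area_cov R) l l.
  by rewrite /cov_lin !lin_seq1/= !mul1r; exact: bridge_var_gt0.
have {}N0 : mu N = 0%E by apply/(gaussian_comb_null Sl v1 mN).
exists N; split => // x /= nx Nx; apply: nx.
have mSx : measurable (xsection S x) by exact: measurable_xsection.
rewrite -(lebesgue_measure_shift (c * x) mSx).
have -> : (fun y => c * x + y) @^-1` xsection S x = xsection S' x.
  by apply/seteqP; split => y; rewrite /xsection/= !inE.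
apply/(gaussian_comb_null Sr (area_residual_var_gt0 s01)); first exact: measurable_xsection.
exact: Nx.
Qed.

Lemma bridge_area_not_homogeneous : ~ time_homogeneous_markov_process T01 P X.
Proof.
move=> [q [mX hq]].
pose B : set (R * R) := [set x | x.1 = 0].
have mB : measurable B.
  have := @measurable_fst _ _ R R measurableT [set (0 : R)] (measurable_set1 0).
  by rewrite setTI.
have q1 (x : R * R) : (q (2^-1)%R x B <= 1)%E.
  by rewrite -(@prob_kernel _ _ _ _ _ (q 2^-1) x) le_measure// inE.
have qfin x : q 2^-1 x B \is a fin_num.
  by rewrite ge0_fin_numE//; exact: le_lt_trans (q1 x) (ltry 1).
pose h x := fine (q 2^-1 x B).
have mh : measurable_fun setT h by apply: measurableT_comp => //; exact: measurable_kernel.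
have h0 x : 0 <= h x by exact: fine_ge0.
have h1 x : h x <= 1.
  by rewrite -lee_fin fineK.
have mXs s : 0 <= s <= 1 -> measurable_fun setT (X s) by move=> s01; exact: (measurable_bridge_area gM s01).
have T01P t : 0 <= t <= 1 -> T01 t by rewrite /= in_itv.
have hE s : 0 <= s -> s + 2^-1 <= 1 ->
    (\int[P]_w (h (X s w))%:E)%E = P [set w | M (s + 2^-1) w = 0].
  move=> s0 s1.
  have ss : 0 <= s <= 1 by lra.
  have tt : 0 <= s + 2^-1 <= 1 by lra.
  have st : s <= s + 2^-1 by lra.
  have [_ _ _ E] := hq s (s + 2^-1) (T01P _ ss) (T01P _ tt) st B mB.
  have sT : sigma_of (T01 `&` `]-oo, s]) X setT.
    exact: (@measurableT _ (sigma_type (T01 `&` `]-oo, s]) X)).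
  have := E setT sT; rewrite integral_indic ?setIT//; last first.
    by rewrite -[X in measurable X]setTI; exact: mXs.
  by rewrite (_ : s + 2^-1 - s = 2^-1); [move=> <-|ring].
(* The states from which {0} x R is reached with probability 1 after time 1/2. Almost surely X is in
   [C] at time 1/2, as M_1 = 0, and outside [C] at time 1/4, as M at time 3/4 has a density. *)
pose C := [set x | h x = 1].
have mC : measurable C.
  by have := mh measurableT [set (1 : R)] (measurable_set1 1); rewrite setTI.
have mhX s : 0 <= s <= 1 -> measurable_fun setT (fun w => h (X s w)).
  by move=> s01; exact: (measurableT_comp mh (mXs _ s01)).
have ae_set s (D : set (R * R)) : 0 <= s <= 1 -> measurable D ->
    {ae P, forall w, ~ D (X s w)} -> P [set w | D (X s w)] = 0%E.
  move=> s01 mD ae; apply: measure_negligible.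
    by rewrite -[X in measurable X]setTI; exact: mXs.
  by apply: negligibleS ae => w Dw /=; apply.
have half : 2^-1 + 2^-1 = 1 :> R by field.
have quarter : 0 < 4^-1 :> R by rewrite invr_gt0.
have quarter1 : 4^-1 < 1 :> R by rewrite invf_lt1// ltr1n.
have half0 : 0 < 2^-1 :> R by rewrite invr_gt0.
have half1 : 2^-1 < 1 :> R by rewrite invf_lt1// ltr1n.
have C1 : P [set w | (~` C) (X 2^-1 w)] = 0%E.
  have s01 : 0 <= (2^-1 : R) <= 1 by rewrite !ltW.
  apply: ae_set => //; first exact: measurableC.
  have M1 : P [set w | M (2^-1 + 2^-1) w = 0] = 1%E.
    have S1 : S01 (true, 1) by rewrite /= ler01 lexx.
    have Sl : supported S01 [:: (1 : R, (true, 1 : R))] by rewrite /supported/= mem_set.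
    have := gaussian_family_law gM Sl (measurable_set1 0).
    have -> : cov_lin (@bridge_area_cov R) [:: (1 : R, (true, 1 : R))] [:: (1 : R, (true, 1 : R))] = 0.
      rewrite /cov_lin !lin_seq1/= !mul1r bridge_area_cov_value ?ler01 ?lexx//.
      by rewrite /bridge_cov minxx; ring.
    rewrite sqrtr0 eqxx diracE mem_set// half => <-.
    by congr (P _); apply/seteqP; split => w /=; rewrite lin_seq1/= mul1r.
  have iC : (\int[P]_w (1 - h (X (2^-1)%R w))%:E = 0)%E.
    under eq_integral do rewrite EFinB.
    have ih : P.-integrable setT (EFin \o (fun w => h (X 2^-1 w))).
      apply: bounded_mfun_integrable; split; first exact: mhX.
      by exists 1 => w; rewrite ger0_norm.
    rewrite integralB//; last exact: (bounded_mfun_integrable P (bounded_mfun_cst 1)).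
    rewrite (hE _ (ltW half0)); last by rewrite half.
    rewrite M1 integral_cst// mul1e -[X in (_ - X)%E](probability_setT P).
    by apply: subee; exact: fin_num_measure.
  have := ge0_integral_eq0_ae measurableT _ _ iC.
  move=> H; have {}H := H _ _.
  have : {ae P, forall w, setT w -> (1 - h (X 2^-1 w))%:E = 0%E}.
    apply: H; first by apply/measurable_EFinP; apply: measurable_funB => //; exact: mhX.
    by move=> w _; rewrite lee_fin subr_ge0.
  by apply: filterS => w /(_ I)[] /eqP; rewrite subr_eq0 /C/= => /eqP e; apply.
have C0 : P [set w | C (X 4^-1 w)] = 0%E.
  have s01 : 0 <= (4^-1 : R) <= 1 by rewrite !ltW.
  apply: ae_set => //.
  have t01 : 0 < (4^-1 + 2^-1 : R) < 1 by lra.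
  have i0 : (\int[P]_w (h (X (4^-1)%R w))%:E = 0)%E.
    rewrite hE ?ltW//; [|by case/andP: t01].
    have S1 : S01 (true, 4^-1 + 2^-1) by rewrite /= !ltW//; case/andP: t01.
    have Sl : supported S01 [:: (1 : R, (true, 4^-1 + 2^-1 : R))] by rewrite /supported/= mem_set.
    have v1 : 0 < cov_lin (@bridge_area_cov R) [:: (1 : R, (true, 4^-1 + 2^-1 : R))]
        [:: (1 : R, (true, 4^-1 + 2^-1 : R))].
      by rewrite /cov_lin !lin_seq1/= !mul1r; exact: bridge_var_gt0.
    have [_] := gaussian_comb_null Sl v1 (measurable_set1 0).
    move=> /(_ (lebesgue_measure_set1 _)) <-.
    by congr (P _); apply/seteqP; split => w /=; rewrite lin_seq1/= mul1r.
  have : {ae P, forall w, setT w -> (h (X 4^-1 w))%:E = 0%E}.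
    apply: ge0_integral_eq0_ae i0 => //.
      by apply/measurable_EFinP; exact: mhX.
    by move=> w _; rewrite lee_fin.
  apply: filterS => w /(_ I)[]; rewrite /C/= => -> /eqP.
  by rewrite eq_sym oner_eq0.
have N1 := bridge_area_null (andb_true_intro (conj half0 half1)) (measurableC mC) C1.
have N0 := bridge_area_null (andb_true_intro (conj quarter quarter1)) mC C0.
(* For almost every x both the section of [C] and its complement are null, hence so is the line. If
   there were no such x, the line would be a union of two null sets; either way its measure would be
   0. *)
have E0 : mu setT = 0%E.
  apply/(negligibleP mu measurableT); apply: negligibleS (negligibleU N1 N0) => x _.
  have [m0|] := pselect (mu (xsection C x) = 0%E); last by right.
  left => /= m1; have : mu setT = 0%E.
    rewrite -(setvU (xsection C x)).
    rewrite measureU0//; [|exact/measurableC/measurable_xsection|exact: measurable_xsection].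
    rewrite -[RHS]m1; congr (mu _); apply/seteqP.
    by split => y; rewrite /xsection/setC/= !inE.
  by rewrite -set_itvNyy lebesgue_measure_itv.
by move: E0; rewrite -set_itvNyy lebesgue_measure_itv.
Qed.

End bridge_not_homogeneous.

(** * Passing to an arbitrary zero area bridge *)

Section zero_area_bridge_law.
Context {R : realType} {d} {Omega : measurableType d} {P : probability Omega R}
  {W : R -> Omega -> R}.
Hypothesis hW : brownian_motion `[0, 1] P W.
Context {d'} {Omega' : measurableType d'} {P' : probability Omega' R}
  {M : R -> Omega' -> R}.
Hypothesis zM : zero_area_bridge P W P' M.
Local Notation S01 := [set j : bool * R | 0 <= j.2 <= 1].
Local Notation T01 := (`[0, 1]%classic : set R).
Local Notation N := (anticipative_bridge W).

Let W_gaussian : gaussian_family T01 P W (fun s t => Num.min s t).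
Proof.
have T0 : T01 0 by rewrite /= in_itv/= lexx ler01.
have T_ge0 t : T01 t -> 0 <= t by rewrite /= in_itv/= => /andP[].
exact: brownian_gaussian T0 T_ge0 hW.
Qed.

Lemma anticipative_area_gaussian :
  gaussian_family S01 P (with_area N) (@bridge_area_cov R).
Proof.
have [[_ cW] W0 _ _] := hW.
apply: bridge_area_gaussian => //; apply: (brownian_area_gaussian (T := T01)) => //.
Qed.

(** The law of M at finitely many times is that of N; areas are path functionals with density 1 and
    no point evaluation, so the joint law with the areas transfers too. *)
Lemma zero_area_bridge_area_gaussian :
  gaussian_family S01 P' (with_area M) (@bridge_area_cov R).
Proof.
have [[mM cM] _ _] := zM.
have [mN cN] := continuous_anticipative hW.
pose p (j : bool * R) : seq (R * R) := if j.1 then [:: (1, j.2)] else [::].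
pose f (j : bool * R) (u : R) : R := if j.1 then 0 else 1.
have cf j : {within `[0, j.2], continuous (f j)}.
  by rewrite /f; case: j.1; exact: within_continuous_cst.
have tT (j : bool * R) u : S01 j -> 0 <= u <= j.2 -> T01 u.
  by move=> /andP[_ j1] /andP[u0 uj]; rewrite /= in_itv/= u0 (le_trans uj j1).
have pT j : S01 j -> supported T01 (p j).
  move=> Sj; rewrite /p; case: j.1 => //; rewrite /supported/= andbT.
  by apply/mem_set; rewrite /= in_itv.
have sub (Om : Type) (X : R -> Om -> R) (j : bool * R) w : S01 j ->
    {within T01, continuous (X^~ w)} -> {within `[0, j.2], continuous (X^~ w)}.
  move=> /andP[_ j1]; apply: within_continuous_sub.
  by apply: subset_itvl; rewrite bnd_simp.
have pE (Om : Type) (X : R -> Om -> R) :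
    (fun j w => path_functional (p j) j.2 (f j) (X^~ w)) = with_area X.
  apply/funext => -[[] s]; apply/funext => w; rewrite /path_functional/with_area/p/f/=.
    rewrite lin_seq1/= mul1r (_ : \int[_]_(u in _) _ = 0) ?addr0//.
    by under eq_Rintegral do rewrite mulr0; rewrite Rintegral_cst ?mul0r.
  by rewrite lin_nil add0r; apply: eq_Rintegral => u _; rewrite mulr1.
apply: (gaussian_family_transfer anticipative_area_gaussian).
  move=> j Sj; rewrite -pE.
  apply: (measurable_path_functional (T := T01)) => //.
  - by move=> u; exact: tT.
  - exact: pT.
  - by move=> w; exact: sub.
rewrite -!pE; apply: (same_cf_path_functional (T := T01)) => //.
- by move=> j w Sj; exact: sub.
- by move=> j w Sj; exact: sub.
- exact: zero_area_bridge_same_cf.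
Qed.

Let halfopen_sub : (`[0, 1[ : set R) `<=` T01.
Proof. by apply: subset_itvl; rewrite bnd_simp. Qed.

Lemma zero_area_bridge_gaussian : gaussian_family (`[0, 1[ : set R) P' M (@bridge_cov R).
Proof.
have := gaussian_family_lin zero_area_bridge_area_gaussian
  (S := `[0, 1[) (l := fun s => [:: (1, (true, s))]).
have -> : (fun (s : R) w => lin [:: (1, (true, s))] (with_area M ^~ w)) = M.
  by apply/funext => s; apply/funext => w; rewrite lin_seq1 mul1r.
have T1 (s : R) : (`[0, 1[%classic : set R) s -> 0 <= s <= 1.
  by move=> /halfopen_sub; rewrite /= in_itv.
move=> g; apply: gaussian_family_cov (g _).
  by move=> s t /T1 s01 /T1 t01; rewrite /cov_lin !lin_seq1/= !mul1r bridge_area_cov_value.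
by move=> s /T1 s01; rewrite /supported/= mem_set.
Qed.

Lemma brownian_halfopen :
  gaussian_family (`[0, 1[ : set R) P W (fun s t => Num.min s t).
Proof.
have [mW XC] := W_gaussian.
split=> [t Tt|s phi Ts]; first exact/mW/halfopen_sub.
apply: XC; apply: sub_all Ts => p /set_mem Tp; exact/mem_set/halfopen_sub.
Qed.

End zero_area_bridge_law.

Theorem mainTheorem8 (R : realType)
    (d : measure_display) (Omega : measurableType d) (P : probability Omega R)
    (W : R -> Omega -> R) (hW : brownian_motion `[0, 1] P W) :
  let N := fun (s : R) (w : Omega) =>
    W s w - s * (3 * s - 2) * W 1 w - 6 * s * (1 - s) * area W 1 w in
  (* (1): N is a zero area Brownian bridge *)
  zero_area_bridge P W P N /\
  forall (d' : measure_display) (Omega' : measurableType d')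
    (P' : probability Omega' R) (M : R -> Omega' -> R),
  zero_area_bridge P W P' M ->
  [/\ (* (1): equality in law *)
      same_law `[0, 1] P N P' M,
      (* (2): M satisfies the equation for some Brownian motion *)
      (exists W' : R -> Omega' -> R,
         [/\ brownian_motion `[0, 1[ P' W',
             bridge_sde P' W' M &
             adapted_to `[0, 1[ W' M]),
      (* (2): for every Brownian motion, the equation has a non-anticipative
         solution, and all solutions have the law of M *)
      (forall (d2 : measure_display) (Omega2 : measurableType d2)
         (P2 : probability Omega2 R) (W2 : R -> Omega2 -> R),
         brownian_motion `[0, 1[ P2 W2 ->
         (exists M2 : R -> Omega2 -> R,
            bridge_sde P2 W2 M2 /\ adapted_to `[0, 1[ W2 M2) /\
         (forall M2 : R -> Omega2 -> R, bridge_sde P2 W2 M2 ->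
            same_law `[0, 1[ P2 M2 P' M)) &
      (* (3): Markov, and not time-homogeneous *)
      (let X := fun (s : R) (w : Omega') => (M s w, area M s w) in
       markov_process `[0, 1] P' X /\
       ~ time_homogeneous_markov_process `[0, 1] P' X)].
Proof.
move=> N; split; first exact: zero_area_bridge_anticipative hW.
move=> d' Omega' P' M zM.
have sub1 : (`[0, 1[ : set R) `<=` `[0, 1].
  by apply: subset_itvl; rewrite bnd_simp.
have T1_ge0 (t : R) : `[0, 1[%classic t -> 0 <= t by rewrite /= in_itv/= => /andP[].
have T1_0 : (`[0, 1[%classic : set R) 0 by rewrite /= in_itv/= lexx ltr01.
have [[mM cM] _ _] := zM.
have gA := zero_area_bridge_area_gaussian hW zM.
have gM := zero_area_bridge_gaussian hW zM.
have mM1 t : `[0, 1[%classic t -> measurable_fun setT (M t) by move=> /sub1; exact: mM.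
have cM1 w : {within `[0, 1[, continuous (M^~ w)}.
  exact: within_continuous_sub sub1 (cM w).
split.
- exact: (zero_area_bridge_same_law hW).
- have [[mW cW] W0 _ _] := hW.
  (* The given W, restricted to [0, 1[, is the reference Brownian motion whose law the noise
     extracted from M inherits. *)
  exists (fun s w => noise_of (M^~ w) s); split.
  + apply: (@noise_of_brownian _ _ _ P W _ _ W0 (brownian_halfopen hW)) => //.
    * by move=> t /sub1; exact: mW.
    * by move=> w; exact: within_continuous_sub sub1 (cW w).
  + exact: noise_of_sde.
  + exact: noise_of_adapted.
- move=> d2 Omega2 P2 W2 hW2.
  have [[mW2 cW2] W20 _ _] := hW2.
  have gW2 := brownian_gaussian T1_0 T1_ge0 hW2.
  split.
    exists (fun s w => bridge_of (W2^~ w) s); split.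
      exact: bridge_of_sde.
    exact: bridge_of_adapted.
  move=> M2 sM2; apply: same_law_of_cf => //; first by case: sM2 => -[].
  exact: gaussian_family_same_cf (bridge_sde_gaussian cW2 W20 gW2 sM2) gM.
- split; first exact: bridge_area_markov.
  exact: bridge_area_not_homogeneous.
Qed.
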